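(* Let $\mathbf{K}$ be $\mathbf{R}$ or $\mathbf{C}$. Fix $\alpha,\beta\in[0,1]$ and, for every $n$, integers $0\leq k_n,l_n\leq n$ such that $\lim k_n/n=\alpha$ and $\lim l_n/n=\beta$. Set $r_n=\min(k_n,l_n,n-k_n,n-l_n)$ and $\phi_\pm=\alpha+\beta-2\alpha\beta\pm 2\sqrt{\alpha\beta(1-\alpha)(1-\beta)}$. For each $n$, let $E_n\in\mathsf{G}_{n,k_n}$ and $F_n\in\mathsf{G}_{n,l_n}$ be independent Haar-distributed random subspaces of $\mathbf{K}^n$, and let $(\theta_i^n)_{1\leq i\leq r_n}$ be the nonzero principal angles between $E_n$ and $F_n$. Then, as $n\to\infty$, the random measures $$\frac1n\sum_{i=1}^{r_n}\delta_{\theta_i^n}$$ converge weakly in probability towards the measure supported on $[\arccos\sqrt{\phi_+},\arccos\sqrt{\phi_-}]$ with density $$s(\theta)=\frac{\sqrt{(\phi_+-\cos^2\theta)(\cos^2\theta-\phi_-)}}{\pi\sin\theta\cos\theta}$$ on that interval. The total mass of this limit measure equals $\min(\alpha,\beta,1-\alpha,1-\beta)$.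
   Context: $\mathbf{K}^n$ carries its usual inner product. $\mathsf{G}_{n,k}$ is the Grassmann manifold of all $k$-dimensional subspaces of $\mathbf{K}^n$; its Haar measure is the unique rotation-invariant probability measure on it (equivalently, the law of the span of $k$ independent standard Gaussian vectors in $\mathbf{K}^n$). Principal angles: for $E\in\mathsf{G}_{n,k}$ and $F\in\mathsf{G}_{n,l}$ there exist an orthonormal basis $(e_i)_{1\leq i\leq k}$ of $E$, an orthonormal basis $(f_j)_{1\leq j\leq l}$ of $F$, and numbers $\theta_1\leq\dots\leq\theta_{\min(k,l)}$ in $[0,\pi/2]$ such that $\langle e_i,f_j\rangle=0$ for $i\neq j$ and $\langle e_i,f_i\rangle=\cos\theta_i$. The numbers $\theta_i$ are uniquely determined by $E,F$ and are called the principal angles between $E$ and $F$ (counted with multiplicity). For independent Haar-distributed $E\in\mathsf{G}_{n,k}$, $F\in\mathsf{G}_{n,l}$, the number of nonzero principal angles is almost surely $\min(k,l,n-k,n-l)$, so the variables $(\theta_i^n)_{1\leq i\leq r_n}$ are almost surely well defined. Convergence of a sequence of random measures means weak convergence in probability. $\delta_x$ is the Dirac mass at $x$. The density is with respect to Lebesgue measure; when $\phi_-=\phi_+$ the limit measure is the zero measure. *)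

(* Defs.v *)
From HB Require Import structures.
From mathcomp Require Import all_boot all_order all_algebra.
From mathcomp Require Import complex.
From mathcomp Require Import all_classical all_reals all_analysis.
From mathcomp Require Import measurable_realfun ring lra.

Set Implicit Arguments.
Unset Strict Implicit.
Unset Printing Implicit Defensive.

Import Order.TTheory GRing.Theory Num.Theory.
Import numFieldNormedType.Exports.

Local Open Scope classical_set_scope.
Local Open Scope ring_scope.
Local Open Scope complex_scope.

Variant scalar_kind := RealScalars | ComplexScalars.

Section scalars.
Context (R : realType).

Definition scalar_field (s : scalar_kind) : numFieldType :=
  match s with RealScalars => R | ComplexScalars => R[i] end.

Definition sconj (s : scalar_kind) : scalar_field s -> scalar_field s :=
  match s with RealScalars => id | ComplexScalars => @conjc R end.

Definition of_real (s : scalar_kind) : R -> scalar_field s :=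
  match s with RealScalars => id | ComplexScalars => fun x => x%:C end.

End scalars.

(* Vectors of K^n are row vectors, so matrices act on the right. *)
Section inner_product.
Context (R : realType) (s : scalar_kind) (n : nat).
Local Notation K := (scalar_field R s).

Definition inner (x y : 'rV[K]_n) : K := \sum_(i < n) x 0 i * sconj (y 0 i).

Definition adjoint m p (A : 'M[K]_(m, p)) : 'M[K]_(p, m) :=
  (map_mx (@sconj R s) A)^T.

(* Orthogonal matrices over R, unitary matrices over C. *)
Definition unitary_matrix (U : 'M[K]_n) : Prop := U *m adjoint U = 1%:M.

Definition orthonormal_basis (E : {vspace 'rV[K]_n}) k
    (e : k.-tuple 'rV[K]_n) : Prop :=
  basis_of E e /\
  forall i j : 'I_k, inner (tnth e i) (tnth e j) = (i == j)%:R.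

Definition basis_mx (E : {vspace 'rV[K]_n}) : 'M[K]_(\dim E, n) :=
  \matrix_(i < \dim E) tnth (vbasis E) i.

(* Matrix of the orthogonal projection onto E: with B a matrix whose rows form
   a basis of E, it is B^* (B B^* )^-1 B, whatever the basis. *)
Definition proj_mx_on (E : {vspace 'rV[K]_n}) : 'M[K]_n :=
  let B := basis_mx E in adjoint B *m invmx (B *m adjoint B) *m B.

End inner_product.

(* k ranges over {0, ..., n}, so that the Grassmannian is not empty. *)
Section grassmannian.
Context (R : realType) (s : scalar_kind) (n : nat) (k : 'I_n.+1).
Local Notation K := (scalar_field R s).

Definition subspace_of_dim := {E : {vspace 'rV[K]_n} | \dim E == k}.

Lemma dim_coordinate_subspace :
  \dim <<take k (vbasis (fullv : {vspace 'rV[K]_n}))>>%VS == k.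
Proof.
have /eqP -> : free (take k (vbasis (fullv : {vspace 'rV[K]_n}))).
  apply: (@catl_free _ _ (drop k (vbasis (fullv : {vspace 'rV[K]_n})))).
  rewrite cat_take_drop; exact: basis_free (vbasisP _).
by rewrite size_takel // size_tuple dimvf /dim /= mul1n -ltnS.
Qed.

HB.instance Definition _ := Choice.on subspace_of_dim.
HB.instance Definition _ := isPointed.Build subspace_of_dim
  (exist (fun E : {vspace 'rV[K]_n} => \dim E == k) _
    dim_coordinate_subspace).

(* The topology of the Grassmann manifold is the one induced by the embedding
   that maps a subspace to its orthogonal projection. *)
Definition grassmannian_open : set (set subspace_of_dim) :=
  [set (fun E : subspace_of_dim => proj_mx_on (val E)) @^-1` O |
    O in [set O : set 'M[K]_n | open O]].

(* The Grassmannian with its Borel sigma-algebra. *)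
Definition grassmannian := g_sigma_algebraType grassmannian_open.

HB.instance Definition _ := Measurable.on grassmannian.

(* [insubd] never uses its default value here when U is unitary: see
   [val_rotate]. *)
Definition rotate (U : 'M[K]_n) (E : grassmannian) : grassmannian :=
  insubd (E : subspace_of_dim)
    (linfun (mulmxr U) @: val (E : subspace_of_dim))%VS.

Lemma val_rotate U (E : grassmannian) : unitary_matrix U ->
  val (rotate U E : subspace_of_dim) =
    (linfun (mulmxr U) @: val (E : subspace_of_dim))%VS.
Proof.
move=> UU; rewrite /rotate val_insubd ifT// limg_dim_eq.
  exact: (valP (E : subspace_of_dim)).
rewrite (_ : lker _ = 0%VS) ?capv0//; apply/eqP/lker0P => x y.
rewrite !lfunE /= => /(congr1 (mulmxr (adjoint U))) /=.
by rewrite -!mulmxA UU !mulmx1.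
Qed.

Definition is_haar_measure (mu : probability grassmannian R) : Prop :=
  forall U : 'M[K]_n, unitary_matrix U ->
  forall A : set grassmannian, measurable A -> mu (rotate U @^-1` A) = mu A.

End grassmannian.

Definition independent_variables (R : realType) d d1 d2 (T : measurableType d)
    (T1 : measurableType d1) (T2 : measurableType d2) (P : probability T R)
    (X : {mfun T >-> T1}) (Y : {mfun T >-> T2}) : Prop :=
  forall A B, measurable A -> measurable B ->
    P ((X @^-1` A) `&` (Y @^-1` B)) = (P (X @^-1` A) * P (Y @^-1` B))%E.

Definition principal_angles (R : realType) (s : scalar_kind) (n : nat)
    (k l : 'I_n.+1) (E : grassmannian R s k) (F : grassmannian R s l)
    (theta : (minn k l).-tuple R) : Prop :=
  [/\ sorted <=%R theta,
      all (fun t => 0 <= t <= pi / 2) theta &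
      exists (e : k.-tuple 'rV[scalar_field R s]_n)
             (f : l.-tuple 'rV[scalar_field R s]_n),
        [/\ orthonormal_basis (val (E : subspace_of_dim R s k)) e,
            orthonormal_basis (val (F : subspace_of_dim R s l)) f &
            forall (i : 'I_k) (j : 'I_l), inner (tnth e i) (tnth f j) =
              if i == j :> nat then of_real s (cos theta`_i) else 0]].

Section angle_measure.
Context (R : realType) (n : nat) (k l : 'I_n.+1).

Definition num_angles : nat := minn (minn k l) (minn (n - k) (n - l)).

(* The list of nonzero angles never has more than [num_angles] elements; on the
   null event where it has fewer, the missing ones are read as 0. *)
Definition angle_measure (theta : (minn k l).-tuple R) : set R -> \bar R :=
  mscale (n%:R^-1)%:nng
    (msum (fun i => \d_([seq t <- theta | t != 0]`_i)) num_angles).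

HB.instance Definition _ theta := Measure.on (angle_measure theta).

End angle_measure.

Section limit_measure.
Context (R : realType) (alpha beta : R).

Definition phi_rad := Num.sqrt (alpha * beta * (1 - alpha) * (1 - beta)).

Definition phi_plus := alpha + beta - 2 * alpha * beta + 2 * phi_rad.
Definition phi_minus := alpha + beta - 2 * alpha * beta - 2 * phi_rad.

Definition limit_density (theta : R) : R :=
  Num.sqrt ((phi_plus - cos theta ^+ 2) * (cos theta ^+ 2 - phi_minus)) /
  (pi * sin theta * cos theta).

Definition limit_support : set R :=
  `[acos (Num.sqrt phi_plus), acos (Num.sqrt phi_minus)].

Hypotheses (ha : 0 <= alpha <= 1) (hb : 0 <= beta <= 1).

(* The bounds on alpha and beta make [limit_density] nonnegative on
   [limit_support], hence [limit_measure] a measure. *)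
Definition limit_measure of 0 <= alpha <= 1 & 0 <= beta <= 1 :
    set R -> \bar R :=
  fun A => (\int[lebesgue_measure]_(theta in A `&` limit_support)
    (limit_density theta)%:E)%E.

Lemma phi_plus_le1 : phi_plus <= 1.
Proof.
case/andP: ha => a0 a1; case/andP: hb => b0 b1.
have x0 : 0 <= alpha * beta by exact: mulr_ge0.
have y0 : 0 <= (1 - alpha) * (1 - beta) by rewrite mulr_ge0 ?subr_ge0.
have := sqr_ge0 (Num.sqrt (alpha * beta) -
  Num.sqrt ((1 - alpha) * (1 - beta))).
rewrite sqrrB !sqr_sqrtr// -mulrnAr mulrnAr -sqrtrM// mulrA.
by rewrite /phi_plus /phi_rad; set r := Num.sqrt _; rewrite -mulr_natl; lra.
Qed.

Lemma phi_minus_ge0 : 0 <= phi_minus.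
Proof.
case/andP: ha => a0 a1; case/andP: hb => b0 b1.
have x0 : 0 <= alpha * (1 - beta) by rewrite mulr_ge0 ?subr_ge0.
have y0 : 0 <= beta * (1 - alpha) by rewrite mulr_ge0 ?subr_ge0.
have := sqr_ge0 (Num.sqrt (alpha * (1 - beta)) -
  Num.sqrt (beta * (1 - alpha))).
rewrite sqrrB !sqr_sqrtr// -sqrtrM//.
rewrite (_ : alpha * (1 - beta) * (beta * (1 - alpha)) =
  alpha * beta * (1 - alpha) * (1 - beta)); last by ring.
by rewrite /phi_minus /phi_rad; set r := Num.sqrt _; rewrite -mulr_natl; lra.
Qed.

Lemma sin_cos_ge0 theta : limit_support theta ->
  0 <= sin theta /\ 0 <= cos theta.
Proof.
have rad0 : 0 <= phi_rad by exact: sqrtr_ge0.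
have pm := phi_minus_ge0; have p1 := phi_plus_le1.
have mp : phi_minus <= phi_plus by rewrite /phi_minus /phi_plus; lra.
have sm1 : Num.sqrt phi_minus <= 1.
  by rewrite -[leRHS]sqrtr1 ler_wsqrtr// (le_trans mp).
have sp1 : Num.sqrt phi_plus <= 1 by rewrite -[leRHS]sqrtr1 ler_wsqrtr.
have sm0 := sqrtr_ge0 phi_minus; have sp0 := sqrtr_ge0 phi_plus.
have bm : -1 <= Num.sqrt phi_minus <= 1 by lra.
have bp : -1 <= Num.sqrt phi_plus <= 1 by lra.
rewrite /limit_support /= in_itv /= => /andP[tl tr].
have t0 : 0 <= theta by apply: le_trans tl; apply: acos_ge0.
have tpi : theta <= pi by apply: (le_trans tr); apply: acos_lepi.
split; first by apply: sin_ge0_pi; rewrite t0.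
apply: (le_trans sm0); rewrite -[leLHS]acosK ?in_itv//.
by rewrite leNgt ltr_cos ?in_itv/= ?t0 ?tpi ?acos_ge0 ?acos_lepi// -leNgt.
Qed.

Lemma limit_density_ge0 theta : limit_support theta ->
  0 <= limit_density theta.
Proof.
move=> /sin_cos_ge0[s0 c0].
by rewrite divr_ge0 ?sqrtr_ge0// !mulr_ge0 ?pi_ge0.
Qed.

Lemma measurable_limit_density : measurable_fun limit_support limit_density.
Proof.
have mcos : measurable_fun [set: R] (@cos R).
  exact: continuous_measurable_fun (@continuous_cos R).
have msin : measurable_fun [set: R] (@sin R).
  exact: continuous_measurable_fun (@continuous_sin R).
pose g theta : R :=
  Num.sqrt ((phi_plus - cos theta ^+ 2) * (cos theta ^+ 2 - phi_minus)) *
  ((pi * sin theta * cos theta) `^ (-1)).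
have mg : measurable_fun limit_support g.
  apply: measurable_funTS; apply: measurable_funM.
    apply: measurableT_comp.
      exact: continuous_measurable_fun (@sqrt_continuous R).
    by apply: measurable_funM; apply: measurable_funB => //;
      exact: measurable_funX.
  apply: (measurableT_comp (measurable_powR _)) => //.
  by do 2 apply: measurable_funM => //.
apply: eq_measurable_fun mg => theta; rewrite inE => /sin_cos_ge0[s0 c0].
by rewrite /g /limit_density powR_inv1// !mulr_ge0 ?pi_ge0.
Qed.

Let limit_measure0 : limit_measure ha hb set0 = 0%E.
Proof. by rewrite /limit_measure set0I integral_set0. Qed.

Let limit_measure_ge0 A : (0 <= limit_measure ha hb A)%E.
Proof.
by apply: integral_ge0 => x [_ Sx]; rewrite lee_fin limit_density_ge0.
Qed.

Let limit_measure_sigma_additive : semi_sigma_additive (limit_measure ha hb).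
Proof.
move=> F mF tF mUF; rewrite /limit_measure; apply: cvg_toP.
  apply: ereal_nondecreasing_is_cvgn => m n mn.
  apply: lee_sum_nneg_natr => // k _ _; exact: limit_measure_ge0.
have mS : measurable limit_support by exact: measurable_itv.
rewrite setI_bigcupl ge0_integral_bigcup//=.
- by move=> i; exact: (measurableI _ _ (mF i) mS).
- apply: (@measurable_funS _ _ _ _ limit_support) => //.
    by move=> x [i _ []].
  by apply/measurable_EFinP; exact: measurable_limit_density.
- by move=> x [i _ [_ Sx]]; rewrite lee_fin limit_density_ge0.
- exact: trivIset_setIr.
Qed.

HB.instance Definition _ := isMeasure.Build _ _ _ (limit_measure ha hb)
  limit_measure0 limit_measure_ge0 limit_measure_sigma_additive.

End limit_measure.

(* Weak convergence in probability of random measures; the n-th one lives on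
   its own probability space. *)
Definition cvg_weakly_in_probability (R : realType) (d : nat -> measure_display)
    (T : forall n, measurableType (d n)) (P : forall n, probability (T n) R)
    (mu : forall n, T n -> {measure set R -> \bar R})
    (nu : {measure set R -> \bar R}) : Prop :=
  forall f : R -> R, continuous f -> (exists M : R, forall x, `|f x| <= M) ->
  forall eps : R, 0 < eps ->
    P n [set w | eps <= `|\int[mu n w]_x f x - \int[nu]_x f x|]
      @[n --> \oo] --> 0%E.

(* Main.v *)
Require Import Defs.
From HB Require Import structures.
From mathcomp Require Import all_boot all_order all_algebra.
From mathcomp Require Import complex.
From mathcomp Require Import all_classical all_reals all_analysis.
From mathcomp Require Import measurable_realfun ring lra zify.

Set Implicit Arguments.
Unset Strict Implicit.
Unset Printing Implicit Defensive.

Import Order.TTheory GRing.Theory Num.Theory.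
Import numFieldNormedType.Exports.

Local Open Scope classical_set_scope.
Local Open Scope ring_scope.

(** Let P and Q be the orthogonal projections onto E and F. For j >= 1 the trace of
   (Q P)^j is the sum of the cos^(2 j) theta_i ([mxtrace_QP]), so that the theorem is
   about normalised traces of words in P and Q.

   The loop equation. Rotating E by a small angle in a coordinate plane (i, j) changes
   neither its law nor its independence of F, so the first variation of any observable
   has mean zero ([mean_loop_derivative]). The observable is the real part of
   tr (A_ij (Q P)^m), with A_ij the infinitesimal rotation, times the difference between
   the m-th moment and a constant kappa. Summed over all planes, its first variation is
   a product of traces of shorter words, up to lower order terms
   ([sum_mxtrace_skew], [sum_loop_derivative]). Rotations with real entries are unitary
   over both scalar fields, and they alone are enough, so that R and C are treated at the
   same time. The result ([mean_loop_sum]) is that E [X_m (M_m - kappa)] = O(1 / n),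
   where M_m is the m-th normalised moment and X_m the defect of a quadratic recursion
   ([loop_defect]) in which M_m occurs linearly, the other terms having lower order. With
   kappa the limit predicted by the recursion, X_m is M_m - kappa up to an error that
   tends to 0 in mean by induction, whence E (M_m - kappa)^2 -> 0: the bias and the
   fluctuations are controlled together ([cvg_in_mean_moment]).

   The limit. The differences of consecutive terms of the solution of this recursion
   satisfy the recursion of the semicircle law of centre
   u = alpha + beta - 2 alpha beta and radius 2 r, with r^2 = alpha beta (1 - alpha) (1 - beta) ([loop_defect_eq0],
   [semicircle_recursion]). The substitutions x = cos^2 theta and x = u + 2 r cos t turn
   cos^2 sin^2 times the density into that law ([density_integral_angle]). This leaves two
   constants, the first moment and its difference with the mass. They are, up to sign, the
   values at 1 and at 0 of the Stieltjes transform of the semicircle law, times r^2; these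
   points may lie at the edge of its support and are approached from outside
   ([limit_moment1], [limit_moment01]).

   The zero angles. At most num_angles of the angles are nonzero, by a rank argument that
   holds for every pair of subspaces ([count_nonzero_angles]). Hence the random measure is
   surely the sum over all the min(k, l) angles minus a deterministic atom at 0
   ([integral_angle_measure]). In the limit this atom has mass max (alpha + beta - 1, 0),
   which is exactly what separates the solution of the recursion from the moments of the
   limit measure ([limit_moment_loop]).

   Convergence of moments in mean extends to continuous functions by polynomial
   approximation in the variable cos^2 ([cos2_polynomial_approximation],
   [cvg_in_mean_approx]), and gives convergence in probability by Markov's inequality. *)

(** * Orthogonal projections and principal angles *)

Section scalars.
Context (R : realType) (s : scalar_kind).
Local Notation K := (scalar_field R s).

Lemma sconj_is_additive : additive (@sconj R s).
Proof. by case: s => // x y; rewrite /= rmorphB. Qed.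

Lemma sconj_is_multiplicative : multiplicative (@sconj R s).
Proof.
by case: s; split; rewrite //=; [exact: rmorphM|exact: conjc1].
Qed.

HB.instance Definition _ := GRing.isAdditive.Build K K (@sconj R s)
  sconj_is_additive.
HB.instance Definition _ := GRing.isMultiplicative.Build K K (@sconj R s)
  sconj_is_multiplicative.

Lemma sconjK : involutive (@sconj R s).
Proof. by case: s => // x; exact: conjcK. Qed.

Lemma of_real_is_additive : additive (@of_real R s).
Proof. by case: s => // x y; rewrite /= rmorphB. Qed.

Lemma of_real_is_multiplicative : multiplicative (@of_real R s).
Proof. by case: s; split => //= x y; exact: rmorphM. Qed.

HB.instance Definition _ := GRing.isAdditive.Build R K (@of_real R s)
  of_real_is_additive.
HB.instance Definition _ := GRing.isMultiplicative.Build R K (@of_real R s)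
  of_real_is_multiplicative.

Lemma sconj_of_real (x : R) : sconj (of_real s x) = of_real s x.
Proof. by case: s => //=; exact: conjc_real. Qed.

Lemma mul_sconj_ge0 (x : K) : 0 <= x * sconj x.
Proof. by case: s x => /= x; [rewrite -expr2 sqr_ge0|exact: mulcJ_ge0]. Qed.

Lemma mul_sconj_eq0 (x : K) : (x * sconj x == 0) = (x == 0).
Proof.
by case: s x => /= x; rewrite mulf_eq0 ?orbb// conjc_eq0 orbb.
Qed.

End scalars.

Section adjoint_theory.
Context (R : realType) (s : scalar_kind).
Local Notation K := (scalar_field R s).

Lemma adjointM m n p (A : 'M[K]_(m, n)) (B : 'M[K]_(n, p)) :
  adjoint (A *m B) = adjoint B *m adjoint A.
Proof. by rewrite /adjoint map_mxM trmx_mul. Qed.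

Lemma adjointK m n (A : 'M[K]_(m, n)) : adjoint (adjoint A) = A.
Proof. by apply/matrixP => i j; rewrite !mxE sconjK. Qed.

Lemma adjoint1 n : adjoint (1%:M : 'M[K]_n) = 1%:M.
Proof. by rewrite /adjoint map_mx1 trmx1. Qed.

Lemma adjoint_eq0 n (v : 'rV[K]_n) : v *m adjoint v = 0 -> v = 0.
Proof.
move=> /matrixP/(_ 0 0); rewrite !mxE => h.
have /eqP := h; rewrite psumr_eq0 => [/allP hv|i _]; last first.
  by rewrite !mxE mul_sconj_ge0.
apply/matrixP => i j; rewrite ord1 mxE; apply/eqP.
by have := hv j (mem_index_enum j); rewrite !mxE mul_sconj_eq0.
Qed.

Lemma mul_mx_adjoint m n (A : 'M[K]_(m, n)) p (B : 'M[K]_(p, n)) i j :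
  (A *m adjoint B) i j = inner (row i A) (row j B).
Proof. by rewrite !mxE; apply: eq_bigr => l _; rewrite !mxE. Qed.

(** If v B B^* = 0 then v B has norm zero. *)
Lemma unitmx_gram m n (B : 'M[K]_(m, n)) : row_free B ->
  B *m adjoint B \in unitmx.
Proof.
move=> fB; rewrite -row_free_unit; apply: inj_row_free => v vB.
have : (v *m B) *m adjoint (v *m B) = 0.
  by rewrite adjointM mulmxA -(mulmxA v) vB mul0mx.
by move/adjoint_eq0/eqP; rewrite mulmx_free_eq0// => /eqP.
Qed.

End adjoint_theory.

Definition rows_mx (K : fieldType) n p (b : p.-tuple 'rV[K]_n) : 'M[K]_(p, n) :=
  \matrix_(i < p) tnth b i.

Section bases.
Context (K : fieldType) (n : nat).

Lemma row_rows_mx p (b : p.-tuple 'rV[K]_n) i : row i (rows_mx b) = tnth b i.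
Proof. by rewrite rowK. Qed.

Lemma mulmx_rows_mx p (b : p.-tuple 'rV[K]_n) (v : 'rV_p) :
  v *m rows_mx b = \sum_(i < p) v 0 i *: b`_i.
Proof.
by rewrite mulmx_sum_row; apply: eq_bigr => i _; rewrite row_rows_mx (tnth_nth 0).
Qed.

Lemma row_free_rows_mx p (b : p.-tuple 'rV[K]_n) : free b -> row_free (rows_mx b).
Proof.
move=> /freeP fb; apply: inj_row_free => v; rewrite mulmx_rows_mx => /fb hv.
by apply/matrixP => i j; rewrite ord1 mxE hv.
Qed.

Lemma basis_change (E : {vspace 'rV[K]_n}) p q (b : p.-tuple 'rV[K]_n)
    (c : q.-tuple 'rV[K]_n) : basis_of E b -> basis_of E c ->
  exists C : 'M[K]_(p, q), rows_mx b = C *m rows_mx c.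
Proof.
move=> bE cE; exists (\matrix_(i, j) coord c j (tnth b i)).
apply/row_matrixP => i; rewrite row_mul mulmx_rows_mx row_rows_mx.
rewrite {1}(@coord_basis _ _ E _ c (tnth b i))//; last first.
  exact: (basis_mem bE (mem_tnth _ _)).
by apply: eq_bigr => j _; rewrite !mxE.
Qed.

End bases.

Section projections.
Context (R : realType) (s : scalar_kind) (n : nat).
Local Notation K := (scalar_field R s).
Implicit Types E F : {vspace 'rV[K]_n}.

(** Changing the basis multiplies the basis matrix by an invertible matrix on the left,
   which cancels out of the formula. *)
Lemma proj_mx_onE E p (b : p.-tuple 'rV[K]_n) : basis_of E b ->
  let B := rows_mx b in
  proj_mx_on E = adjoint B *m invmx (B *m adjoint B) *m B.
Proof.
move=> bE B.
have vE : basis_of E (vbasis E) := vbasisP E.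
have [C hC] := basis_change vE bE; have [C' hC'] := basis_change bE vE.
rewrite /proj_mx_on /= (_ : basis_mx E = C *m B); last by rewrite -hC.
have fB : row_free B by apply/row_free_rows_mx/(basis_free bE).
have fV : row_free (rows_mx (vbasis E)) by apply/row_free_rows_mx/(basis_free vE).
have C'C : C' *m C = 1%:M.
  apply: (row_free_inj fB).
  by rewrite -mulmxA -hC mul1mx -hC'.
have CC' : C *m C' = 1%:M.
  apply: (row_free_inj fV).
  by rewrite -mulmxA -hC' mul1mx -hC.
have uM := unitmx_gram fB; set M := B *m adjoint B in uM *.
have -> : invmx (C *m B *m adjoint (C *m B)) = adjoint C' *m invmx M *m C'.
  have e1 : (C *m B *m adjoint (C *m B)) *m (adjoint C' *m invmx M *m C') = 1%:M.
    rewrite adjointM !mulmxA -(mulmxA C B) -/M -(mulmxA _ (adjoint C)).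
    by rewrite -adjointM C'C adjoint1 mulmx1 mulmxK// CC'.
  have [uX _] := mulmx1_unit e1.
  by rewrite -[RHS](mulKmx uX) e1 mulmx1.
rewrite adjointM !mulmxA -(mulmxA _ (adjoint C)) -adjointM C'C adjoint1 mulmx1.
by rewrite -(mulmxA _ C') C'C mulmx1.
Qed.

Lemma orthonormal_rows E p (e : p.-tuple 'rV[K]_n) : orthonormal_basis E e ->
  rows_mx e *m adjoint (rows_mx e) = 1%:M.
Proof.
by case=> _ h; apply/matrixP => i j; rewrite mul_mx_adjoint !row_rows_mx h mxE.
Qed.

Lemma proj_mx_on_orthonormal E p (e : p.-tuple 'rV[K]_n) :
  orthonormal_basis E e -> proj_mx_on E = adjoint (rows_mx e) *m rows_mx e.
Proof.
move=> oe; rewrite (@proj_mx_onE _ _ e); last by case: oe.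
by rewrite (orthonormal_rows oe) invmx1 mulmx1.
Qed.

(** Idempotent because the middle factor of the formula inverts a Gram matrix, and
   self-adjoint because a Gram matrix is. *)
Lemma proj_mx_on_props E :
  proj_mx_on E *m proj_mx_on E = proj_mx_on E /\ adjoint (proj_mx_on E) = proj_mx_on E.
Proof.
rewrite (proj_mx_onE (vbasisP E)) /=; set B := rows_mx _.
have uM : B *m adjoint B \in unitmx.
  by apply/unitmx_gram/row_free_rows_mx/(basis_free (vbasisP E)).
split; first by rewrite !mulmxA -(mulmxA _ B) mulmxK.
have aM : adjoint (B *m adjoint B) = B *m adjoint B by rewrite adjointM adjointK.
have aN : adjoint (invmx (B *m adjoint B)) = invmx (B *m adjoint B).
  apply: (row_free_inj (A := B *m adjoint B)); first by rewrite row_free_unit.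
  by rewrite mulVmx// -{2}aM -adjointM mulmxV// adjoint1.
by rewrite !(adjointM, adjointK) aN mulmxA.
Qed.

(** The images under U of a basis of E form a basis of the image of E. *)
Lemma proj_mx_on_limg E (U : 'M[K]_n) : unitary_matrix U ->
  proj_mx_on (linfun (mulmxr U) @: E)%VS = adjoint U *m proj_mx_on E *m U.
Proof.
move=> UU; set f := linfun _.
have injf : lker f == 0%VS.
  apply/lker0P => x y; rewrite !lfunE /= => /(congr1 (mulmxr (adjoint U))) /=.
  by rewrite -!mulmxA UU !mulmx1.
have bE : basis_of (f @: E)%VS (map_tuple f (vbasis E)).
  by apply: (limg_basis_of _ (vbasisP E)); rewrite (eqP injf) capv0.
rewrite (proj_mx_onE bE) (proj_mx_onE (vbasisP E)) /=.
have -> : rows_mx (map_tuple f (vbasis E)) = rows_mx (vbasis E) *m U.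
  apply/row_matrixP => i; rewrite row_mul !row_rows_mx tnth_map lfunE /=.
  by [].
set B := rows_mx _.
by rewrite adjointM !mulmxA -(mulmxA B) UU mulmx1.
Qed.

End projections.

Section angles.
Context (R : realType) (s : scalar_kind) (n : nat) (k l : 'I_n.+1).
Local Notation K := (scalar_field R s).
Context (E : grassmannian R s k) (F : grassmannian R s l).
Context (theta : (minn k l).-tuple R) (h : principal_angles E F theta).

Let P := proj_mx_on (val (E : subspace_of_dim R s k)).
Let Q := proj_mx_on (val (F : subspace_of_dim R s l)).
Local Notation sc := (@of_real R s).

Lemma angles_bounds i : 0 <= theta`_i <= pi / 2.
Proof.
case: h => _ /allP ht _; case: (ltnP i (size theta)) => hi.
  exact/ht/mem_nth.
by rewrite nth_default// lexx divr_ge0 ?pi_ge0.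
Qed.

(** The form in which the principal angles enter the traces and ranks below: the matrix
   e f^* is diagonal, though not square in general. *)
Lemma principal_bases : exists (e : 'M[K]_(k, n)) (f : 'M[K]_(l, n)),
  [/\ e *m adjoint e = 1%:M, f *m adjoint f = 1%:M,
      P = adjoint e *m e, Q = adjoint f *m f &
      forall (i : 'I_k) (j : 'I_l), (e *m adjoint f) i j =
        if i == j :> nat then sc (cos theta`_i) else 0].
Proof.
case: h => _ _ [e [f [oe of_ hef]]]; exists (rows_mx e), (rows_mx f); split.
- exact: (orthonormal_rows oe).
- exact: (orthonormal_rows of_).
- exact: (proj_mx_on_orthonormal oe).
- exact: (proj_mx_on_orthonormal of_).
- by move=> i j; rewrite mul_mx_adjoint !row_rows_mx hef.
Qed.

Lemma mxtrace_proj : \tr P = k%:R /\ \tr Q = l%:R.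
Proof.
have [e [f [ee ff -> -> _]]] := principal_bases.
by rewrite mxtrace_mulC ee [\tr (_ *m f)]mxtrace_mulC ff !mxtrace1.
Qed.

Lemma gram_diag (e : 'M[K]_(k, n)) (f : 'M[K]_(l, n)) :
  (forall (i : 'I_k) (j : 'I_l), (e *m adjoint f) i j =
        if i == j :> nat then sc (cos theta`_i) else 0) ->
  adjoint (e *m adjoint f) *m (e *m adjoint f) =
  diag_mx (\row_(j < l) if (j < k)%N then sc (cos theta`_j ^+ 2) else 0).
Proof.
move=> hD; apply/matrixP => i j; rewrite !mxE.
under eq_bigr => x _ do rewrite 2!mxE !hD.
case: (ltnP j k) => jk.
  rewrite (bigD1 (Ordinal jk)) //= eqxx big1 => [|x]; last first.
    rewrite -val_eqE /= => /negbTE ->; rewrite mulr0//.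
  rewrite addr0 (_ : (j == i :> nat) = (i == j)); last by rewrite eq_sym -val_eqE.
  case: eqP => [->|]; last by rewrite raddf0 mul0r.
  by rewrite jk sconj_of_real -rmorphM /= -expr2.
rewrite big1 => [|x _].
  by case: eqP => [->|]; rewrite ?mulr0n// ltnNge jk mul0rn.
by rewrite [X in _ * X]ifN ?mulr0//; apply/eqP; have := ltn_ord x; lia.
Qed.

(** A cyclic permutation of the factors turns tr (Q P)^j into tr (D^* D)^j, with
   D = e f^*. The case j = 0 is excluded because the left-hand side is then n. *)
Lemma mxtrace_QP j : (0 < j)%N ->
  \tr ((Q *m P) ^+ j) = sc (\sum_(i < minn k l) cos theta`_i ^+ (2 * j)).
Proof.
have [e [f [ee ff -> -> hD]]] := principal_bases.
case: j => // j _; set D := e *m adjoint f.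
have hpow : forall i, (adjoint f *m f *m (adjoint e *m e)) ^+ i.+1 =
    adjoint f *m (adjoint D *m D) ^+ i *m adjoint D *m e.
  elim=> [|i IH]; first by rewrite expr1 expr0 mulmx1 /D adjointM adjointK !mulmxA.
  rewrite exprS IH [in RHS]exprS -!mulmxE /D !adjointM !adjointK !mulmxA.
  by rewrite -!mulmxA.
rewrite hpow -!mulmxA mxtrace_mulC -!mulmxA -/D [LHS](_ : _ = \tr ((adjoint D *m D) ^+ j.+1)).
  rewrite gram_diag//; set d := (X in diag_mx X).
  have -> : forall i : nat, (diag_mx d) ^+ i.+1 = diag_mx (\row_j d 0 j ^+ i.+1).
    elim=> [|i IH]; first by congr diag_mx; apply/rowP => i; rewrite !mxE.
    rewrite exprS IH -mulmxE mulmx_diag; congr diag_mx.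
    by apply/rowP => x; rewrite !mxE -exprS.
  rewrite mxtrace_diag rmorph_sum /=.
  under eq_bigr => x _ do rewrite !mxE.
  rewrite (bigID (fun x : 'I_l => (x < k)%N)) /= [X in _ + X]big1 ?addr0; last first.
    by move=> x /negbTE ->; rewrite expr0n.
  rewrite [RHS](big_ord_widen_cond l (fun=> true) (fun i => sc (cos theta`_i ^+ (2 * j.+1)))) ?geq_minr//=.
  apply: eq_big => [x|x xk]; first by rewrite ltn_min ltn_ord andbT.
  by rewrite xk -rmorphXn /= exprM.
by rewrite exprSr -mulmxE.
Qed.

(** The matrix f (1 - P) f^* = 1 - D^* D, with D = e f^*, has rank at most n - k. It is
   diagonal, with a nonzero entry for every nonzero angle and also for each of the
   l - min(k, l) indices that carry no angle. The second kind of entry is what turns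
   the bound n - k into n - l when k <= l. *)
Lemma count_nonzero_angles :
  (size [seq t <- theta | (t != 0)%R] <= num_angles k l)%N.
Proof.
have [e [f [ee ff _ _ hD]]] := principal_bases.
set D := e *m adjoint f in hD.
set c := size _.
have c_le : (c <= minn k l)%N.
  by rewrite /c size_filter -{2}(size_tuple theta) count_size.
pose d := \row_(j < l) (1 - if (j < k)%N then sc (cos theta`_j ^+ 2) else 0).
have hd : f *m (1%:M - adjoint e *m e) *m adjoint f = diag_mx d.
  rewrite mulmxBr mulmxBl mulmx1 ff.
  have -> : f *m (adjoint e *m e) *m adjoint f = adjoint D *m D.
    by rewrite /D adjointM adjointK !mulmxA.
  rewrite gram_diag//.
  apply/matrixP => i j; rewrite !mxE; case: eqP => //=; rewrite ?mulr1n// !mulr0n.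
  by rewrite subr0.
have rk1 : (\rank (1%:M - adjoint e *m e)%R <= n - k)%N.
  have z : (1%:M - adjoint e *m e) *m adjoint e = 0.
    by rewrite mulmxBl mul1mx -mulmxA ee mulmx1 subrr.
  have := mulmx0_rank_max z; suff -> : \rank (adjoint e) = k by have := ltn_ord k; lia.
  apply/eqP; rewrite eqn_leq rank_leq_col /=.
  by rewrite -[X in (X <= _)%N](mxrank1 K k) -ee mxrankM_maxr.
have rk2 : (\rank (diag_mx d) <= n - k)%N.
  by rewrite -hd; apply: leq_trans rk1; rewrite (leq_trans (mxrankM_maxl _ _))// mxrankM_maxr.
pose S := [set j | d 0 j != 0]%SET.
have rkE : (#|S| <= \rank (diag_mx d))%N.
  pose M := rowsub (@enum_val _ (mem S)) (diag_mx d).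
  have /eqP <- : row_free M.
    apply: inj_row_free => v /matrixP vM; apply/matrixP => i a.
    rewrite ord1 [RHS]mxE; have := vM 0 (enum_val a).
    rewrite !mxE (bigD1 a)//= big1 => [|b ba]; last first.
      rewrite !mxE (_ : (enum_val b == enum_val a) = false) ?mulr0n ?mulr0//.
      by apply/negbTE; rewrite (inj_eq enum_val_inj).
    rewrite !mxE eqxx mulr1n addr0 => /eqP; rewrite mulf_eq0.
    by have := enum_valP a; rewrite inE => /negbTE; rewrite mxE => -> /orP[/eqP|].
  exact/mxrankS/rowsub_sub.
have cE : (c + (l - minn k l) <= #|S|)%N.
  pose nz (i : nat) : bool := theta`_i != 0.
  have -> : c = (\sum_(i < minn k l) nz i)%N.
    rewrite /c size_filter -sum1_count (big_nth 0) size_tuple big_mkord.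
    by rewrite big_mkcond; apply: eq_bigr => i _; rewrite /nz; case: (_ != _).
  pose G (j : nat) : nat := if (j < k)%N then nz j else true.
  apply: (@leq_trans (\sum_(j < l) G j)).
    rewrite -(big_mkord xpredT G) (@big_cat_nat _ _ _ (minn k l))//= ?geq_minr//.
    apply: leq_add.
      rewrite big_mkord; apply: leq_sum => i _; rewrite /G ifT//.
      by have := ltn_ord i; rewrite leq_min => /andP[].
    rewrite -[leqLHS](muln1) -sum_nat_const_nat big_nat_cond [leqRHS]big_nat_cond.
    apply: leq_sum => i; rewrite andbT /G => /andP[mi il].
    by case: (ltnP i k) => // ik; exfalso; lia.
  rewrite -sum1_card [leqRHS]big_mkcond; apply: leq_sum => j _.
  rewrite inE mxE /G /nz; case: ifP => jk; last by rewrite subr0 oner_eq0.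
  case: (eqVneq (theta`_j) 0) => //= tj.
  rewrite -(rmorph1 (of_real s)) -rmorphB fmorph_eq0 /= -sin2cos2.
  have /andP[t0 t1] := angles_bounds j.
  rewrite expf_neq0// gt_eqF// sin_gt0_pi// lt_neqAle eq_sym tj t0/=.
  by rewrite (le_lt_trans t1)// ltr_pdivrMr// ltr_pMr ?pi_gt0// ltr1n.
rewrite /num_angles; have := ltn_ord k; have := ltn_ord l; lia.
Qed.

End angles.

(** * Traces of words in two projections *)

Section real_imaginary.
Context (R : realType) (s : scalar_kind).
Local Notation K := (scalar_field R s).

(** Real and imaginary parts on the two scalar fields at once, so that a single argument
   by real inequalities covers both. *)
Definition re : K -> R :=
  match s return scalar_field R s -> R with
  | RealScalars => id | ComplexScalars => @complex.Re R end.

Definition im : K -> R :=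
  match s return scalar_field R s -> R with
  | RealScalars => fun=> 0 | ComplexScalars => @complex.Im R end.

Lemma re_is_additive : additive re.
Proof. by rewrite /re; case: s => // -[a b] [c e]. Qed.

Lemma im_is_additive : additive im.
Proof. by rewrite /im; case: s => [x y|[a b] [c e]] //; rewrite subr0. Qed.

HB.instance Definition _ := GRing.isAdditive.Build K R re re_is_additive.
HB.instance Definition _ := GRing.isAdditive.Build K R im im_is_additive.

Lemma reM (x y : K) : re (x * y) = re x * re y - im x * im y.
Proof.
rewrite /re /im; move: x y; case: s => [x y|[a b] [c e]] //=.
by rewrite mul0r subr0.
Qed.

Lemma imM (x y : K) : im (x * y) = re x * im y + im x * re y.
Proof.
rewrite /re /im; move: x y; case: s => [x y|[a b] [c e]] //=.
by rewrite mul0r mulr0 addr0.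
Qed.

Lemma re_conj (x : K) : re (sconj x) = re x.
Proof. by rewrite /re; move: x; case: s => // -[a b]. Qed.

Lemma im_conj (x : K) : im (sconj x) = - im x.
Proof. by rewrite /im; move: x; case: s => [x|[a b]] //=; rewrite oppr0. Qed.

Lemma re_of_real (a : R) : re (of_real s a) = a.
Proof. by rewrite /re; case: s. Qed.

Lemma im_of_real (a : R) : im (of_real s a) = 0.
Proof. by rewrite /im; case: s. Qed.

Lemma re_of_realM (a : R) (x : K) : re (of_real s a * x) = a * re x.
Proof. by rewrite reM re_of_real im_of_real mul0r subr0. Qed.

Lemma re_norm (x : K) (c : R) : `|x| <= of_real s c -> `|re x| <= c.
Proof.
rewrite /re; move: x; case: s => //= x h.
by rewrite -lecR; exact: le_trans (normc_ge_Re x) h.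
Qed.

Lemma norm_of_real (a : R) : `|of_real s a| = of_real s `|a|.
Proof. by case: s => //=; rewrite normc_def /= expr0n addr0 sqrtr_sqr. Qed.

Lemma ler_of_real (a b : R) : (of_real s a <= of_real s b) = (a <= b).
Proof. by case: s => //=; exact: lecR. Qed.

Lemma norm_of_re_im (x : K) : `|x| <= of_real s (`|re x| + `|im x|).
Proof.
rewrite /re /im; move: x; case: s => [x|x] /=; first by rewrite normr0 addr0.
rewrite normc_def lecR -[leRHS]ger0_norm ?addr_ge0// -sqrtr_sqr ler_sqrt ?sqr_ge0//.
rewrite sqrrD -!(real_normK (num_real (complex.Re x))) -!(real_normK (num_real (complex.Im x))).
by rewrite lerD2r lerDl mulrn_wge0 ?mulr_ge0.
Qed.

(** The squared modulus, as a real number. *)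
Definition nsq (x : K) : R := re x ^+ 2 + im x ^+ 2.

Lemma nsq_ge0 x : 0 <= nsq x.
Proof. by rewrite addr_ge0 ?sqr_ge0. Qed.

Lemma nsqE x : nsq x = re (x * sconj x).
Proof. by rewrite reM re_conj im_conj /nsq; ring. Qed.

Lemma re_sqr_le x : re x ^+ 2 <= nsq x.
Proof. by rewrite lerDl sqr_ge0. Qed.

Lemma nsqB_le x y : nsq (x - y) <= 2 * (nsq x + nsq y).
Proof.
rewrite /nsq !raddfB -subr_ge0.
suff -> : 2 * (re x ^+ 2 + im x ^+ 2 + (re y ^+ 2 + im y ^+ 2)) -
  ((re x - re y) ^+ 2 + (im x - im y) ^+ 2) =
  (re x + re y) ^+ 2 + (im x + im y) ^+ 2 by rewrite addr_ge0 ?sqr_ge0.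
by ring.
Qed.

Lemma re_mul_le x y : `|re (x * y)| <= (nsq x + nsq y) / 2.
Proof.
rewrite ler_norml reM /nsq; apply/andP; split; rewrite -subr_ge0.
  rewrite (_ : _ - _ = ((re x + re y) ^+ 2 + (im x - im y) ^+ 2) / 2); last by field.
  by rewrite divr_ge0// addr_ge0 ?sqr_ge0.
rewrite (_ : _ - _ = ((re x - re y) ^+ 2 + (im x + im y) ^+ 2) / 2); last by field.
by rewrite divr_ge0// addr_ge0 ?sqr_ge0.
Qed.

End real_imaginary.

Section frobenius.
Context (R : realType) (s : scalar_kind).
Local Notation K := (scalar_field R s).

Definition fsq m n (M : 'M[K]_(m, n)) : R := \sum_i \sum_j nsq (M i j).

Lemma fsq_ge0 m n (M : 'M[K]_(m, n)) : 0 <= fsq M.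
Proof. by do 2 (apply: sumr_ge0 => ? _); exact: nsq_ge0. Qed.

Lemma fsqE m n (M : 'M[K]_(m, n)) : fsq M = re (\tr (M *m adjoint M)).
Proof.
rewrite /fsq /mxtrace raddf_sum; apply: eq_bigr => i _.
by rewrite mxE raddf_sum; apply: eq_bigr => j _; rewrite !mxE nsqE.
Qed.

Lemma fsq_tr m n (M : 'M[K]_(m, n)) : fsq M^T = fsq M.
Proof.
by rewrite /fsq exchange_big; do 2 (apply: eq_bigr => ? _); rewrite mxE.
Qed.

Lemma fsqB_le m n (M N : 'M[K]_(m, n)) : fsq (M - N) <= 2 * (fsq M + fsq N).
Proof.
rewrite /fsq -big_split mulr_sumr; apply: ler_sum => i _.
rewrite -big_split mulr_sumr; apply: ler_sum => j _.
by rewrite !mxE nsqB_le.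
Qed.

Lemma fsq1 n : fsq (1%:M : 'M[K]_n) = n%:R.
Proof. by rewrite fsqE adjoint1 mulmx1 mxtrace1 -(rmorph_nat (@of_real R s)) re_of_real. Qed.

Lemma re_mxtrace_mul_le n (X Y : 'M[K]_n) :
  `|re (\tr (X *m Y))| <= (fsq X + fsq Y) / 2.
Proof.
rewrite -(fsq_tr Y) /fsq -big_split mulr_suml /mxtrace raddf_sum.
apply: le_trans (ler_norm_sum _ _ _) _; apply: ler_sum => i _.
rewrite -big_split mulr_suml mxE raddf_sum.
apply: le_trans (ler_norm_sum _ _ _) _; apply: ler_sum => j _.
by rewrite mxE re_mul_le.
Qed.

Section fixed_size.
Context (n : nat).
Implicit Types P M N : 'M[K]_n.

(** Left multiplication by M does not increase the Frobenius norm. This makes the squared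
   norm of any word in two projections at most n, where the entrywise bounds would lose
   powers of n. *)
Definition frob_contr M := forall N, fsq (M *m N) <= fsq N.

(** Pythagoras: fsq N is the sum of fsq (P N) and fsq ((1 - P) N). *)
Lemma frob_contr_proj P : P *m P = P -> adjoint P = P -> frob_contr P.
Proof.
move=> PP Pa N.
have e M : M *m M = M -> adjoint M = M -> fsq (M *m N) = re (\tr (M *m (N *m adjoint N))).
  by move=> MM Ma; rewrite fsqE adjointM mulmxA mxtrace_mulC Ma !mulmxA MM -mulmxA.
have PP' : (1%:M - P) *m (1%:M - P) = 1%:M - P.
  by rewrite mulmxBr mulmx1 mulmxBl mul1mx PP subrr subr0.
have Pa' : adjoint (1%:M - P) = 1%:M - P.
  by rewrite -[in RHS]Pa -[in RHS](adjoint1 _ s); apply/matrixP => i j; rewrite !mxE rmorphB.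
have := fsq_ge0 ((1%:M - P) *m N).
by rewrite !e// mulmxBl mul1mx !raddfB /= -fsqE subr_ge0.
Qed.

Lemma frob_contrM M N : frob_contr M -> frob_contr N -> frob_contr (M *m N).
Proof. by move=> hM hN X; rewrite -mulmxA; apply: le_trans (hM _) (hN _). Qed.

Lemma frob_contr1 : frob_contr 1%:M.
Proof. by move=> N; rewrite mul1mx. Qed.

Lemma frob_contrX M i : frob_contr M -> frob_contr (M ^+ i).
Proof.
move=> hM; elim: i => [|i IH]; first exact: frob_contr1.
by rewrite exprS; exact: frob_contrM.
Qed.

Lemma frob_contr_fsq M : frob_contr M -> fsq M <= n%:R.
Proof. by move=> /(_ 1%:M); rewrite mulmx1 fsq1. Qed.

End fixed_size.
End frobenius.

Section skew_sums.
Context (R : realType) (s : scalar_kind) (n : nat).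
Local Notation K := (scalar_field R s).

Definition skew_mx (i j : 'I_n) : 'M[K]_n := delta_mx i j - delta_mx j i.

Lemma mxtrace_delta_mul (i j : 'I_n) (X : 'M[K]_n) : \tr (delta_mx i j *m X) = X j i.
Proof.
rewrite /mxtrace (bigD1 i)//= [X in _ + X]big1 => [|a ai]; rewrite ?addr0 mxE.
  rewrite (bigD1 j)//= big1 => [|b bj]; rewrite ?addr0 mxE ?eqxx ?mul1r//.
  by rewrite (negbTE bj) andbF mul0r.
by rewrite big1// => b _; rewrite mxE (negbTE ai) mul0r.
Qed.

Lemma mxtrace_skew_mul i j (X : 'M[K]_n) : \tr (skew_mx i j *m X) = X j i - X i j.
Proof. by rewrite mulmxBl raddfB /= !mxtrace_delta_mul. Qed.

(** The sum over the planes decouples the two factors, up to a term with a transpose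
   that is of order n instead of n^2 when X and Y are words. *)
Lemma sum_mxtrace_skew (X Y : 'M[K]_n) :
  \sum_i \sum_j \tr (skew_mx i j *m X *m skew_mx i j *m Y) =
  2 * (\tr (X *m Y^T) - \tr X * \tr Y).
Proof.
have e i j a b : \tr (delta_mx i j *m X *m delta_mx a b *m Y) = X j a * Y b i.
  rewrite -!mulmxA mxtrace_delta_mul mxE (bigD1 a)//= big1 => [|c ca].
    rewrite addr0 mxE (bigD1 b)//= big1 => [|c cb]; rewrite ?addr0 mxE ?eqxx ?mul1r//.
    by rewrite (negbTE cb) andbF mul0r.
  rewrite mxE big1 ?mulr0// => b' _; rewrite mxE (negbTE ca) mul0r//.
have t : \tr (X *m Y^T) = \sum_i \sum_j X i j * Y i j.
  by apply: eq_bigr => i _; rewrite mxE; apply: eq_bigr => j _; rewrite mxE.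
have t' : \tr X * \tr Y = \sum_i \sum_j X i i * Y j j.
  by rewrite mulr_suml; apply: eq_bigr => i _; rewrite mulr_sumr.
have step i j : \tr (skew_mx i j *m X *m skew_mx i j *m Y) =
    (X j i * Y j i + X i j * Y i j) - (X j j * Y i i + X i i * Y j j).
  rewrite /skew_mx !mulmxBl !mulmxBr !mulmxBl !raddfB /= !e; ring.
under eq_bigr => i _ do under eq_bigr => j _ do rewrite step.
under eq_bigr => i _ do rewrite sumrB !big_split /=.
rewrite sumrB !big_split /= t t'.
rewrite [X in X + _ - _]exchange_big /= [X in _ - (X + _)]exchange_big /=.
by ring.
Qed.

Lemma sum_re_skew_sqr_le (X : 'M[K]_n) :
  \sum_i \sum_j re (\tr (skew_mx i j *m X)) ^+ 2 <= 4 * fsq X.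
Proof.
rewrite (_ : 4 * fsq X = 2 * (fsq X^T + fsq X)); last by rewrite fsq_tr; ring.
rewrite /fsq -big_split mulr_sumr; apply: ler_sum => i _.
rewrite -big_split mulr_sumr; apply: ler_sum => j _.
by rewrite mxtrace_skew_mul mxE; apply: le_trans (re_sqr_le _) (nsqB_le _ _).
Qed.

(** By the inequality 2 |x y| <= x^2 + y^2. The left-hand side, which has n^2 terms, is
   only of order n when X and Y are words. *)
Lemma sum_re_skew_mul_le (X Y : 'M[K]_n) :
  \sum_i \sum_j `|re (\tr (skew_mx i j *m X)) * re (\tr (skew_mx i j *m Y))| <=
  2 * (fsq X + fsq Y).
Proof.
apply: (@le_trans _ _ ((\sum_i \sum_j re (\tr (skew_mx i j *m X)) ^+ 2 +
   \sum_i \sum_j re (\tr (skew_mx i j *m Y)) ^+ 2) / 2)); last first.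
  by have := sum_re_skew_sqr_le X; have := sum_re_skew_sqr_le Y; lra.
rewrite -big_split mulr_suml; apply: ler_sum => i _.
rewrite -big_split mulr_suml; apply: ler_sum => j _ /=.
set x := re _; set y := re _; rewrite ler_norml; apply/andP; split.
  by have := sqr_ge0 (x + y); rewrite sqrrD; lra.
by have := sqr_ge0 (x - y); rewrite sqrrB; lra.
Qed.

End skew_sums.
Arguments skew_mx {R} s {n} i j.

(** * Infinitesimal rotations *)

Section expansions.
Context (R : realType) (s : scalar_kind) (T : Type).
Local Notation K := (scalar_field R s).
Local Notation toK := (@of_real R s).

(** Boundedness is uniform in the random parameter w, so that it passes to means. *)
Definition bounded_family m n (M : T -> R -> 'M[K]_(m, n)) := exists C : R,
  forall w t i j, `|t| <= 1 -> `|M w t i j| <= toK C.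

Lemma bounded_familyD m n (M N : T -> R -> 'M[K]_(m, n)) :
  bounded_family M -> bounded_family N ->
  bounded_family (fun w t => M w t + N w t).
Proof.
move=> [C hC] [C' hC']; exists (C + C') => w t i j t1; rewrite mxE rmorphD /=.
by rewrite (le_trans (ler_normD _ _))// lerD ?hC ?hC'.
Qed.

Lemma bounded_familyM m n p (M : T -> R -> 'M[K]_(m, n)) (N : T -> R -> 'M[K]_(n, p)) :
  bounded_family M -> bounded_family N ->
  bounded_family (fun w t => M w t *m N w t).
Proof.
move=> [C hC] [C' hC']; exists (\sum_(i < n) C * C') => w t i j t1; rewrite mxE rmorph_sum /=.
rewrite (le_trans (ler_norm_sum _ _ _))// ler_sum// => l _.
by rewrite normrM rmorphM /= ler_pM ?hC ?hC'.
Qed.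

Lemma bounded_familyZ m n (a : R -> R) (M : T -> R -> 'M[K]_(m, n)) :
  (exists c, forall t, `|t| <= 1 -> `|a t| <= c) -> bounded_family M ->
  bounded_family (fun w t => toK (a t) *: M w t).
Proof.
move=> [c ac] [C hC]; exists (c * C) => w t i j t1.
rewrite mxE normrM rmorphM /= ler_pM// ?hC//.
by rewrite norm_of_real ler_of_real ac.
Qed.

Lemma bounded_family_cst m n (M : 'M[K]_(m, n)) : bounded_family (fun _ _ => M).
Proof.
exists (\sum_i \sum_j (`|re (M i j)| + `|im (M i j)|)) => w t i j _.
apply: le_trans (norm_of_re_im _) _; rewrite ler_of_real.
rewrite (bigD1 i)//= (bigD1 j)//= -addrA lerDl addr_ge0//.
  by apply: sumr_ge0 => *; rewrite addr_ge0.
by do 2 (apply: sumr_ge0 => * ); rewrite addr_ge0.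
Qed.

Lemma bounded_family_tr n (M : T -> R -> 'M[K]_n) : bounded_family M ->
  exists C, forall w t, `|t| <= 1 -> `|re (\tr (M w t))| <= C.
Proof.
move=> [C hC]; exists (\sum_(i < n) C) => w t t1; apply: re_norm.
rewrite rmorph_sum /= (le_trans (ler_norm_sum _ _ _))// ler_sum// => i _.
exact: hC.
Qed.

(** M w t = M0 w + t M1 w + O(t^2) for |t| <= 1, with an explicit remainder that is
   uniform in w. *)
Definition expands m n (M : T -> R -> 'M[K]_(m, n)) (M0 M1 : T -> 'M[K]_(m, n)) :=
  [/\ bounded_family (fun w _ => M0 w), bounded_family (fun w _ => M1 w) &
   exists2 M2, bounded_family M2 &
     forall w t, M w t = M0 w + toK t *: M1 w + toK (t ^+ 2) *: M2 w t].

Lemma le1_bounded : exists c : R, forall t : R, `|t| <= 1 -> `|t| <= c.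
Proof. by exists 1. Qed.

Lemma le1_sqr_bounded : exists c : R, forall t : R, `|t| <= 1 -> `|t ^+ 2| <= c.
Proof. by exists 1 => t t1; rewrite normrX exprn_ile1. Qed.

Lemma expands_const m n (M : T -> 'M[K]_(m, n)) :
  bounded_family (fun w _ => M w) -> expands (fun w _ => M w) M (fun=> 0).
Proof.
move=> bM; split=> //; first exact: bounded_family_cst.
exists (fun _ _ => 0); first exact: bounded_family_cst.
by move=> w t; rewrite !scaler0 !addr0.
Qed.

Lemma expandsM m n p (M : T -> R -> 'M[K]_(m, n)) M0 M1
    (N : T -> R -> 'M[K]_(n, p)) N0 N1 : expands M M0 M1 -> expands N N0 N1 ->
  expands (fun w t => M w t *m N w t) (fun w => M0 w *m N0 w)
    (fun w => M0 w *m N1 w + M1 w *m N0 w).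
Proof.
move=> [bM0 bM1 [M2 bM2 hM]] [bN0 bN1 [N2 bN2 hN]]; split.
- exact: bounded_familyM.
- by apply: bounded_familyD; exact: bounded_familyM.
exists (fun w t => M0 w *m N2 w t + M1 w *m N1 w + M2 w t *m N0 w +
    (toK t *: (M1 w *m N2 w t + M2 w t *m N1 w) + toK (t ^+ 2) *: (M2 w t *m N2 w t))).
  do ?[apply: bounded_familyD | apply: bounded_familyM | apply: bounded_familyZ] => //.
  - exact: le1_bounded.
  - exact: le1_sqr_bounded.
move=> w t; rewrite hM hN !mulmxDl !mulmxDr !rmorphXn /=.
rewrite -!scalemxAl -!scalemxAr.
move: (M0 w *m N0 w) (M0 w *m N1 w) (M0 w *m N2 w t) (M1 w *m N0 w)
  (M1 w *m N1 w) (M1 w *m N2 w t) (M2 w t *m N0 w) (M2 w t *m N1 w)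
  (M2 w t *m N2 w t) => *.
by apply/matrixP => i j; rewrite !mxE; ring.
Qed.

Lemma expandsX n (M : T -> R -> 'M[K]_n) M0 M1 k : expands M M0 M1 ->
  expands (fun w t => M w t ^+ k) (fun w => M0 w ^+ k)
    (fun w => \sum_(a < k) M0 w ^+ a *m M1 w *m M0 w ^+ (k - a.+1)).
Proof.
move=> hM; elim: k => [|k IH].
  rewrite (_ : (fun w => \sum_(a < 0) _) = fun=> 0); last first.
    by apply/funext => w; rewrite big_ord0.
  exact: expands_const (bounded_family_cst 1%:M).
rewrite (_ : (fun w => \sum_(a < k.+1) _) = fun w =>
   M0 w *m (\sum_(a < k) M0 w ^+ a *m M1 w *m M0 w ^+ (k - a.+1)) + M1 w *m M0 w ^+ k).
  rewrite (_ : (fun w => M0 w ^+ k.+1) = fun w => M0 w *m M0 w ^+ k); last first.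
    by apply/funext => w; rewrite exprS.
  rewrite (_ : (fun w t => M w t ^+ k.+1) = fun w t => M w t *m M w t ^+ k); last first.
    by apply/funext => w; apply/funext => t; rewrite exprS.
  exact: expandsM.
apply/funext => w; rewrite big_ord_recl expr0 mul1mx subn1 /= addrC mulmx_sumr.
by congr (_ + _); apply: eq_bigr => a _; rewrite /bump /= exprS -mulmxE !mulmxA.
Qed.

End expansions.

Section rotations.
Context (R : realType) (s : scalar_kind) (n : nat).
Local Notation K := (scalar_field R s).
Local Notation toK := (@of_real R s).
Implicit Types (i j : 'I_n) (t : R).

(** Rational parametrisation of the circle by sin x = 4 t / (4 + t^2) and
   cos x = (4 - t^2) / (4 + t^2), so that x = t + O(t^2). *)
Definition rotation i j t : 'M[K]_n :=
  1%:M + toK (4 * t / (4 + t ^+ 2)) *: skew_mx s i j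
       - toK (2 * t ^+ 2 / (4 + t ^+ 2)) *: (delta_mx i i + delta_mx j j).

Lemma adjoint_delta (i j : 'I_n) : adjoint (delta_mx i j : 'M[K]_n) = delta_mx j i.
Proof. by apply/matrixP => a b; rewrite !mxE rmorph_nat andbC. Qed.

Lemma adjointD m p (A B : 'M[K]_(m, p)) : adjoint (A + B) = adjoint A + adjoint B.
Proof. by apply/matrixP => i j; rewrite !mxE rmorphD. Qed.

Lemma adjointB m p (A B : 'M[K]_(m, p)) : adjoint (A - B) = adjoint A - adjoint B.
Proof. by apply/matrixP => i j; rewrite !mxE rmorphB. Qed.

Lemma adjointZ m p a (A : 'M[K]_(m, p)) : adjoint (toK a *: A) = toK a *: adjoint A.
Proof. by apply/matrixP => i j; rewrite !mxE rmorphM /= sconj_of_real. Qed.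

Lemma adjoint_rotation i j t : adjoint (rotation i j t) =
  1%:M - toK (4 * t / (4 + t ^+ 2)) *: skew_mx s i j
       - toK (2 * t ^+ 2 / (4 + t ^+ 2)) *: (delta_mx i i + delta_mx j j).
Proof.
rewrite adjointB !adjointD !adjointZ adjoint1 adjointB adjointD !adjoint_delta.
by rewrite -[delta_mx j i - _]opprB scalerN.
Qed.

(** On its plane, A^2 = - D and A D = D A = A, where D is the projection on that plane. *)
Lemma rotation_unitary i j t : i != j -> unitary_matrix (rotation i j t).
Proof.
move=> ij; rewrite /unitary_matrix adjoint_rotation /rotation.
set A := skew_mx s i j; set D : 'M[K]_n := _ + delta_mx j j.
have ji : (j == i) = false by rewrite eq_sym (negbTE ij).
have AA : A *m A = - D.
  rewrite /A /D /skew_mx mulmxBl !mulmxBr !mul_delta_mx_cond !eqxx (negbTE ij) ji.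
  by rewrite !mulr0n !mulr1n sub0r subr0 opprD.
have AD : A *m D = A.
  rewrite /A /D /skew_mx mulmxBl !mulmxDr !mul_delta_mx_cond !eqxx (negbTE ij) ji.
  by rewrite !mulr0n !mulr1n add0r addr0.
have DA : D *m A = A.
  rewrite /A /D /skew_mx mulmxDl !mulmxBr !mul_delta_mx_cond !eqxx (negbTE ij) ji.
  by rewrite !mulr0n !mulr1n subr0 sub0r.
have DD : D *m D = D.
  rewrite /D mulmxDl !mulmxDr !mul_delta_mx_cond !eqxx (negbTE ij) ji.
  by rewrite !mulr0n !mulr1n addr0 add0r.
set x := _ / _; set y := _ / _.
have d0 : 4 + t ^+ 2 != 0 by rewrite gt_eqF// ltr_wpDr ?sqr_ge0.
have xy : x ^+ 2 + y ^+ 2 = 2 * y by rewrite /x /y; field.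
rewrite !mulmxBr !mulmxBl !mulmxDl !mulmx1 !mul1mx -!scalemxAl -!scalemxAr AA AD DA DD.
rewrite !scalerA -!rmorphM /= -!expr2 scalerN.
have -> : toK (x ^+ 2) = 2 * toK y - toK (y ^+ 2).
  by rewrite -(rmorph_nat toK) -rmorphM -rmorphB /=; congr (toK _); rewrite -xy; ring.
rewrite (mulrC y x); apply/matrixP => a b; rewrite !mxE; ring.
Qed.

(** The rotation is 1 + t A + O(t^2) and its adjoint 1 - t A + O(t^2). *)
Lemma expands_rotation (T : Type) i j (X : T -> 'M[K]_n) :
  bounded_family (fun w (_ : R) => X w) ->
  expands (fun w t => adjoint (rotation i j t) *m X w *m rotation i j t)
    X (fun w => X w *m skew_mx s i j - skew_mx s i j *m X w).
Proof.
move=> bX; set A := skew_mx s i j; set D : 'M[K]_n := delta_mx i i + delta_mx j j.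
have b4 t : 4 <= 4 + t ^+ 2 by rewrite lerDl sqr_ge0.
have d0 t : 4 + t ^+ 2 != 0.
  by rewrite gt_eqF//; have := sqr_ge0 t; lra.
have hB e : bounded_family (fun (_ : T) t => toK (e * t / (4 + t ^+ 2)) *: A
    - toK (2 / (4 + t ^+ 2)) *: D).
  rewrite (_ : (fun _ => _) = (fun _ t => toK (e * t / (4 + t ^+ 2)) *: A
    + toK (2 / (4 + t ^+ 2)) *: (- D))); last first.
    by apply/funext => w; apply/funext => t; rewrite scalerN.
  apply: bounded_familyD; apply: bounded_familyZ; try exact: bounded_family_cst.
    exists `|e| => t t1; rewrite !normrM normfV ler_pdivrMr ?normr_gt0//.
    rewrite ler_wpM2l// (le_trans t1)// (le_trans _ (ler_norm _))//.
    by apply: le_trans (b4 t); lra.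
  exists 1 => t _; rewrite ger0_norm ?divr_ge0//; last by have := sqr_ge0 t; lra.
  by rewrite ler_pdivrMr; have := sqr_ge0 t; lra.
have e1 : expands (fun (_ : T) t => rotation i j t) (fun=> 1%:M) (fun=> A).
  split; try exact: bounded_family_cst.
  exists (fun _ t => toK (- 1 * t / (4 + t ^+ 2)) *: A - toK (2 / (4 + t ^+ 2)) *: D) => //.
  move=> w t; rewrite /rotation -/A -/D; clearbody A D.
  rewrite scalerBr !scalerA -!rmorphM /= addrA.
  rewrite -[_ + toK t *: A + _]addrA -scalerDl -rmorphD.
  have -> : 4 * t / (4 + t ^+ 2) = t + t ^+ 2 * (- 1 * t / (4 + t ^+ 2)) by field.
  have -> : 2 * t ^+ 2 / (4 + t ^+ 2) = t ^+ 2 * (2 / (4 + t ^+ 2)) by rewrite (mulrC 2) mulrA.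
  by [].
have e2 : expands (fun (_ : T) t => adjoint (rotation i j t)) (fun=> 1%:M) (fun=> - A).
  split; try exact: bounded_family_cst.
  exists (fun _ t => toK (1 * t / (4 + t ^+ 2)) *: A - toK (2 / (4 + t ^+ 2)) *: D) => //.
  move=> w t; rewrite adjoint_rotation -/A -/D; clearbody A D.
  have -> : 4 * t / (4 + t ^+ 2) = t - t ^+ 2 * (1 * t / (4 + t ^+ 2)) by field.
  have -> : 2 * t ^+ 2 / (4 + t ^+ 2) = t ^+ 2 * (2 / (4 + t ^+ 2)) by rewrite (mulrC 2) mulrA.
  rewrite rmorphB !(rmorphM _ (t ^+ 2)) /=.
  by apply/matrixP => a b; rewrite !mxE; ring.
have := expandsM (expandsM e2 (expands_const bX)) e1.
rewrite (_ : (fun w => 1%:M *m X w *m 1%:M) = X); last first.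
  by apply/funext => w; rewrite mul1mx mulmx1.
rewrite (_ : (fun w => 1%:M *m X w *m A + _) = fun w => X w *m A - A *m X w)//.
by apply/funext => w; rewrite mul1mx mulmx0 add0r mulmx1 mulNmx.
Qed.

End rotations.

(** * The loop equation at a point *)

Section loop_pointwise.
Context (R : realType) (s : scalar_kind) (n m : nat) (kappa : R).
Local Notation K := (scalar_field R s).
Local Notation A := (skew_mx s).
Context (P Q : 'M[K]_n) (n0 : (0 < n)%N).
Hypotheses (PP : P *m P = P) (Pa : adjoint P = P).
Hypotheses (QQ : Q *m Q = Q) (Qa : adjoint Q = Q).

Let W := (Q *m P) ^+ m.
Let Y := re (\tr W) / n%:R - kappa.

(** The parts of (Q P)^m on the left and on the right of one of its factors P. *)
Definition word_left a := (Q *m P) ^+ a *m Q.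
Definition word_right a := (Q *m P) ^+ (m - a.+1).

(** The derivative of (Q P)^m when P moves at speed P A - A P. *)
Definition word_derivative (i j : 'I_n) : 'M[K]_n :=
  \sum_(a < m) word_left a *m (P *m A i j - A i j *m P) *m word_right a.

Definition loop_derivative i j : R :=
  re (\tr (A i j *m word_derivative i j)) * Y +
  re (\tr (A i j *m W)) * (re (\tr (word_derivative i j)) / n%:R).

(** What remains of the first variation of tr (A (Q P)^m) after summation over the planes,
   up to the factor -2 and to lower order terms. *)
Definition loop_sum : K := \sum_(a < m)
  (\tr (word_left a *m P) * \tr (word_right a) -
   \tr (word_left a) * \tr (P *m word_right a)).

Let cP : frob_contr P := frob_contr_proj PP Pa.
Let cQ : frob_contr Q := frob_contr_proj QQ Qa.

Let cL a : frob_contr (word_left a).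
Proof. by apply: frob_contrM => //; apply: frob_contrX; exact: frob_contrM. Qed.

Let cR a : frob_contr (word_right a).
Proof. by apply: frob_contrX; exact: frob_contrM. Qed.

Let fW : fsq W <= n%:R.
Proof. by apply: frob_contr_fsq; apply: frob_contrX; exact: frob_contrM. Qed.

Let tr_le (X Z : 'M[K]_n) : fsq X <= n%:R -> fsq Z <= n%:R -> `|re (\tr (X *m Z))| <= n%:R.
Proof. by move=> hX hZ; apply: le_trans (re_mxtrace_mul_le _ _) _; lra. Qed.

Let nR0 : 0 < n%:R :> R. Proof. by rewrite ltr0n. Qed.

Let Y_le : `|Y| <= 1 + `|kappa|.
Proof.
rewrite (le_trans (ler_normB _ _))// lerD2r normrM normfV [`|n%:R|]ger0_norm//.
rewrite ler_pdivrMr// mul1r -[W]mulmx1; apply: tr_le => //.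
by rewrite fsq1.
Qed.

Lemma mxtrace_skew_derivative i j : \tr (A i j *m word_derivative i j) =
  \sum_(a < m) (\tr (A i j *m (word_left a *m P) *m A i j *m word_right a) -
                \tr (A i j *m word_left a *m A i j *m (P *m word_right a))).
Proof.
rewrite /word_derivative; move: (A i j) => B; rewrite mulmx_sumr raddf_sum /=; apply: eq_bigr => a _.
by rewrite mulmxBr mulmxBl mulmxBr raddfB /= !mulmxA.
Qed.

Lemma mxtrace_derivative i j : \tr (word_derivative i j) =
  \sum_(a < m) \tr (A i j *m (word_right a *m word_left a *m P -
                               P *m word_right a *m word_left a)).
Proof.
rewrite /word_derivative; move: (A i j) => B; rewrite raddf_sum /=; apply: eq_bigr => a _.
have e (X Z : 'M[K]_n) : \tr (X *m B *m Z) = \tr (B *m (Z *m X)).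
  by rewrite -mulmxA mxtrace_mulC -mulmxA.
rewrite mulmxBr mulmxBl mulmxBr !raddfB /=; congr (_ - _).
  by rewrite !mulmxA (e (word_left a *m P)) !mulmxA.
by rewrite !mulmxA -mulmxA e !mulmxA.
Qed.

(** Summing the derivative over all planes produces a product of traces of
   shorter words, the main term of order n^2, and terms of order n. *)
Lemma sum_loop_derivative :
  `|\sum_i \sum_j loop_derivative i j + 2 * re loop_sum * Y| <=
  14 * m%:R * (1 + `|kappa|) * n%:R.
Proof.
pose T1 := \sum_(a < m) (re (\tr (word_left a *m P *m (word_right a)^T)) -
                         re (\tr (word_left a *m (P *m word_right a)^T))).
pose T2 := \sum_i \sum_j re (\tr (A i j *m W)) * (re (\tr (word_derivative i j)) / n%:R).
have re2 (x : K) : re (2 * x) = 2 * re x by rewrite mulr_natl raddfMn /= mulr_natl.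
have e1 : \sum_i \sum_j loop_derivative i j = 2 * (T1 - re loop_sum) * Y + T2.
  rewrite /loop_derivative; under eq_bigr do rewrite big_split /=.
  rewrite big_split /= -/T2; congr (_ + _).
  under eq_bigr do rewrite -mulr_suml.
  rewrite -mulr_suml; congr (_ * Y).
  have -> : \sum_i \sum_j re (\tr (A i j *m word_derivative i j)) =
      re (\sum_i \sum_j \tr (A i j *m word_derivative i j)).
    by rewrite raddf_sum; apply: eq_bigr => i _; rewrite raddf_sum.
  under eq_bigr do under eq_bigr do rewrite mxtrace_skew_derivative.
  under eq_bigr do rewrite exchange_big /=.
  rewrite exchange_big /=.
  under eq_bigr do under eq_bigr do rewrite sumrB.
  under eq_bigr do rewrite sumrB !sum_mxtrace_skew.
  rewrite raddf_sum /T1 /loop_sum raddf_sum -sumrB mulr_sumr; apply: eq_bigr => a _.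
  rewrite -mulrBr /= re2; congr (_ * _).
  by rewrite !raddfB /=; ring.
have T1_le : `|T1| <= 2 * m%:R * n%:R.
  apply: le_trans (ler_norm_sum _ _ _) _.
  rewrite (_ : 2 * m%:R * n%:R = \sum_(a < m) (2 * n%:R)); last first.
    by rewrite sumr_const card_ord -mulr_natl; ring.
  apply: ler_sum => a _; apply: le_trans (ler_normB _ _) _.
  rewrite [leRHS](_ : _ = n%:R + n%:R); last by ring.
  have h1 : fsq (word_left a *m P) <= n%:R by apply/frob_contr_fsq/frob_contrM.
  have h2 : fsq (word_right a)^T <= n%:R by rewrite fsq_tr; apply/frob_contr_fsq.
  have h3 : fsq (word_left a) <= n%:R by apply/frob_contr_fsq.
  have h4 : fsq (P *m word_right a)^T <= n%:R.
    by rewrite fsq_tr; apply/frob_contr_fsq/frob_contrM.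
  by apply: lerD; [exact: tr_le h1 h2 | exact: tr_le h3 h4].
(* 10 = 2 (1 + 4), from the Frobenius norms of W and of the V a. *)
have T2_le : `|T2| <= 10 * m%:R.
  pose V a := word_right a *m word_left a *m P - P *m word_right a *m word_left a.
  have fV a : fsq (V a) <= 4 * n%:R.
    apply: le_trans (fsqB_le _ _) _.
    have h1 : fsq (word_right a *m word_left a *m P) <= n%:R.
      by apply: frob_contr_fsq; do ?apply: frob_contrM => //.
    have h2 : fsq (P *m word_right a *m word_left a) <= n%:R.
      by apply: frob_contr_fsq; do ?apply: frob_contrM => //.
    lra.
  apply: (@le_trans _ _ (\sum_i \sum_j \sum_(a < m)
      `|re (\tr (A i j *m W)) * re (\tr (A i j *m V a))| / n%:R)).
    apply: le_trans (ler_norm_sum _ _ _) _; apply: ler_sum => i _.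
    apply: le_trans (ler_norm_sum _ _ _) _; apply: ler_sum => j _.
    have -> : re (\tr (word_derivative i j)) = \sum_(a < m) re (\tr (A i j *m V a)).
      by rewrite mxtrace_derivative; exact: raddf_sum.
    set z := re _; rewrite mulr_suml mulr_sumr.
    apply: le_trans (ler_norm_sum _ _ _) _; apply: ler_sum => a _.
    by rewrite mulrA normrM normfV [`|n%:R|]ger0_norm.
  under eq_bigr do rewrite exchange_big /=.
  rewrite exchange_big /= (_ : 10 * m%:R = \sum_(a < m) 10); last first.
    by rewrite sumr_const card_ord -mulr_natl; ring.
  apply: ler_sum => a _; under eq_bigr do rewrite -mulr_suml.
  rewrite -mulr_suml ler_pdivrMr//.
  by apply: le_trans (sum_re_skew_mul_le _ _) _; have := fV a; have := fW; lra.
(* 14 = 4 + 10, from 2 T1 Y and from T2. *)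
rewrite e1; have -> : 2 * (T1 - re loop_sum) * Y + T2 + 2 * re loop_sum * Y = 2 * T1 * Y + T2 by ring.
apply: le_trans (ler_normD _ _) _; rewrite !normrM [`|2|]ger0_norm//.
have m0 : 0 <= m%:R :> R by [].
have k0 : 0 <= `|kappa| by [].
have n1 : 1 <= n%:R :> R by rewrite ler1n.
have hTY : `|T1| * `|Y| <= (2 * m%:R * n%:R) * (1 + `|kappa|) by rewrite ler_pM.
have : m%:R * 1 <= m%:R * ((1 + `|kappa|) * n%:R).
  rewrite ler_wpM2l// -[leLHS]mul1r ler_pM//; lra.
nra.
Qed.

End loop_pointwise.

Section loop_expansion.
Context (R : realType) (s : scalar_kind) (n m : nat) (kappa : R) (T : Type).
Local Notation K := (scalar_field R s).
Local Notation A := (skew_mx s).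
Context (P Q : T -> 'M[K]_n).
Hypotheses (PP : forall w, P w *m P w = P w) (Pa : forall w, adjoint (P w) = P w).
Hypotheses (QQ : forall w, Q w *m Q w = Q w) (Qa : forall w, adjoint (Q w) = Q w).

(** The second factor serves to test the loop equation against the centred moment, and
   thus to bound its second moment. *)
Definition loop_observable i j (P Q : 'M[K]_n) : R :=
  re (\tr (A i j *m (Q *m P) ^+ m)) * (re (\tr ((Q *m P) ^+ m)) / n%:R - kappa).

(** The squared Frobenius norm of a projection is at most n. *)
Lemma bounded_family_proj (M : T -> 'M[K]_n) : (forall w, M w *m M w = M w) ->
  (forall w, adjoint (M w) = M w) -> bounded_family (fun w (_ : R) => M w).
Proof.
move=> MM Ma; exists (1 + n%:R) => w _ i j _.
apply: le_trans (norm_of_re_im _) _; rewrite ler_of_real.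
have : nsq (M w i j) <= n%:R.
  apply: le_trans (frob_contr_fsq (frob_contr_proj (MM w) (Ma w))).
  rewrite /fsq (bigD1 i)//= (bigD1 j)//= -addrA lerDl addr_ge0//.
    by apply: sumr_ge0 => *; exact: nsq_ge0.
  by do 2 (apply: sumr_ge0 => * ); exact: nsq_ge0.
rewrite /nsq -[re _ ^+ 2]real_normK ?num_real// -[im _ ^+ 2]real_normK ?num_real//.
set a := `|re _|; set b := `|im _|.
have := sqr_ge0 (a - 1); have := sqr_ge0 (b - 1); nra.
Qed.

(** The rotation of E acts on its projection by conjugation, which moves P at speed
   P A - A P ([expands_rotation]); the product rule gives the rest. *)
Lemma loop_expansion i j : exists C, forall w,
  `|loop_derivative m kappa (P w) (Q w) i j| <= C /\
  forall t, `|t| <= 1 ->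
  `|loop_observable i j (adjoint (rotation s i j t) *m P w *m rotation s i j t) (Q w)
    - loop_observable i j (P w) (Q w) - t * loop_derivative m kappa (P w) (Q w) i j|
  <= C * t ^+ 2.
Proof.
have eP := expands_rotation i j (bounded_family_proj PP Pa).
have eQ := expands_const (bounded_family_proj QQ Qa).
have := expandsX m (expandsM eQ eP); set W1 := fun w => \sum_(a < m) _.
have -> : W1 = fun w => word_derivative m (P w) (Q w) i j.
  apply/funext => w; rewrite /W1 /word_derivative; apply: eq_bigr => a _.
  by rewrite mul0mx addr0 /word_left /word_right !mulmxA.
move=> eW; have eA := expandsM (expands_const (bounded_family_cst T (A i j))) eW.
case: eW eA => b0 b1 [W2 b2 hW] [a0 a1 [V2 c2 hV]].
case: (bounded_family_tr b0) => B0 {}b0. case: (bounded_family_tr b1) => B1 {}b1.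
case: (bounded_family_tr b2) => B2 {}b2. case: (bounded_family_tr a0) => A0 {}a0.
case: (bounded_family_tr a1) => A1 {}a1. case: (bounded_family_tr c2) => A2 {}c2.
have hN : exists N : R, 0 <= N /\ forall x : R, `|x / n%:R| <= N * `|x|.
  by exists `|n%:R^-1|; split => // x; rewrite normrM mulrC.
case: hN => N [N0 hN].
pose C1 := A0 + A1 + A2 + 1; pose C2 := N * (B0 + B1 + B2) + `|kappa|.
have l1 : `|0 : R| <= 1 by rewrite normr0.
exists (4 * (C1 * C2)) => w.
have {}b0 : `|re (\tr ((Q w *m P w) ^+ m)) / n%:R| <= N * B0.
  by rewrite (le_trans (hN _))// ler_wpM2l// (b0 w 0).
have {}b1 : `|re (\tr (word_derivative m (P w) (Q w) i j)) / n%:R| <= N * B1.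
  by rewrite (le_trans (hN _))// ler_wpM2l// (b1 w 0).
have {}a0 := a0 w 0 l1; have {}a1 := a1 w 0 l1.
rewrite mul0mx addr0 in a1.
have pos (x y : R) : `|x| <= y -> 0 <= y by move=> h; exact: le_trans h.
have A00 := pos _ _ a0; have A10 := pos _ _ a1.
have A20 := pos _ _ (c2 w 0 l1); have B00 := pos _ _ b0; have B10 := pos _ _ b1.
have B20 : 0 <= N * B2 by rewrite mulr_ge0// (pos _ _ (b2 w 0 l1)).
have k0 : 0 <= `|kappa| by [].
have C1E : C1 = A0 + A1 + A2 + 1 by [].
have C2E : C2 = N * B0 + N * B1 + N * B2 + `|kappa| by rewrite /C2; ring.
set x0 := re _ in a0; set x1 := re _ in a1.
set y0 := re _ / _ in b0; set y1 := re _ / _ in b1.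
have dE : loop_derivative m kappa (P w) (Q w) i j = x1 * (y0 - kappa) + x0 * y1 by [].
have y0k : `|y0 - kappa| <= N * B0 + `|kappa|.
  by rewrite (le_trans (ler_normB _ _))// lerD2r.
have M12 (x y : R) : `|x| <= C1 -> `|y| <= C2 -> `|x * y| <= C1 * C2.
  by move=> *; rewrite normrM ler_pM.
have le1 : `|x1 * (y0 - kappa)| <= C1 * C2 by apply: M12; lra.
have le2 : `|x0 * y1| <= C1 * C2 by apply: M12; lra.
have CC0 : 0 <= C1 * C2 := pos _ _ le2.
split.
  by rewrite dE (le_trans (ler_normD _ _))//; lra.
move=> t t1.
have {}c2 := c2 w t t1; have {}b2 := b2 w t t1.
have {}b2 : `|re (\tr (W2 w t)) / n%:R| <= N * B2.
  by rewrite (le_trans (hN _))// ler_wpM2l.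
set x2 := re _ in c2; set y2 := re _ / _ in b2.
have hx : re (\tr (A i j *m (Q w *m (adjoint (rotation s i j t) *m P w *m rotation s i j t)) ^+ m)) =
    x0 + t * x1 + t ^+ 2 * x2.
  rewrite hV mul0mx addr0 !raddfD /= !mxtraceZ.
  by rewrite !re_of_realM.
have hy : re (\tr ((Q w *m (adjoint (rotation s i j t) *m P w *m rotation s i j t)) ^+ m)) / n%:R =
    y0 + t * y1 + t ^+ 2 * y2.
  rewrite hW !raddfD /= !mxtraceZ !re_of_realM.
  by rewrite !mulrDl -!mulrA.
rewrite dE /loop_observable hx hy -/x0 -/y0.
have le3 : `|x1 * y1| <= C1 * C2 by apply: M12; lra.
have le4 : `|x0 * y2| <= C1 * C2 by apply: M12; lra.
have le5 : `|(x2 * (y0 + t * y1 + t ^+ 2 * y2 - kappa) + t * x1 * y2)| <= 2 * (C1 * C2).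
  have t2 : `|t ^+ 2| <= 1 by rewrite normrX exprn_ile1.
  rewrite (le_trans (ler_normD _ _))// [leRHS](_ : _ = C1 * C2 + C1 * C2); last by ring.
  apply: lerD; last first.
    apply: M12; last lra.
    rewrite normrM; apply: (@le_trans _ _ (1 * `|x1|)); first by rewrite ler_wpM2r.
    lra.
  apply: M12; first lra.
  rewrite (le_trans (ler_normB _ _))// (le_trans (lerD (ler_normD _ _) (lexx _)))//.
  have q1 : `|t * y1| <= N * B1 by rewrite normrM -[leRHS]mul1r ler_pM.
  have q2 : `|t ^+ 2 * y2| <= N * B2 by rewrite normrM -[leRHS]mul1r ler_pM.
  have := ler_normD y0 (t * y1); lra.
rewrite (_ : _ - _ - _ = (x1 * y1 + x0 * y2 +
   (x2 * (y0 + t * y1 + t ^+ 2 * y2 - kappa) + t * x1 * y2)) * t ^+ 2); last by ring.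
rewrite normrM [`|t ^+ 2|]ger0_norm ?sqr_ge0// ler_wpM2r ?sqr_ge0//.
rewrite (le_trans (ler_normD _ _))// (le_trans (lerD (ler_normD _ _) (lexx _)))//; lra.
Qed.

End loop_expansion.

(** * Measurability and invariance *)

Section grassmannian_measurability.
Context (R : realType) (s : scalar_kind) (n : nat).
Local Notation K := (scalar_field R s).

Definition proj_of (k : 'I_n.+1) (E : grassmannian R s k) : 'M[K]_n :=
  proj_mx_on (val (E : subspace_of_dim R s k)).

Lemma re_norm_lt (x : K) (c : R) : `|x| < of_real s c -> `|re x| < c.
Proof.
rewrite /re; move: x; case: s => //= x h.
by rewrite -ltcR; exact: le_lt_trans (normc_ge_Re x) h.
Qed.

Lemma im_norm_lt (x : K) (c : R) : `|x| < of_real s c -> `|im x| < c.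
Proof.
rewrite /im; move: x; case: s => /= x h.
  by rewrite normr0; exact: le_lt_trans h.
have -> : complex.Im x = complex.Re (x * - 'i%C) by case: x {h} => a b /=; ring.
rewrite -ltcR; apply: le_lt_trans (normc_ge_Re _) _.
rewrite normrM normrN (_ : `|'i%C : R[i]%C| = 1) ?mulr1//.
by rewrite normc_def /= expr0n expr1n add0r sqrtr1.
Qed.

Lemma of_real_gt0 (e : R) : 0 < e -> 0 < of_real s e.
Proof. by case: s => //= e0; rewrite ltcR. Qed.

Lemma continuous_re : continuous (@re R s).
Proof.
move=> x B /nbhs_ballP[e /= e0 eB]; apply/nbhs_ballP.
exists (of_real s e); first exact: of_real_gt0.
move=> y xy; apply: eB; rewrite /ball /= -raddfB; apply: re_norm_lt; exact: xy.
Qed.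

Lemma continuous_im : continuous (@im R s).
Proof.
move=> x B /nbhs_ballP[e /= e0 eB]; apply/nbhs_ballP.
exists (of_real s e); first exact: of_real_gt0.
move=> y xy; apply: eB; rewrite /ball /= -raddfB; apply: im_norm_lt; exact: xy.
Qed.

Lemma measurable_proj_open k (O : set 'M[K]_n) : open O ->
  measurable (@proj_of k @^-1` O).
Proof. by move=> oO; apply: sub_sigma_algebra; exists O. Qed.

Lemma measurable_continuous_proj k (f : 'M[K]_n -> R) : continuous f ->
  measurable_fun [set: grassmannian R s k] (f \o @proj_of k).
Proof.
move=> cf; apply: (measurability _ (RGenOInfty.measurableE R)) => //.
move=> _ [_ [x ->] <-]; rewrite setTI comp_preimage.
apply: measurable_proj_open; apply: open_comp; last exact: rray_open.
by move=> ? _; exact: cf.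
Qed.

Lemma measurable_re_proj k i j :
  measurable_fun [set: grassmannian R s k] (fun E => re (proj_of E i j)).
Proof.
apply: (@measurable_continuous_proj _ (fun M => re (M i j))) => M.
apply: (@continuous_comp _ _ _ (fun N : 'M[K]_n => N i j) (@re R s)).
  exact: coord_continuous.
exact: continuous_re.
Qed.

Lemma measurable_im_proj k i j :
  measurable_fun [set: grassmannian R s k] (fun E => im (proj_of E i j)).
Proof.
apply: (@measurable_continuous_proj _ (fun M => im (M i j))) => M.
apply: (@continuous_comp _ _ _ (fun N : 'M[K]_n => N i j) (@im R s)).
  exact: coord_continuous.
exact: continuous_im.
Qed.

Lemma continuous_conj_mx (U V : 'M[K]_n) : continuous (fun M => U *m M *m V).
Proof.
move=> M B [Pij hP sB]; rewrite nbhs_filterE.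
have hij i j : \forall N \near M, Pij i j ((U *m N *m V) i j).
  suff cij : continuous (fun N : 'M[K]_n => (U *m N *m V) i j).
    by apply: (cij M); exact: hP.
  rewrite (_ : (fun N => _) = fun N : 'M[K]_n => \sum_a (\sum_b U i b * N b a) * V a j).
    apply: continuous_big => [|a _ N]; first exact: add_continuous.
    apply: (@cvgM K _ (nbhs N) (nbhs_filter N)); last exact: cvg_cst.
    apply: continuous_big => [|b _ N']; first exact: add_continuous.
    by apply: (@cvgM K _ (nbhs N') (nbhs_filter N')); [exact: cvg_cst|exact: coord_continuous].
  by apply/funext => N; rewrite !mxE; apply: eq_bigr => a _; rewrite !mxE.
have hall : nbhs M [set N | forall i j, Pij i j ((U *m N *m V) i j)].
  exact: (filter_forall (nbhs_filter M) (fun i => filter_forall (nbhs_filter M) (hij i))).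
by apply: (@filterS _ (nbhs M) _ _ _ _ hall) => N hN; exact: sB.
Qed.

Lemma proj_rotate k (U : 'M[K]_n) (E : grassmannian R s k) : unitary_matrix U ->
  proj_of (rotate U E) = adjoint U *m proj_of E *m U.
Proof. by move=> UU; rewrite /proj_of val_rotate// proj_mx_on_limg. Qed.

(** The rotation corresponds to the continuous map M |-> U^* M U on projections, whose
   open sets generate the sigma-algebra. *)
Lemma measurable_rotate k (U : 'M[K]_n) : unitary_matrix U ->
  measurable_fun setT (@rotate R s n k U).
Proof.
move=> UU; apply: (@measurability _ _ (grassmannian R s k) (grassmannian R s k)
  setT (@rotate R s n k U) (@grassmannian_open R s n k) erefl).
move=> _ [_ [B openB <- ] <- ]; rewrite setTI.
rewrite (_ : _ @^-1` _ = @proj_of k @^-1`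
    ((fun M => adjoint U *m M *m U) @^-1` B)); last first.
  by apply/seteqP; split => E /=; rewrite -proj_rotate.
apply: measurable_proj_open; apply: open_comp => // M _.
exact: continuous_conj_mx.
Qed.

End grassmannian_measurability.

Section matrix_measurability.
Context (R : realType) (s : scalar_kind) d (X : measurableType d).
Local Notation K := (scalar_field R s).

(** In terms of real and imaginary parts, which is uniform over the two scalar fields. *)
Definition measurable_mx m n (M : X -> 'M[K]_(m, n)) := forall i j,
  measurable_fun setT (fun x => re (M x i j)) /\
  measurable_fun setT (fun x => im (M x i j)).

Lemma measurable_mx_cst m n (M : 'M[K]_(m, n)) : measurable_mx (fun=> M).
Proof. by move=> i j; split; exact: measurable_cst. Qed.

Lemma measurable_mxM m n p (M : X -> 'M[K]_(m, n)) (N : X -> 'M[K]_(n, p)) :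
  measurable_mx M -> measurable_mx N -> measurable_mx (fun x => M x *m N x).
Proof.
move=> hM hN i j; split.
  rewrite (_ : (fun x => _) = fun x => \sum_l (re (M x i l) * re (N x l j) -
      im (M x i l) * im (N x l j))); last first.
    by apply/funext => x; rewrite mxE raddf_sum; apply: eq_bigr => l _; rewrite /= reM.
  apply: measurable_sum => l; apply: measurable_funB; apply: measurable_funM;
    by [case: (hM i l) | case: (hN l j)].
rewrite (_ : (fun x => _) = fun x => \sum_l (re (M x i l) * im (N x l j) +
    im (M x i l) * re (N x l j))); last first.
  by apply/funext => x; rewrite mxE raddf_sum; apply: eq_bigr => l _; rewrite /= imM.
apply: measurable_sum => l; apply: measurable_funD; apply: measurable_funM;
  by [case: (hM i l) | case: (hN l j)].
Qed.

Lemma measurable_mxB m n (M N : X -> 'M[K]_(m, n)) :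
  measurable_mx M -> measurable_mx N -> measurable_mx (fun x => M x - N x).
Proof.
move=> hM hN i j; case: (hM i j) (hN i j) => h1 h2 [h3 h4]; split.
  rewrite (_ : (fun x => _) = fun x => re (M x i j) - re (N x i j)); last first.
    by apply/funext => x; rewrite !mxE raddfB.
  exact: measurable_funB.
rewrite (_ : (fun x => _) = fun x => im (M x i j) - im (N x i j)); last first.
  by apply/funext => x; rewrite !mxE raddfB.
exact: measurable_funB.
Qed.

Lemma measurable_mx_sum m n I (r : seq I) (M : I -> X -> 'M[K]_(m, n)) :
  (forall a, measurable_mx (M a)) ->
  measurable_mx (fun x => \sum_(a <- r) M a x).
Proof.
move=> hM i j; split.
  rewrite (_ : (fun x => _) = fun x => \sum_(a <- r) re (M a x i j)); last first.
    by apply/funext => x; rewrite summxE raddf_sum.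
  by apply: measurable_sum => a; case: (hM a i j).
rewrite (_ : (fun x => _) = fun x => \sum_(a <- r) im (M a x i j)); last first.
  by apply/funext => x; rewrite summxE raddf_sum.
by apply: measurable_sum => a; case: (hM a i j).
Qed.

Lemma measurable_mxX n (M : X -> 'M[K]_n) a :
  measurable_mx M -> measurable_mx (fun x => M x ^+ a).
Proof.
move=> hM; elim: a => [|a IH]; first exact: measurable_mx_cst.
rewrite (_ : (fun x => _) = fun x => M x *m M x ^+ a); last first.
  by apply/funext => x; rewrite exprS.
exact: measurable_mxM.
Qed.

Lemma measurable_re_tr n (M : X -> 'M[K]_n) : measurable_mx M ->
  measurable_fun setT (fun x => re (\tr (M x))).
Proof.
move=> hM; rewrite (_ : (fun x => _) = fun x => \sum_i re (M x i i)); last first.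
  by apply/funext => x; rewrite /mxtrace raddf_sum.
by apply: measurable_sum => i; case: (hM i i).
Qed.

Context (n m : nat) (kappa : R) (P Q : X -> 'M[K]_n).
Hypotheses (mP : measurable_mx P) (mQ : measurable_mx Q).

Lemma measurable_word a : measurable_mx (fun x => (Q x *m P x) ^+ a).
Proof. by apply: measurable_mxX; exact: measurable_mxM. Qed.

Lemma measurable_loop_observable i j :
  measurable_fun setT (fun x => loop_observable m kappa i j (P x) (Q x)).
Proof.
apply: measurable_funM.
  apply: measurable_re_tr; apply: measurable_mxM (measurable_word _).
  exact: measurable_mx_cst.
apply: measurable_funB => //; apply: measurable_funM => //.
exact/measurable_re_tr/measurable_word.
Qed.

Lemma measurable_loop_derivative i j :
  measurable_fun setT (fun x => loop_derivative m kappa (P x) (Q x) i j).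
Proof.
have mc := measurable_mx_cst (skew_mx s i j).
have mD : measurable_mx (fun x => word_derivative m (P x) (Q x) i j).
  apply: measurable_mx_sum => a; apply: measurable_mxM (measurable_word _).
  apply: measurable_mxM; first by apply: measurable_mxM => //; exact: measurable_word.
  by apply: measurable_mxB; exact: measurable_mxM.
apply: measurable_funD; apply: measurable_funM.
- by apply: measurable_re_tr; exact: measurable_mxM.
- apply: measurable_funB => //; apply: measurable_funM => //.
  exact/measurable_re_tr/measurable_word.
- by apply: measurable_re_tr; apply: measurable_mxM => //; exact: measurable_word.
- by apply: measurable_funM => //; exact: measurable_re_tr.
Qed.

End matrix_measurability.

(** * The loop equation in mean *)

Section expectations.
Context (R : realType) d (T : measurableType d) (P : probability T R).
Implicit Types f g : T -> R.

Definition bounded_measurable f :=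
  measurable_fun setT f /\ exists C, forall w, `|f w| <= C.

Lemma bounded_measurable_cst c : bounded_measurable (fun=> c).
Proof. by split; [exact: measurable_cst|exists `|c|]. Qed.

Lemma bounded_measurableD f g : bounded_measurable f -> bounded_measurable g ->
  bounded_measurable (fun w => f w + g w).
Proof.
move=> [mf [C hC]] [mg [C' hC']]; split; first exact: measurable_funD.
by exists (C + C') => w; rewrite (le_trans (ler_normD _ _))// lerD.
Qed.

Lemma bounded_measurableM f g : bounded_measurable f -> bounded_measurable g ->
  bounded_measurable (fun w => f w * g w).
Proof.
move=> [mf [C hC]] [mg [C' hC']]; split; first exact: measurable_funM.
by exists (C * C') => w; rewrite normrM ler_pM.
Qed.

Lemma bounded_measurableN f : bounded_measurable f -> bounded_measurable (fun w => - f w).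
Proof.
move=> [mf [C hC]]; split; first exact: measurable_funN.
by exists C => w; rewrite normrN.
Qed.

Lemma bounded_measurableB f g : bounded_measurable f -> bounded_measurable g ->
  bounded_measurable (fun w => f w - g w).
Proof. by move=> bf /bounded_measurableN; exact: bounded_measurableD. Qed.

Lemma bounded_measurable_sum I (r : seq I) (p : pred I) (f : I -> T -> R) :
  (forall i, bounded_measurable (f i)) ->
  bounded_measurable (fun w => \sum_(i <- r | p i) f i w).
Proof.
move=> bf; elim: r => [|i r IH].
  rewrite (_ : (fun w => _) = fun=> 0); first exact: bounded_measurable_cst.
  by apply/funext => w; rewrite big_nil.
rewrite (_ : (fun w => _) = fun w => (if p i then f i w else 0) +
    \sum_(j <- r | p j) f j w); last first.
  by apply/funext => w; rewrite big_cons; case: ifP; rewrite ?add0r.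
apply: bounded_measurableD => //; case: (p i) => //.
exact: bounded_measurable_cst.
Qed.

Lemma bounded_measurable_integrable f : bounded_measurable f ->
  P.-integrable setT (EFin \o f).
Proof.
move=> [mf [C hC]]; apply: measurable_bounded_integrable => //.
  exact: le_lt_trans (probability_le1 P measurableT) (ltry _).
exists C; split; first exact: num_real.
by move=> M CM w _ /=; rewrite (le_trans (hC w))// ltW.
Qed.

Lemma meanD f g : bounded_measurable f -> bounded_measurable g ->
  \int[P]_w (f w + g w) = \int[P]_w f w + \int[P]_w g w.
Proof. by move=> bf bg; rewrite RintegralD//; exact: bounded_measurable_integrable. Qed.

Lemma meanB f g : bounded_measurable f -> bounded_measurable g ->
  \int[P]_w (f w - g w) = \int[P]_w f w - \int[P]_w g w.
Proof. by move=> bf bg; rewrite RintegralB//; exact: bounded_measurable_integrable. Qed.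

Lemma meanZ c f : bounded_measurable f ->
  \int[P]_w (c * f w) = c * \int[P]_w f w.
Proof. by move=> bf; rewrite RintegralZl//; exact: bounded_measurable_integrable. Qed.

Lemma mean_cst c : \int[P]_w c = c.
Proof.
have PT : (P : {measure set T -> \bar R}) setT = 1%E by exact: probability_setT.
by rewrite Rintegral_cst// PT /= mulr1.
Qed.

Lemma mean_sum I (r : seq I) (f : I -> T -> R) :
  (forall i, bounded_measurable (f i)) ->
  \int[P]_w (\sum_(i <- r) f i w) = \sum_(i <- r) \int[P]_w f i w.
Proof.
move=> bf; elim: r => [|i r IH].
  by under eq_Rintegral do rewrite big_nil; rewrite mean_cst big_nil.
under eq_Rintegral do rewrite big_cons.
by rewrite meanD// ?big_cons ?IH//; exact: bounded_measurable_sum.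
Qed.

Lemma le_mean f g : bounded_measurable f -> bounded_measurable g ->
  (forall w, f w <= g w) -> \int[P]_w f w <= \int[P]_w g w.
Proof.
by move=> bf bg fg; apply: le_Rintegral => //; exact: bounded_measurable_integrable.
Qed.

Lemma mean_norm_le f C : bounded_measurable f -> (forall w, `|f w| <= C) ->
  `|\int[P]_w f w| <= C.
Proof.
move=> bf fC; have bc := bounded_measurable_cst.
have fC' w : - C <= f w <= C by rewrite -ler_norml.
rewrite ler_norml; apply/andP; split.
  rewrite -[leLHS]mean_cst; apply: le_mean => // w.
  by case/andP: (fC' w).
rewrite -[leRHS]mean_cst; apply: le_mean => // w.
by case/andP: (fC' w).
Qed.

Lemma measurable_fun_mfun d' (Y : measurableType d') (X : T -> Y) :
  measurable_fun setT X -> exists Z : {mfun T >-> Y}, X = Z.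
Proof.
move=> mX.
pose Z : {mfun T >-> Y} := HB.pack X (isMeasurableFun.Build _ _ _ _ X mX).
by exists Z.
Qed.

Lemma mean_law_eq d' (Y : measurableType d') (X1 X2 : T -> Y) (h : Y -> R) :
  measurable_fun setT X1 -> measurable_fun setT X2 ->
  (forall A, measurable A -> P (X1 @^-1` A) = P (X2 @^-1` A)) ->
  measurable_fun setT h -> (exists C, forall y, `|h y| <= C) ->
  \int[P]_w h (X1 w) = \int[P]_w h (X2 w).
Proof.
move=> m1 m2 e12 mh [C hC].
have key (X : T -> Y) (mX : measurable_fun setT X) :
    (\int[P]_w (h (X w))%:E = \int[pushforward P X]_y (h y)%:E)%E.
  have iX : P.-integrable (X @^-1` setT) ((EFin \o h) \o X).
    rewrite preimage_setT; apply: (@bounded_measurable_integrable (h \o X)); split.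
      exact: measurableT_comp.
    by exists C => w /=.
  by rewrite (integral_pushforward mX _ iX)//; exact/measurable_EFinP.
rewrite /Rintegral !key//; congr fine.
have [Z1 Z1E] := measurable_fun_mfun m1; have [Z2 Z2E] := measurable_fun_mfun m2.
rewrite Z1E Z2E in e12 *.
apply: (@eq_measure_integral _ Y R setT (distribution P Z2) (distribution P Z1)).
by move=> A mA _; exact: e12.
Qed.

(** The difference quotients of f at 0 have mean zero and tend to f1 uniformly. *)
Lemma mean_first_variation (f : R -> T -> R) (f0 f1 : T -> R) C :
  bounded_measurable f0 -> bounded_measurable f1 ->
  (forall t, bounded_measurable (f t)) ->
  (forall t, \int[P]_w f t w = \int[P]_w f0 w) ->
  0 <= C ->
  (forall t w, `|t| <= 1 -> `|f t w - f0 w - t * f1 w| <= C * t ^+ 2) ->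
  \int[P]_w f1 w = 0.
Proof.
move=> b0 b1 bf inv C0 hC.
set I := \int[P]_w _; apply/eqP; rewrite -normr_eq0 eq_le normr_ge0 andbT.
apply/ler_addgt0Pr => e e0; rewrite add0r.
pose t := Num.min 1 (e / (C + 1)).
have t0 : 0 < t by rewrite lt_min ltr01 divr_gt0// ltr_wpDl.
have t1 : `|t| <= 1 by rewrite gtr0_norm// ge_min lexx.
have b3 := bounded_measurableM (bounded_measurable_cst t) b1.
have b4 := bounded_measurableB (bf t) b0.
have := mean_norm_le (bounded_measurableB b4 b3) (fun w => hC t w t1).
rewrite meanB// meanB// inv subrr sub0r normrN meanZ//.
rewrite normrM gtr0_norm// -/I.
rewrite expr2 (mulrC C) -mulrA ler_pM2l// => /le_trans; apply.
apply: (@le_trans _ _ (e / (C + 1) * C)).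
  by rewrite ler_wpM2r// ge_min lexx orbT.
rewrite mulrAC ler_pdivrMr ?ltr_wpDl// ler_wpM2l ?(ltW e0)//.
by rewrite lerDl.
Qed.

End expectations.

Section loop_equation.
Context (R : realType) (s : scalar_kind) (n m : nat) (kappa : R) (k l : 'I_n.+1).
Context d (T : measurableType d) (P : probability T R).
Context (E : {mfun T >-> grassmannian R s k}) (F : {mfun T >-> grassmannian R s l}).
Hypothesis hE : is_haar_measure (distribution P E).
Hypothesis hEF : independent_variables P E F.
Local Notation K := (scalar_field R s).

(** The two pairs have the same law: their components are independent, with the same
   marginal laws since the law of E is invariant. *)
Lemma rotation_invariance (U : 'M[K]_n)
    (h : grassmannian R s k * grassmannian R s l -> R) : unitary_matrix U ->
  measurable_fun setT h -> (exists C, forall y, `|h y| <= C) ->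
  \int[P]_w h (rotate U (E w), F w) = \int[P]_w h (E w, F w).
Proof.
move=> UU mh bh.
have mE : measurable_fun setT E by [].
have mF : measurable_fun setT F by [].
have mU : measurable_fun setT (rotate U \o E).
  by apply: measurableT_comp => //; exact: measurable_rotate.
have m1 : measurable_fun setT (fun w => (rotate U (E w), F w)).
  exact: measurable_fun_pair.
have m2 : measurable_fun setT (fun w => (E w, F w)) by exact: measurable_fun_pair.
apply: (mean_law_eq m1 m2) => // A mA.
have [Z1 Z1E] := measurable_fun_mfun m1; have [Z2 Z2E] := measurable_fun_mfun m2.
have q1 : ((distribution P E) \x (distribution P F))%E A = distribution P Z1 A.
  apply: product_measure_unique => // A1 A2 mA1 mA2.
  change (P (Z1 @^-1` (A1 `*` A2)) = (P (E @^-1` A1) * P (F @^-1` A2))%E).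
  rewrite -Z1E.
  rewrite -[P (E @^-1` _)]/(distribution P E A1) -(hE UU mA1).
  apply: hEF => //; rewrite -[_ @^-1` _]setTI; exact: (measurable_rotate UU).
have q2 : ((distribution P E) \x (distribution P F))%E A = distribution P Z2 A.
  apply: product_measure_unique => // A1 A2 mA1 mA2.
  change (P (Z2 @^-1` (A1 `*` A2)) = (P (E @^-1` A1) * P (F @^-1` A2))%E).
  by rewrite -Z2E; exact: hEF.
by rewrite Z1E Z2E; exact: etrans (esym q1) q2.
Qed.

Let pE w := proj_of (E w).
Let pF w := proj_of (F w).

Lemma proj_of_props (j : 'I_n.+1) (G : grassmannian R s j) :
  proj_of G *m proj_of G = proj_of G /\ adjoint (proj_of G) = proj_of G.
Proof. exact: proj_mx_on_props. Qed.

Lemma measurable_proj_of (j : 'I_n.+1) : measurable_mx (@proj_of R s n j).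
Proof. by move=> a b; split; [exact: measurable_re_proj|exact: measurable_im_proj]. Qed.

Lemma measurable_mx_comp d1 d2 (X : measurableType d1) (Y : measurableType d2)
    p q (M : Y -> 'M[K]_(p, q)) (f : X -> Y) :
  measurable_fun setT f -> measurable_mx M -> measurable_mx (M \o f).
Proof.
move=> mf mM i j; case: (mM i j) => h1 h2.
by split; [exact: (measurableT_comp h1)|exact: (measurableT_comp h2)].
Qed.

Lemma measurable_pE : measurable_mx pE.
Proof. by apply: (@measurable_mx_comp _ _ _ _ _ _ _ E) => //; exact: measurable_proj_of. Qed.

Lemma measurable_pF : measurable_mx pF.
Proof. by apply: (@measurable_mx_comp _ _ _ _ _ _ _ F) => //; exact: measurable_proj_of. Qed.

Lemma loop_observable_bounded i j (P1 Q1 : 'M[K]_n) :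
  P1 *m P1 = P1 -> adjoint P1 = P1 -> Q1 *m Q1 = Q1 -> adjoint Q1 = Q1 ->
  `|loop_observable m kappa i j P1 Q1| <=
  (fsq (skew_mx s i j : 'M[K]_n) + n%:R) / 2 * (n%:R * `|n%:R^-1| + `|kappa|).
Proof.
move=> PP Pa QQ Qa.
have fW : fsq ((Q1 *m P1) ^+ m) <= n%:R.
  by apply/frob_contr_fsq/frob_contrX/frob_contrM; exact: frob_contr_proj.
rewrite normrM; apply: ler_pM => //.
  by apply: le_trans (re_mxtrace_mul_le _ _) _; have := fW; lra.
rewrite (le_trans (ler_normB _ _))// lerD2r normrM ler_wpM2r//.
rewrite -[_ ^+ m]mulmx1; apply: le_trans (re_mxtrace_mul_le _ _) _.
by rewrite fsq1; have := fW; lra.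
Qed.

(** Rotating E by a small angle does not change the mean of an observable, so
   that its first variation has mean zero. *)
Lemma mean_loop_derivative i j :
  \int[P]_w loop_derivative m kappa (pE w) (pF w) i j = 0.
Proof.
have [->|ij] := eqVneq i j.
  have z w : loop_derivative m kappa (pE w) (pF w) j j = 0.
    by rewrite /loop_derivative /skew_mx subrr !mul0mx mxtrace0 raddf0 !mul0r addr0.
  by under eq_Rintegral do rewrite z; rewrite mean_cst.
have PPE w := proj1 (proj_of_props (E w)); have PaE w := proj2 (proj_of_props (E w)).
have PPF w := proj1 (proj_of_props (F w)); have PaF w := proj2 (proj_of_props (F w)).
have [C hC] := loop_expansion m kappa PPE PaE PPF PaF i j.
have md : bounded_measurable (fun w => loop_derivative m kappa (pE w) (pF w) i j).
  split; last by exists C => w; case: (hC w).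
  by apply: measurable_loop_derivative; [exact: measurable_pE|exact: measurable_pF].
pose h (y : grassmannian R s k * grassmannian R s l) :=
  loop_observable m kappa i j (proj_of y.1) (proj_of y.2).
have mh : measurable_fun setT h.
  apply: measurable_loop_observable.
    by apply: (@measurable_mx_comp _ _ _ _ _ _ _ fst) => //; exact: measurable_proj_of.
  by apply: (@measurable_mx_comp _ _ _ _ _ _ _ snd) => //; exact: measurable_proj_of.
have bh : exists C, forall y, `|h y| <= C.
  eexists => y; have [? ?] := proj_of_props y.1; have [? ?] := proj_of_props y.2.
  exact: loop_observable_bounded.
have C0 : 0 <= C by have [+ _] := hC point; apply: le_trans.
have bm (X : T -> grassmannian R s k) : measurable_fun setT X ->
    bounded_measurable (fun w => h (X w, F w)).
  move=> mX; split; last by have [B hB] := bh; exists B => w; exact: hB.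
  apply: (measurableT_comp mh); exact: measurable_fun_pair.
have UU t := @rotation_unitary R s n i j t ij.
have bt t : bounded_measurable (fun w => h (rotate (rotation s i j t) (E w), F w)).
  apply: (bm (fun w => rotate (rotation s i j t) (E w))).
  by apply: measurableT_comp; [exact: measurable_rotate|].
have et t : \int[P]_w h (rotate (rotation s i j t) (E w), F w) =
    \int[P]_w h (E w, F w).
  exact: rotation_invariance (UU t) mh bh.
apply: (mean_first_variation (bm _ _) md bt et C0); first by [].
by move=> t w t1; case: (hC w) => _ /(_ t t1); rewrite -(proj_rotate _ (UU t)).
Qed.

Lemma bounded_measurable_trace a :
  bounded_measurable (fun w => re (\tr ((pF w *m pE w) ^+ a))).
Proof.
split.
  by apply: measurable_re_tr; apply: measurable_word; [exact: measurable_pE|exact: measurable_pF].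
exists n%:R => w; have [? ?] := proj_of_props (E w); have [? ?] := proj_of_props (F w).
rewrite -[_ ^+ a]mulmx1; apply: le_trans (re_mxtrace_mul_le _ _) _.
have : fsq ((pF w *m pE w) ^+ a) <= n%:R.
  by apply/frob_contr_fsq/frob_contrX/frob_contrM; exact: frob_contr_proj.
by rewrite fsq1; lra.
Qed.

(** The bound is of order n whereas loop_sum is of order n^2, so that the normalised loop
   equation holds up to 1 / n. *)
Lemma mean_loop_sum : (0 < n)%N ->
  bounded_measurable (fun w => re (loop_sum m (pE w) (pF w))) ->
  `|\int[P]_w (re (loop_sum m (pE w) (pF w)) *
      (re (\tr ((pF w *m pE w) ^+ m)) / n%:R - kappa))| <=
  7 * m%:R * (1 + `|kappa|) * n%:R.
Proof.
move=> n0 bX.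
have PPE w := proj1 (proj_of_props (E w)); have PaE w := proj2 (proj_of_props (E w)).
have PPF w := proj1 (proj_of_props (F w)); have PaF w := proj2 (proj_of_props (F w)).
have bY : bounded_measurable (fun w => re (\tr ((pF w *m pE w) ^+ m)) / n%:R - kappa).
  apply: bounded_measurableB; last exact: bounded_measurable_cst.
  apply: bounded_measurableM; last exact: bounded_measurable_cst.
  exact: bounded_measurable_trace.
have bD i j : bounded_measurable (fun w => loop_derivative m kappa (pE w) (pF w) i j).
  have [C hC] := loop_expansion m kappa PPE PaE PPF PaF i j.
  split; last by exists C => w; case: (hC w).
  by apply: measurable_loop_derivative; [exact: measurable_pE|exact: measurable_pF].
pose S w := \sum_i \sum_j loop_derivative m kappa (pE w) (pF w) i j.
have bS : bounded_measurable S.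
  by do 2 (apply: bounded_measurable_sum => ?).
have S0 : \int[P]_w S w = 0.
  rewrite mean_sum => [|i]; last exact: bounded_measurable_sum.
  rewrite big1// => i _; rewrite mean_sum// big1// => j _.
  exact: mean_loop_derivative.
have bXY := bounded_measurableM bX bY.
have b2 := bounded_measurableM (bounded_measurable_cst T 2) bXY.
have : `|\int[P]_w (S w + 2 * (re (loop_sum m (pE w) (pF w)) *
      (re (\tr ((pF w *m pE w) ^+ m)) / n%:R - kappa)))| <=
    14 * m%:R * (1 + `|kappa|) * n%:R.
  apply: mean_norm_le; first exact: bounded_measurableD.
  move=> w; rewrite [2 * _]mulrA.
  exact: (sum_loop_derivative m kappa n0 (PPE w) (PaE w) (PPF w) (PaF w)).
rewrite meanD// S0 add0r meanZ// normrM ger0_norm//.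
by set Z := `|_|; lra.
Qed.

End loop_equation.

(** * Convergence of the moments *)

Section loop_defect.
Context (R : realType).

(** The amount by which a sequence of moments c fails the limit loop equation;
   a and b stand for the normalised traces of the two projections. *)
Definition loop_defect (a b : R) (c : nat -> R) m : R := \sum_(i < m)
  (c i.+1 * (if (m - i.+1)%N is 0 then 1 else c (m - i.+1)%N) -
   (if i : nat is 0 then b else c i) *
   (if (m - i.+1)%N is 0 then a else c (m - i.+1)%N)).

Definition normalized_moment n (k l : 'I_n.+1) (theta : (minn k l).-tuple R) j : R :=
  (\sum_(i < minn k l) cos theta`_i ^+ (2 * j)) / n%:R.

Lemma normalized_moment_bounds n (k l : 'I_n.+1) (theta : (minn k l).-tuple R) j :
  0 <= normalized_moment theta j <= 1.
Proof.
have h i : 0 <= cos theta`_i ^+ (2 * j) <= 1.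
  by rewrite exprM exprn_ge0 ?sqr_ge0//= exprn_ile1 ?sqr_ge0// cos2_le1.
apply/andP; split; first by rewrite divr_ge0// sumr_ge0// => i _; case/andP: (h i).
have [n0|n0] := posnP n.
  by rewrite /normalized_moment (_ : n%:R = 0) ?invr0 ?mulr0// n0.
rewrite ler_pdivrMr ?ltr0n// mul1r.
apply: (@le_trans _ _ (\sum_(i < minn k l) 1)).
  by apply: ler_sum => i _; case/andP: (h i).
by rewrite sumr_const card_ord ler_nat; have := ltn_ord k; lia.
Qed.

Lemma re_loop_sum_angles s n (k l : 'I_n.+1) (E : grassmannian R s k)
    (F : grassmannian R s l) (theta : (minn k l).-tuple R) m : (0 < n)%N ->
  principal_angles E F theta ->
  re (loop_sum m (proj_of E) (proj_of F)) = n%:R ^+ 2 *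
    loop_defect (k%:R / n%:R) (l%:R / n%:R) (normalized_moment theta) m.
Proof.
move=> n0 h; set P := proj_of E; set Q := proj_of F.
have nR : n%:R != 0 :> R by rewrite pnatr_eq0 -lt0n.
have [PP _] := proj_of_props E; have [QQ _] := proj_of_props F.
rewrite -/P in PP; rewrite -/Q in QQ.
have [tP tQ] := mxtrace_proj h; rewrite -!/(proj_of _) -/P -/Q in tP tQ.
have tW j : (0 < j)%N -> \tr ((Q *m P) ^+ j) =
    of_real s (n%:R * normalized_moment theta j).
  by move=> j0; rewrite (mxtrace_QP h j0) /normalized_moment mulrCA divff// mulr1.
clearbody P Q.
rewrite /loop_sum /loop_defect raddf_sum mulr_sumr; apply: eq_bigr => -[i /= im] _.
have e1 : \tr (word_left P Q i *m P) = of_real s (n%:R * normalized_moment theta i.+1).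
  by rewrite -tW// /word_left exprSr -mulmxE !mulmxA.
have e2 : \tr (word_right m P Q i) = of_real s (n%:R *
    (if (m - i.+1)%N is 0 then 1 else normalized_moment theta (m - i.+1)%N)).
  rewrite /word_right; case: (m - i.+1)%N => [|j]; last by rewrite tW.
  by rewrite expr0 mxtrace1 mulr1 rmorph_nat.
have e3 : \tr (word_left P Q i) = of_real s (n%:R *
    (if i is 0 then l%:R / n%:R else normalized_moment theta i)).
  rewrite /word_left; case: (i) => [|j].
    by rewrite expr0 mul1mx tQ mulrCA divff// mulr1 rmorph_nat.
  by rewrite -tW// mxtrace_mulC exprS -mulmxE !mulmxA QQ.
have e4 : \tr (P *m word_right m P Q i) = of_real s (n%:R *
    (if (m - i.+1)%N is 0 then k%:R / n%:R else normalized_moment theta (m - i.+1)%N)).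
  rewrite /word_right; case: (m - i.+1)%N => [|j].
    by rewrite expr0 mulmx1 tP mulrCA divff// mulr1 rmorph_nat.
  by rewrite -tW// mxtrace_mulC exprSr -mulmxE -!mulmxA PP.
rewrite e1 e2 e3 e4 -!rmorphM -rmorphB /= re_of_real.
by ring.
Qed.

Lemma re_mxtrace_angles s n (k l : 'I_n.+1) (E : grassmannian R s k)
    (F : grassmannian R s l) (theta : (minn k l).-tuple R) j : (0 < j)%N ->
  principal_angles E F theta ->
  re (\tr ((proj_of F *m proj_of E) ^+ j)) / n%:R = normalized_moment theta j.
Proof. by move=> j0 h; rewrite (mxtrace_QP h j0) re_of_real. Qed.

End loop_defect.

Section convergence_in_mean.
Context (R : realType) (d : nat -> measure_display)
  (T : forall n, measurableType (d n)) (P : forall n, probability (T n) R).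
Implicit Types (Z W : forall n, T n -> R).

Definition cvg_in_mean Z (z : R) :=
  [/\ forall n, measurable_fun setT (Z n), exists B, forall n w, `|Z n w| <= B &
   \int[P n]_w `|Z n w - z| @[n --> \oo] --> (0 : R)].

Lemma bounded_measurable_cvg Z z n : cvg_in_mean Z z ->
  bounded_measurable (Z n).
Proof. by move=> [mZ [B hB] _]; split => //; exists B => w; exact: hB. Qed.

Lemma bounded_measurable_norm d' (Y : measurableType d') (f : Y -> R) :
  bounded_measurable f -> bounded_measurable (fun w => `|f w|).
Proof.
move=> [mf [C hC]]; split; first exact: measurableT_comp.
by exists C => w; rewrite normr_id.
Qed.

Lemma cvg_in_mean_le Z z (e : nat -> R) :
  (forall n, measurable_fun setT (Z n)) -> (exists B, forall n w, `|Z n w| <= B) ->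
  (\forall n \near \oo, \int[P n]_w `|Z n w - z| <= e n) -> e n @[n --> \oo] --> (0 : R) ->
  cvg_in_mean Z z.
Proof.
move=> mZ bZ le e0; split => //.
apply: (squeeze_cvgr _ (cvg_cst 0) e0).
apply: filterS le => n ->; rewrite andbT.
by apply: Rintegral_ge0 => w _.
Qed.

Lemma cvg_in_mean_seq (u : nat -> R) z : (exists B, forall n, `|u n| <= B) ->
  u n @[n --> \oo] --> z -> cvg_in_mean (fun n _ => u n) z.
Proof.
move=> [B hB] uz; apply: (@cvg_in_mean_le _ _ (fun n => `|u n - z|)) => //.
- by exists B.
- by apply: nearW => n; rewrite mean_cst.
- by apply/norm_cvg0P; apply/subr_cvg0.
Qed.

Lemma cvg_in_mean_cst z : cvg_in_mean (fun _ _ => z) z.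
Proof. by apply: cvg_in_mean_seq; [by exists `|z| | exact: cvg_cst]. Qed.

Lemma bounded_measurable_dist Z z n : cvg_in_mean Z z ->
  bounded_measurable (fun w => `|Z n w - z|).
Proof.
move=> hZ; apply: bounded_measurable_norm; apply: bounded_measurableB.
  exact: bounded_measurable_cvg hZ.
exact: bounded_measurable_cst.
Qed.

Lemma cvg_in_meanD Z W z v : cvg_in_mean Z z -> cvg_in_mean W v ->
  cvg_in_mean (fun n w => Z n w + W n w) (z + v).
Proof.
move=> hZ hW; have := hZ; have := hW.
move=> [mW [B' hB'] cW] [mZ [B hB] cZ].
apply: (@cvg_in_mean_le _ _ (fun n => \int[P n]_w `|Z n w - z| + \int[P n]_w `|W n w - v|)).
- by move=> n; exact: measurable_funD.
- by exists (B + B') => n w; rewrite (le_trans (ler_normD _ _))// lerD.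
- apply: nearW => n.
  rewrite -meanD; [|exact: bounded_measurable_dist hZ|exact: bounded_measurable_dist hW].
  apply: le_mean.
  + apply: bounded_measurable_norm; apply: bounded_measurableB;
      last exact: bounded_measurable_cst.
    by apply: bounded_measurableD; [exact: bounded_measurable_cvg hZ|exact: bounded_measurable_cvg hW].
  + apply: bounded_measurableD; [exact: bounded_measurable_dist hZ|exact: bounded_measurable_dist hW].
  + move=> w; rewrite (_ : Z n w + W n w - (z + v) = (Z n w - z) + (W n w - v)); last by ring.
    exact: ler_normD.
- by rewrite -[X in _ --> X]addr0; exact: cvgD.
Qed.

Lemma cvg_in_meanM Z W z v : cvg_in_mean Z z -> cvg_in_mean W v ->
  cvg_in_mean (fun n w => Z n w * W n w) (z * v).
Proof.
move=> hZ hW; have := hZ; have := hW.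
move=> [mW [B' hB'] cW] [mZ [B hB] cZ].
apply: (@cvg_in_mean_le _ _ (fun n => B' * \int[P n]_w `|Z n w - z| + `|z| * \int[P n]_w `|W n w - v|)).
- by move=> n; exact: measurable_funM.
- by exists (B * B') => n w; rewrite normrM ler_pM.
- apply: nearW => n.
  have b1 := bounded_measurable_dist n hZ; have b2 := bounded_measurable_dist n hW.
  have c1 := bounded_measurableM (bounded_measurable_cst (T n) B') b1.
  have c2 := bounded_measurableM (bounded_measurable_cst (T n) `|z|) b2.
  rewrite -!meanZ// -meanD//.
  apply: le_mean.
  + apply: bounded_measurable_norm; apply: bounded_measurableB;
      last exact: bounded_measurable_cst.
    by apply: bounded_measurableM; [exact: bounded_measurable_cvg hZ|exact: bounded_measurable_cvg hW].
  + exact: bounded_measurableD.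
  + move=> w; rewrite (_ : Z n w * W n w - z * v = W n w * (Z n w - z) + z * (W n w - v)); last by ring.
    by rewrite (le_trans (ler_normD _ _))// !normrM lerD2r ler_wpM2r.
- rewrite -[X in _ --> X](_ : B' * 0 + `|z| * 0 = 0); last by rewrite !mulr0 addr0.
  by apply: cvgD; apply: cvgM => //; exact: cvg_cst.
Qed.

Lemma cvg_in_meanB Z W z v : cvg_in_mean Z z -> cvg_in_mean W v ->
  cvg_in_mean (fun n w => Z n w - W n w) (z - v).
Proof.
move=> hZ hW; have := cvg_in_meanD hZ (cvg_in_meanM (cvg_in_mean_cst (-1)) hW).
rewrite mulN1r (_ : (fun n w => _ + _) = fun n w => Z n w - W n w)//.
by apply/functional_extensionality_dep => n; apply/funext => w; rewrite mulN1r.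
Qed.

Lemma cvg_in_mean_sum I (r : seq I) (Z : I -> forall n, T n -> R) (z : I -> R) :
  (forall i, cvg_in_mean (Z i) (z i)) ->
  cvg_in_mean (fun n w => \sum_(i <- r) Z i n w) (\sum_(i <- r) z i).
Proof.
move=> hZ; elim: r => [|i r IH].
  rewrite big_nil (_ : (fun n w => _) = fun _ _ => 0); first exact: cvg_in_mean_cst.
  by apply/functional_extensionality_dep => n; apply/funext => w; rewrite big_nil.
rewrite big_cons (_ : (fun n w => _) = fun n w => Z i n w + \sum_(i <- r) Z i n w).
  exact: cvg_in_meanD.
by apply/functional_extensionality_dep => n; apply/funext => w; rewrite big_cons.
Qed.

(** Since |x| <= (e + x^2 / e) / 2 for every e > 0, the second moment controls the first. *)
Lemma cvg_in_mean_sqr Z z (e : nat -> R) :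
  (forall n, measurable_fun setT (Z n)) -> (exists B, forall n w, `|Z n w| <= B) ->
  (\forall n \near \oo, \int[P n]_w (Z n w - z) ^+ 2 <= e n) -> e n @[n --> \oo] --> (0 : R) ->
  cvg_in_mean Z z.
Proof.
move=> mZ bZ le e0; split => //.
have bd n : bounded_measurable (fun w => Z n w - z).
  apply: bounded_measurableB; last exact: bounded_measurable_cst.
  by split => //; have [B hB] := bZ; exists B => w; exact: hB.
apply/cvgrPdist_le => eps eps0.
have e0' : \forall n \near \oo, `|0 - e n| <= eps ^+ 2.
  by move/cvgrPdist_le : e0; apply; rewrite exprn_gt0.
near=> n.
rewrite sub0r normrN ger0_norm; last by apply: Rintegral_ge0 => w _.
have h1 : \int[P n]_w (Z n w - z) ^+ 2 <= e n by near: n.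
have h2 : `|0 - e n| <= eps ^+ 2 by near: n.
have {}h2 : e n <= eps ^+ 2 by rewrite (le_trans (ler_norm _))// -normrN -sub0r.
have bq : bounded_measurable (fun w => eps / 2 + (2 * eps)^-1 * (Z n w - z) ^+ 2).
  apply: bounded_measurableD; first exact: bounded_measurable_cst.
  apply: bounded_measurableM; first exact: bounded_measurable_cst.
  by under eq_fun do rewrite expr2; exact: bounded_measurableM.
apply: (@le_trans _ _ (\int[P n]_w (eps / 2 + (2 * eps)^-1 * (Z n w - z) ^+ 2))).
  apply: le_mean => //; first exact: bounded_measurable_norm.
  move=> w; rewrite -[(Z n w - z) ^+ 2]real_normK ?num_real//; set x := `|_|.
  rewrite -subr_ge0 (_ : _ - _ = (x - eps) ^+ 2 / (2 * eps)); last by field; rewrite gt_eqF.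
  by rewrite divr_ge0 ?sqr_ge0// mulr_ge0// ltW.
have bs : bounded_measurable (fun w => (Z n w - z) ^+ 2).
  by under eq_fun do rewrite expr2; exact: bounded_measurableM.
rewrite meanD ?mean_cst ?meanZ//; last 2 first.
- exact: bounded_measurable_cst.
- by apply: bounded_measurableM => //; exact: bounded_measurable_cst.
rewrite [leRHS](_ : _ = eps / 2 + (2 * eps)^-1 * eps ^+ 2); last by field; rewrite gt_eqF.
rewrite lerD2l ler_wpM2l ?invr_ge0 ?mulr_ge0 ?(ltW eps0)//.
exact: le_trans h2.
Unshelve. all: by end_near. Qed.

End convergence_in_mean.

Section moment_convergence.
Context (R : realType) (s : scalar_kind) (alpha beta : R).
Context (k l : forall n : nat, 'I_n.+1)
    (hk : ((k n : nat)%:R / n%:R : R) @[n --> \oo] --> alpha)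
    (hl : ((l n : nat)%:R / n%:R : R) @[n --> \oo] --> beta)
    (d : nat -> measure_display) (T : forall n, measurableType (d n))
    (P : forall n, probability (T n) R)
    (E : forall n, {mfun T n >-> grassmannian R s (k n)})
    (F : forall n, {mfun T n >-> grassmannian R s (l n)})
    (hE : forall n, is_haar_measure (distribution (P n) (E n)))
    (hEF : forall n, independent_variables (P n) (E n) (F n))
    (theta : forall n, T n -> (minn (k n) (l n)).-tuple R)
    (htheta : forall n w, principal_angles (E n w) (F n w) (theta n w)).

(** The angles themselves are arbitrary functions of w. Their symmetric functions are
   measurable because they are traces. *)
Lemma measurable_normalized_moment n j : (0 < j)%N ->
  measurable_fun setT (fun w => normalized_moment (@theta n w) j).
Proof.
move=> j0; rewrite (_ : (fun w => _) = fun w =>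
    re (\tr ((proj_of (F n w) *m proj_of (E n w)) ^+ j)) / n%:R).
  apply: measurable_funM => //; apply: measurable_re_tr; apply: measurable_word.
    exact: measurable_pE.
  exact: measurable_pF.
by apply/funext => w; rewrite (re_mxtrace_angles j0 (@htheta n w)).
Qed.

Lemma frac_bounded (j : forall n : nat, 'I_n.+1) :
  exists B : R, forall n, `|(j n : nat)%:R / n%:R : R| <= B.
Proof.
exists 1 => n; rewrite ger0_norm ?divr_ge0//.
have [->|n0] := posnP n; first by rewrite invr0 mulr0.
by rewrite ler_pdivrMr ?ltr0n// mul1r ler_nat -ltnS.
Qed.

Local Notation mom j := (fun n w => normalized_moment (@theta n w) j).

(** By induction on m: in the loop equation, the moment of order m occurs once,
   and the other terms are products of moments of lower order. *)
Lemma cvg_in_mean_moment (c : nat -> R) :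
  (forall m, loop_defect alpha beta c m.+1 = 0) ->
  forall m, cvg_in_mean P (mom m.+1) (c m.+1).
Proof.
move=> hc m; elim/ltn_ind: m => m IH.
have bmom n : bounded_measurable (fun w => normalized_moment (@theta n w) m.+1).
  split; first exact: measurable_normalized_moment.
  exists 1 => w; have /andP[h0 h1] := normalized_moment_bounds (@theta n w) m.+1.
  by rewrite ger0_norm.
have cvg_if (u : nat -> R) x j : (j <= m)%N -> (exists B, forall n, `|u n| <= B) ->
    u n @[n --> \oo] --> x ->
    cvg_in_mean P (fun n w => if j is 0 then u n else normalized_moment (@theta n w) j)
      (if j is 0 then x else c j).
  case: j => [_ bu ux|j jm _ _]; first exact: cvg_in_mean_seq.
  exact: IH.
(* The terms other than the one that contains the moment of order m + 1. *)
pose rest (a b : R) (v : nat -> R) := \sum_(i < m)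
  (v i.+1 * (if (m - i)%N is 0 then 1 else v (m - i)%N)) -
  \sum_(i < m.+1) (if i : nat is 0 then b else v i) *
    (if (m - i)%N is 0 then a else v (m - i)%N).
have defectE a b v : loop_defect a b v m.+1 = v m.+1 + rest a b v.
  rewrite /loop_defect sumrB big_ord_recr /= subnn mulr1 /rest.
  under eq_bigr do rewrite subSS.
  under [X in _ - X = _]eq_bigr do rewrite subSS.
  by rewrite [_ + v m.+1]addrC addrA.
have cvg_rest : cvg_in_mean P (fun n w => rest ((k n)%:R / n%:R) ((l n)%:R / n%:R)
    (normalized_moment (@theta n w))) (rest alpha beta c).
  have one_cvg : (fun=> 1 : R) n @[n --> \oo] --> (1 : R) by exact: cvg_cst.
  apply: cvg_in_meanB; apply: cvg_in_mean_sum => -[i /= im].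
    apply: cvg_in_meanM; first exact: IH.
    by apply: (@cvg_if (fun=> 1)); rewrite ?leq_subr//; exists 1 => n; rewrite normr1.
  apply: cvg_in_meanM.
    by apply: (@cvg_if (fun n => (l n)%:R / n%:R)) => //; exact: frac_bounded.
  by apply: (@cvg_if (fun n => (k n)%:R / n%:R)); rewrite ?leq_subr//; exact: frac_bounded.
have := cvg_rest => -[mrest [B hB] rest0].
(* The value that the limit recursion forces on the moment of order m + 1. *)
set kappa := c m.+1.
have kE : kappa = - rest alpha beta c.
  by apply/eqP; rewrite -addr_eq0 -defectE hc.
pose e n : R := (7 * m.+1%:R * (1 + `|kappa|)) / n%:R +
  (1 + `|kappa|) * \int[P n]_w `|rest ((k n)%:R / n%:R) ((l n)%:R / n%:R)
    (normalized_moment (@theta n w)) - rest alpha beta c|.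
apply: (@cvg_in_mean_sqr _ _ _ _ _ _ e).
- by move=> n; case: (bmom n).
- exists 1 => n w; have /andP[h0 h1] := normalized_moment_bounds (@theta n w) m.+1.
  by rewrite ger0_norm.
- near=> n; have n0 : (0 < n)%N by near: n; exact: nbhs_infty_gt.
  have nR : 0 < n%:R :> R by rewrite ltr0n.
  pose an : R := (k n)%:R / n%:R; pose bn : R := (l n)%:R / n%:R.
  pose Y w := normalized_moment (@theta n w) m.+1 - kappa.
  pose X w := loop_defect an bn (normalized_moment (@theta n w)) m.+1.
  pose D w := rest an bn (normalized_moment (@theta n w)) - rest alpha beta c.
  have bY : bounded_measurable Y.
    by apply: bounded_measurableB => //; exact: bounded_measurable_cst.
  have bD : bounded_measurable D.
    by apply: bounded_measurableB; [exact: (bounded_measurable_cvg n cvg_rest)|exact: bounded_measurable_cst].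
  have XE w : X w = Y w + D w.
    by rewrite /X /Y /D defectE kE; ring.
  have bX : bounded_measurable X.
    by rewrite (_ : X = fun w => Y w + D w); [exact: bounded_measurableD|exact/funext].
  have Yle w : `|Y w| <= 1 + `|kappa|.
    rewrite (le_trans (ler_normB _ _))// lerD2r ger0_norm.
      by case/andP: (normalized_moment_bounds (@theta n w) m.+1).
    by case/andP: (normalized_moment_bounds (@theta n w) m.+1).
  have loopE w : re (loop_sum m.+1 (proj_of (E n w)) (proj_of (F n w))) = n%:R ^+ 2 * X w.
    by rewrite (re_loop_sum_angles _ n0 (@htheta n w)).
  have b2X : bounded_measurable (fun w => n%:R ^+ 2 * X w).
    by apply: bounded_measurableM => //; exact: bounded_measurable_cst.
  have hXY : `|\int[P n]_w (X w * Y w)| <= 7 * m.+1%:R * (1 + `|kappa|) / n%:R.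
    have := @mean_loop_sum R s n m.+1 kappa (k n) (l n) _ (T n) (P n) (E n) (F n)
      (@hE n) (@hEF n) n0.
    under eq_fun do rewrite loopE.
    move=> /(_ b2X).
    under eq_Rintegral do rewrite loopE (re_mxtrace_angles _ (@htheta n _))// -mulrA.
    rewrite meanZ; last exact: bounded_measurableM.
    rewrite normrM ger0_norm ?sqr_ge0// ler_pdivlMr// => h.
    rewrite -(ler_pM2r nR); apply: le_trans h.
    by rewrite /Y expr2; set z := `|_|; rewrite le_eqVlt; apply/orP; left; apply/eqP; ring.
  have bYY := bounded_measurableM bY bY; have bXY := bounded_measurableM bX bY.
  have bDY := bounded_measurableM bD bY.
  have -> : \int[P n]_w (normalized_moment (@theta n w) m.+1 - kappa) ^+ 2 =
      \int[P n]_w (X w * Y w) - \int[P n]_w (D w * Y w).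
    rewrite -meanB//; apply: eq_Rintegral => w _.
    by rewrite XE -/(Y w); ring.
  rewrite /e; apply: lerD; first exact: le_trans (ler_norm _) hXY.
  rewrite (le_trans (ler_norm _))// normrN.
  have bnD := bounded_measurable_norm bD.
  rewrite -meanZ//.
  apply: le_trans (le_normr_Rintegral _ _) _ => //.
    exact: bounded_measurable_integrable.
  apply: le_mean.
  + exact: bounded_measurable_norm.
  + by apply: bounded_measurableM => //; exact: bounded_measurable_cst.
  + by move=> w; rewrite normrM mulrC ler_wpM2r.
- rewrite /e -[X in _ --> X](_ : (7 * m.+1%:R * (1 + `|kappa|)) * 0 + (1 + `|kappa|) * 0 = 0); last by rewrite !mulr0 addr0.
  apply: cvgD; apply: cvgM; try exact: cvg_cst; last exact: rest0.
  by rewrite -cvg_shiftS; exact: cvg_harmonic.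
Unshelve. all: by end_near. Qed.

End moment_convergence.

(** * From the semicircle recursion to the loop equation *)

Section power_series.
Context (R : realFieldType).
Implicit Types (p q : {poly R}).

(** Generating functions are truncated to polynomials, and identities between them hold
   modulo X^N. *)
Definition vanishes N p := forall i, (i < N)%N -> p`_i = 0.

Lemma vanishesD N p q : vanishes N p -> vanishes N q -> vanishes N (p + q).
Proof. by move=> hp hq i iN; rewrite coefD hp ?hq ?addr0. Qed.

Lemma vanishesM N p q : vanishes N p -> vanishes N (p * q).
Proof.
move=> hp i iN; rewrite coefM big1// => -[j /= ji] _.
by rewrite hp ?mul0r// (leq_ltn_trans _ iN).
Qed.

Lemma vanishes_cancel N p : vanishes N ((1 - 'X) * p) -> vanishes N p.
Proof.
move=> hp; elim=> [|i IH] iN; have := hp _ iN; rewrite mulrBl mul1r coefB coefXM /=.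
  by rewrite subr0.
by rewrite IH ?subr0// ltnW.
Qed.

End power_series.

Section recursions.
Context (R : realType).

(** With C = c_1 X + c_2 X^2 + ... and D = d_0 + d_1 X + ..., the hypotheses say
   that (1 - X) C = X (a b - X D) and that v + (u X - 1) D + X^2 D^2 = 0, and the
   conclusion that C (1 + C) = X (a + C) (b + C). *)
Lemma loop_defect_eq0 (a b : R) (c d : nat -> R) :
  let u := a + b - 2 * a * b in
  c 1%N = a * b -> (forall j, d j = c j.+1 - c j.+2) ->
  d 0%N = a * b * (1 - a) * (1 - b) ->
  (forall j, d j.+1 = u * d j + \sum_(i < j) d i * d (j - i.+1)%N) ->
  forall m, loop_defect a b c m.+1 = 0.
Proof.
move=> u c1 dc d0 dS m.
pose N := m.+2.
pose C : {poly R} := \poly_(i < N) (if i is 0 then 0 else c i).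
pose D : {poly R} := \poly_(i < N) d i.
have CE i : (i < N)%N -> C`_i = if i is 0 then 0 else c i.
  by move=> iN; rewrite coef_poly iN.
have DE i : (i < N)%N -> D`_i = d i by move=> iN; rewrite coef_poly iN.
pose S := (a * b * (1 - a) * (1 - b))%:P + (u *: (D * 'X) - D) + 'X^2 * (D * D).
have S0 : vanishes N S.
  move=> i iN; rewrite /S coefD coefD coefB coefC coefZ coefMX coefXnM.
  case: i iN => [|[|i]] iN /=; rewrite !DE//; last exact: ltnW.
  - by rewrite d0; ring.
  - by rewrite dS big_ord0 d0; ring.
  rewrite subn2 /= coefM (dS i.+1).
  have -> : \sum_(j < i.+1) D`_j * D`_(i - j) =
      \sum_(j < i.+1) d j * d (i.+1 - j.+1)%N.
    by apply: eq_bigr => -[j /= ji] _; rewrite !DE// ?subSS//; move: iN; rewrite /N; lia.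
  by ring.
pose W := C * (1 - 'X) - 'X * ((a * b)%:P - 'X * D).
have W0 : vanishes N W.
  move=> i iN; rewrite /W mulrBr mulr1 mulrBr mulrA -expr2 !coefB coefMX coefXM coefXnM coefC.
  case: i iN => [|[|i]] iN /=; rewrite ?CE ?DE//; try exact: ltnW.
  - by rewrite !subr0.
  - by rewrite c1; ring.
  - by rewrite subn2 /= dc; ring.
  - by rewrite subn2 /= ltnW// ltnW.
pose G := C * (1 + C) - 'X * ((b%:P + C) * (a%:P + C)).
have G0 : vanishes N G.
  apply: vanishes_cancel.
  have -> : (1 - 'X) * G = W * (1 - 'X + W + 2 * ('X * ((a * b)%:P - 'X * D)) -
      (a + b - 1)%:P * 'X) + S * 'X^2.
    have -> : S = (a * b * (1 - a) * (1 - b))%:P + (u%:P * (D * 'X) - D) + 'X^2 * (D * D).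
      by rewrite mul_polyC.
    have -> : u = a + b - (a * b + a * b) by rewrite /u; ring.
    rewrite /W /G !(rmorphM, rmorphB, rmorphD, rmorph1) /=.
    by ring.
  exact: vanishesD (vanishesM _ W0) (vanishesM _ S0).
have := G0 m.+1 (ltnSn _); rewrite /G coefB coefXM /= !coefM big_ord_recl CE//= mul0r add0r.
move=> <-; rewrite /loop_defect sumrB; congr (_ - _); apply: eq_bigr => -[i /= im] _.
  rewrite /bump /= add1n coefD coef1 subSS !CE ?ltnS ?(leq_trans (leq_subr _ _))//.
  by case: (m - i)%N => [|j]; rewrite ?addr0 ?add0r.
rewrite !coefD !coefC subSS !CE ?ltnS ?(leq_trans (leq_subr _ _))//; last by rewrite ltnW.
by case: (m - i)%N => [|j]; case: (i) => [|h] /=; rewrite ?addr0 ?add0r.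
Qed.

(** Decomposing a path at its first return to level 0: A i k counts weighted paths of
   i steps from level 0 to level k that stay nonnegative. *)
Lemma first_return (u r : R) (A : nat -> nat -> R) :
  A 0%N 0%N = 1 -> (forall k, A 0%N k.+1 = 0) ->
  (forall i, A i.+1 0%N = u * A i 0%N + r * A i 1%N) ->
  (forall i k, A i.+1 k.+1 = u * A i k.+1 + r * A i k.+2 + r * A i k) ->
  forall i k, A i k.+1 = r * \sum_(p < i) A p k * A (i - p.+1)%N 0%N.
Proof.
move=> A00 A0 AS0 AS i; elim: i => [|i IH] k; first by rewrite big_ord0 mulr0 A0.
rewrite big_ord_recl subn1 /= AS !IH.
have -> : \sum_(p < i) A (bump 0 p) k * A (i.+1 - (bump 0 p).+1)%N 0%N =
    \sum_(p < i) A p.+1 k * A (i - p.+1)%N 0%N.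
  by apply: eq_bigr => p _; rewrite /bump /= add1n subSS.
case: k => [|k].
  under [in RHS]eq_bigr do rewrite AS0 mulrDl -!mulrA.
  by rewrite A00 big_split /= -!mulr_sumr; ring.
under [in RHS]eq_bigr do rewrite AS !mulrDl -!mulrA.
by rewrite A0 !big_split /= -!mulr_sumr IH; ring.
Qed.

End recursions.

(** * Integrals over an angle *)

Section calculus.
Context (R : realType).
Local Notation mu := (@lebesgue_measure R).
Implicit Types (f g F G : R -> R) (a b : R).

Lemma is_derive_continuous F f : (forall x : R, is_derive x 1 F (f x)) -> continuous F.
Proof.
by move=> dF x; apply: differentiable_continuous; apply/derivable1_diffP; exact: ex_derive.
Qed.

Lemma is_derive_LRcontinuous F f a b : (forall x : R, is_derive x 1 F (f x)) ->
  derivable_oo_LRcontinuous F a b.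
Proof.
move=> dF; have cF := is_derive_continuous dF.
split; [by move=> x _; exact: ex_derive| |].
  by apply: cvg_at_right_filter; exact: cF.
by apply: cvg_at_left_filter; exact: cF.
Qed.

Lemma within_continuous (A : set R) f : continuous f -> {within A, continuous f}.
Proof. exact: continuous_subspaceT. Qed.

Lemma integrable_segment a b f : {within `[a, b], continuous f} ->
  mu.-integrable `[a, b] (EFin \o f).
Proof. by move=> cf; apply: continuous_compact_integrable => //; exact: segment_compact. Qed.

Lemma Rintegral_derive F f a b : a < b -> continuous f ->
  (forall x : R, is_derive x 1 F (f x)) -> \int[mu]_(x in `[a, b]) f x = F b - F a.
Proof.
move=> ab cf dF; rewrite /Rintegral (continuous_FTC2 ab (F := F))//.
- exact: within_continuous.
- exact: is_derive_LRcontinuous dF.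
- by move=> x _; rewrite derive1E derive_val.
Qed.

Lemma Rintegral_substitution_decreasing F f G a b : a <= b ->
  {in `[a, b] &, {homo F : x y /~ x < y}} -> continuous f ->
  (forall x : R, is_derive x 1 F (f x)) -> {within `[F b, F a], continuous G} ->
  \int[mu]_(x in `[F b, F a]) G x = \int[mu]_(x in `[a, b]) (G (F x) * - f x).
Proof.
move=> ab decF cf dF cG; have F'E : derive1 F = f.
  by apply/funext => x; rewrite derive1E derive_val.
have cF' : continuous (derive1 F) by rewrite F'E.
have ca : cvg (derive1 F x @[x --> a^'+]).
  by apply/cvg_ex; exists (derive1 F a); apply: cvg_at_right_filter; exact: cF'.
have cb : cvg (derive1 F x @[x --> b^'-]).
  by apply/cvg_ex; exists (derive1 F b); apply: cvg_at_left_filter; exact: cF'.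
have cab : {in `]a, b[, continuous (derive1 F)} by move=> x _; exact: cF'.
congr fine; rewrite (integration_by_substitution_decreasing ab decF cab ca cb
  (is_derive_LRcontinuous a b dF) cG).
by apply: eq_integral => x _ /=; rewrite F'E.
Qed.

Lemma Rintegral_segmentD a b f g : continuous f -> continuous g ->
  \int[mu]_(x in `[a, b]) (f x + g x) =
  \int[mu]_(x in `[a, b]) f x + \int[mu]_(x in `[a, b]) g x.
Proof.
by move=> cf cg; rewrite RintegralD//; apply: integrable_segment; exact: within_continuous.
Qed.

Lemma Rintegral_segmentZ a b c f : continuous f ->
  \int[mu]_(x in `[a, b]) (c * f x) = c * \int[mu]_(x in `[a, b]) f x.
Proof.
by move=> cf; rewrite RintegralZl//; apply: integrable_segment; exact: within_continuous.
Qed.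

Local Notation J f := (\int[mu]_(x in `[0, pi]) f x).

Lemma continuous_cosM c : continuous (fun x : R => cos (c * x)).
Proof.
move=> x; apply: continuous_comp; last exact: continuous_cos.
by apply: cvgM; [exact: cvg_cst|exact: cvg_id].
Qed.

Lemma continuous_sinM c : continuous (fun x : R => sin (c * x)).
Proof.
move=> x; apply: continuous_comp; last exact: continuous_sin.
by apply: cvgM; [exact: cvg_cst|exact: cvg_id].
Qed.

Lemma sin_natpi j : sin (j%:R * pi) = 0 :> R.
Proof.
elim: j => [|j IH]; first by rewrite mul0r sin0.
by rewrite -addn1 natrD mulrDl mul1r sinD IH sinpi mul0r mulr0 addr0.
Qed.

Lemma integral_cos_nat j : J (fun x => cos (j.+1%:R * x)) = 0.
Proof.
pose F (x : R) := j.+1%:R^-1 * sin (j.+1%:R * x).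
have dF (x : R) : is_derive x 1 F (cos (j.+1%:R * x)).
  have d1 : is_derive x 1 (fun y : R => j.+1%:R * y) j.+1%:R.
    by apply: is_derive_eq; rewrite /GRing.scale /= mulr1.
  have d2 := is_derive1_comp (is_derive_sin (j.+1%:R * x)) d1.
  have -> : F = (fun y => j.+1%:R^-1 * (sin \o (fun y : R => j.+1%:R * y)) y) by [].
  apply: is_derive_eq.
  by rewrite /GRing.scale /= mulrCA mulVf ?mulr1// pnatr_eq0.
have cc : continuous (fun x : R => cos (j.+1%:R * x)) by exact: continuous_cosM.
rewrite (Rintegral_derive (pi_gt0 R) cc dF).
by rewrite /F sin_natpi mulr0 mulr0 sin0 mulr0 subr0.
Qed.

Lemma integral_sin_sin k :
  J (fun x => sin x * sin (k.+1%:R * x)) = if k is 0 then pi / 2 else 0.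
Proof.
have e x : sin x * sin (k.+1%:R * x) = 2^-1 * (cos (k%:R * x) + (-1) * cos (k.+2%:R * x)).
  have -> : k.+2%:R * x = k.+1%:R * x + x by rewrite -[k.+2]addn1 natrD mulrDl mul1r.
  have -> : k%:R * x = k.+1%:R * x - x by rewrite -[k.+1]addn1 natrD mulrDl mul1r addrK.
  by rewrite cosB cosD; field.
under eq_Rintegral do rewrite e.
have c1 : continuous (fun x : R => cos (k%:R * x)) by exact: continuous_cosM.
have c2 : continuous (fun x : R => cos (k.+2%:R * x)) by exact: continuous_cosM.
have c3 : continuous (fun x : R => -1 * cos (k.+2%:R * x)).
  by move=> x; apply: cvgM; [exact: cvg_cst|exact: c2].
rewrite Rintegral_segmentZ; last by move=> x; apply: cvgD; [exact: c1|exact: c3].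
rewrite Rintegral_segmentD// Rintegral_segmentZ// integral_cos_nat mulr0 addr0.
case: k {e c1 c2 c3} => [|k]; last by rewrite integral_cos_nat mulr0.
under eq_Rintegral do rewrite mul0r cos0.
rewrite Rintegral_cst//= lebesgue_measure_itv/= lte_fin pi_gt0 /= subr0.
by field.
Qed.

(** The antiderivative is continuous on the whole line, unlike the one obtained from the
   half-angle substitution; w = sqrt (A^2 - 1). *)
Lemma integral_inv_cos (A e : R) : 1 < A -> e ^+ 2 = 1 ->
  J (fun x => (A + e * cos x)^-1) = pi / Num.sqrt (A ^+ 2 - 1).
Proof.
move=> A1 e2; set w := Num.sqrt _.
have A21 : 0 < A ^+ 2 - 1 by nra.
have w0 : 0 < w by rewrite sqrtr_gt0.
have w2 : w ^+ 2 = A ^+ 2 - 1 by rewrite sqr_sqrtr// ltW.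
have ec x : `|e * cos x| <= 1.
  have -> : `|e * cos x| = `|cos x|.
    rewrite normrM (_ : `|e| = 1) ?mul1r//.
    by apply/eqP; rewrite -sqrp_eq1// real_normK ?num_real// e2.
  by rewrite ler_norml cos_geN1 cos_le1.
have d0 x : 0 < A + e * cos x by have := ec x; rewrite ler_norml; lra.
have n0 x : 0 < A + w + e * cos x by have := d0 x; lra.
pose F (x : R) := x / w - 2 / w * atan (e * sin x / (A + w + e * cos x)).
have dF (x : R) : is_derive x 1 F (A + e * cos x)^-1.
  rewrite /F; have nx := n0 x; have dx := d0 x.
  have nx' : A + w + e * cos x != 0 by rewrite gt_eqF.
  have i1 : is_derive x 1 (fun x => (A + w + e * cos x)^-1)
      (- (A + w + e * cos x) ^- 2 *: (e * - sin x)).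
    apply: (@is_deriveV _ (fun x => A + w + e * cos x)) => //.
    by apply: is_derive_eq; rewrite /GRing.scale /=; ring.
  have i2 : is_derive x 1 (fun x => e * sin x / (A + w + e * cos x))
     (((A + w) * (e * cos x) + 1) / (A + w + e * cos x) ^+ 2).
    apply: is_derive_eq; rewrite /GRing.scale /=.
    have s2 : sin x ^+ 2 = 1 - cos x ^+ 2 := sin2cos2 x.
    rewrite (_ : 1 = e ^+ 2 * (sin x ^+ 2 + cos x ^+ 2)) ?cos2Dsin2; last first.
      by rewrite addrC cos2Dsin2 mulr1 e2.
    by field.
  have i3 := @is_derive1_comp R atan (fun x => e * sin x / (A + w + e * cos x)) x _ _ (is_derive1_atan _) i2.
  have -> : (fun x => x / w - 2 / w * atan (e * sin x / (A + w + e * cos x))) =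
      (fun x => w^-1 * x - 2 / w * (atan \o (fun x => e * sin x / (A + w + e * cos x))) x).
    by apply/funext => y /=; rewrite mulrC.
  apply: is_derive_eq; rewrite /GRing.scale /=.
  have -> : 1 + (e * sin x / (A + w + e * cos x)) ^+ 2 =
      2 * (A + w) * (A + e * cos x) / (A + w + e * cos x) ^+ 2.
    have s2 : (e * sin x) ^+ 2 = 1 - (e * cos x) ^+ 2.
      by rewrite !exprMn e2 sin2cos2 !mul1r.
    rewrite expr_div_n s2.
    have -> : 2 * (A + w) * (A + e * cos x) = (A + w + e * cos x) ^+ 2 + (1 - (e * cos x) ^+ 2) .
      have -> : 2 * (A + w) * (A + e * cos x) = (A + w + e * cos x) ^+ 2 + (1 - (e * cos x) ^+ 2) + (A ^+ 2 - 1 - w ^+ 2) by ring.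
      by rewrite w2 subrr addr0.
    by field.
  have Aw : A + w != 0 by rewrite gt_eqF//; lra.
  have dx' : A + e * cos x != 0 by rewrite gt_eqF.
  have w0' : w != 0 by rewrite gt_eqF.
  have h : (A + w) * (A - w) = 1 by rewrite mulrC -subr_sqr w2; ring.
  have -> : ((A + w) * (e * cos x) + 1) = (A + w) * (e * cos x + (A - w)).
    by rewrite mulrDr h.
  by field; rewrite dx' nx' Aw w0'.
have cf : continuous (fun x : R => (A + e * cos x)^-1).
  move=> x; apply: cvgV; first by rewrite gt_eqF.
  apply: cvgD; first exact: cvg_cst.
  by apply: cvgM; [exact: cvg_cst|exact: continuous_cos].
rewrite (Rintegral_derive (pi_gt0 R) cf dF).
by rewrite /F sinpi sin0 mulr0 !mul0r atan0 mulr0 !subr0.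
Qed.

(** With c = e cos x and w^2 = A^2 - 1, one has
   (1 - c^2) / (A + c) = A - c - w^2 / (A + c). *)
Lemma integral_sin2_cos (A e : R) : 1 < A -> e ^+ 2 = 1 ->
  J (fun x => sin x ^+ 2 / (A + e * cos x)) = pi * (A - Num.sqrt (A ^+ 2 - 1)).
Proof.
move=> A1 e2; set w := Num.sqrt _.
have A21 : 0 < A ^+ 2 - 1 by nra.
have w0 : 0 < w by rewrite sqrtr_gt0.
have w2 : w ^+ 2 = A ^+ 2 - 1 by rewrite sqr_sqrtr// ltW.
have d0 x : A + e * cos x != 0.
  have : `|e * cos x| <= 1.
    rewrite normrM (_ : `|e| = 1) ?mul1r ?ler_norml ?cos_geN1 ?cos_le1//.
    by apply/eqP; rewrite -sqrp_eq1// real_normK ?num_real// e2.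
  by rewrite ler_norml => ?; rewrite gt_eqF//; lra.
have ce x : sin x ^+ 2 / (A + e * cos x) = A + ((- e) * cos x + (- w ^+ 2) * (A + e * cos x)^-1).
  have s2 : sin x ^+ 2 = 1 - (e * cos x) ^+ 2 by rewrite exprMn e2 mul1r sin2cos2.
  by rewrite s2 w2; field.
under eq_Rintegral do rewrite ce.
have ci : continuous (fun x : R => (A + e * cos x)^-1).
  move=> x; apply: cvgV => //; apply: cvgD; first exact: cvg_cst.
  by apply: cvgM; [exact: cvg_cst|exact: continuous_cos].
have cM c (f : R -> R) : continuous f -> continuous (fun x => c * f x).
  by move=> cf x; apply: cvgM; [exact: cvg_cst|exact: cf].
have c1 := cM (- e) _ (@continuous_cos R); have c2 := cM (- w ^+ 2) _ ci.
rewrite Rintegral_segmentD; [|exact: cst_continuous|by move=> x; apply: cvgD; [exact: c1|exact: c2]].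
rewrite Rintegral_segmentD// Rintegral_segmentZ//; last exact: continuous_cos.
rewrite Rintegral_segmentZ// integral_inv_cos// -/w.
have -> : J (fun x => cos x) = 0.
  by rewrite -[RHS](integral_cos_nat 0); apply: eq_Rintegral => x _; rewrite mul1r.
rewrite Rintegral_cst//= lebesgue_measure_itv/= lte_fin pi_gt0 /= subr0.
by field; rewrite gt_eqF.
Qed.

(** The moments of x = u + 2 r cos t against (2 / pi) sin^2 t dt follow the recursion of
   the semicircle law. More generally sin t sin (k + 1) t is tracked: multiplication by x
   moves k by at most one step. *)
Definition angular_moment (u r : R) i k : R :=
  2 / pi * J (fun t => (u + 2 * r * cos t) ^+ i * (sin t * sin (k.+1%:R * t))).

Lemma continuous_angular (u r : R) i k :
  continuous (fun t : R => (u + 2 * r * cos t) ^+ i * (sin t * sin (k.+1%:R * t))).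
Proof.
move=> t; apply: cvgM; last first.
  by apply: cvgM; [exact: continuous_sin|exact: continuous_sinM].
apply: (@continuous_comp _ _ _ (fun t => u + 2 * r * cos t) (fun x => x ^+ i)).
  by apply: cvgD; [exact: cvg_cst|apply: cvgM; [exact: cvg_cst|exact: continuous_cos]].
exact: exprn_continuous.
Qed.

Lemma angular_moment0 u r k : angular_moment u r 0 k = (k == 0%N)%:R.
Proof.
rewrite /angular_moment; under eq_Rintegral do rewrite expr0 mul1r.
rewrite integral_sin_sin; case: k => [|k]; last by rewrite mulr0.
by rewrite eqxx mulf_div [pi * 2]mulrC divff// mulf_neq0// gt_eqF// pi_gt0.
Qed.

Lemma angular_momentS u r i k : angular_moment u r i.+1 k =
  u * angular_moment u r i k + r * angular_moment u r i k.+1 +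
  (if k is k'.+1 then r * angular_moment u r i k' else 0).
Proof.
pose f k t := (u + 2 * r * cos t) ^+ i * (sin t * sin (k%:R * t)) : R.
have cf j : continuous (f j.+1) by exact: continuous_angular.
have c0 : continuous (f 0%N).
  by rewrite (_ : f 0%N = fun=> 0); [exact: cst_continuous|apply/funext => t; rewrite /f mul0r sin0 !mulr0].
have cM c j : continuous (fun t => c * f j t).
  by move=> t; apply: cvgM; [exact: cvg_cst|case: (j) => [|j']; [exact: c0|exact: cf]].
have e t : (u + 2 * r * cos t) ^+ i.+1 * (sin t * sin (k.+1%:R * t)) =
    u * f k.+1 t + (r * f k.+2 t + r * f k t).
  have -> : f k.+2 t = (u + 2 * r * cos t) ^+ i * (sin t *
      (sin (k.+1%:R * t) * cos t + cos (k.+1%:R * t) * sin t)).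
    rewrite /f (_ : k.+2%:R * t = k.+1%:R * t + t) ?sinD//.
    by rewrite -[k.+2]addn1 natrD mulrDl mul1r.
  have -> : f k t = (u + 2 * r * cos t) ^+ i * (sin t *
      (sin (k.+1%:R * t) * cos t - cos (k.+1%:R * t) * sin t)).
    rewrite /f (_ : k%:R * t = k.+1%:R * t - t) ?sinB//.
    by rewrite -[k.+1]addn1 natrD mulrDl mul1r addrK.
  by rewrite /f exprS; ring.
rewrite /angular_moment; under eq_Rintegral do rewrite e.
rewrite Rintegral_segmentD; [|exact: cM|by move=> t; apply: cvgD; exact: cM].
rewrite Rintegral_segmentD; [|exact: cM|exact: cM].
rewrite Rintegral_segmentZ; [|exact: cf].
rewrite Rintegral_segmentZ; [|exact: cf].
rewrite Rintegral_segmentZ; last by case: (k) => [|j]; [exact: c0|exact: cf].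
have -> : J (f k) = if k is k'.+1 then J (f k'.+1) else 0.
  case: (k) => [|j]//; rewrite (_ : f 0%N = fun=> 0); first by rewrite Rintegral_cst// mul0r.
  by apply/funext => t; rewrite /f mul0r sin0 !mulr0.
by case: (k) => [|j]; rewrite /f; ring.
Qed.

(** By [first_return] at level 0. *)
Lemma semicircle_recursion u r j : angular_moment u r j.+1 0 =
  u * angular_moment u r j 0 + r ^+ 2 *
    \sum_(i < j) angular_moment u r i 0 * angular_moment u r (j - i.+1)%N 0.
Proof.
rewrite angular_momentS addr0; congr (_ + _).
rewrite (@first_return _ u r (angular_moment u r)) 1?mulrA//.
- by rewrite angular_moment0.
- by move=> k; rewrite angular_moment0.
- by move=> i; rewrite angular_momentS addr0.
- by move=> i k; rewrite angular_momentS.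
Qed.

End calculus.

(** * Moments of the limit measure *)

Section bounded_convergence.
Context (R : realType).
Local Notation mu := (@lebesgue_measure R).

Lemma integrable_bounded_segment (a b : R) (f : R -> R) C :
  measurable_fun `[a, b] f -> (forall x, `[a, b]%classic x -> `|f x| <= C) ->
  mu.-integrable `[a, b] (EFin \o f).
Proof.
move=> mf fC.
have fin : (mu (`[a, b]%classic : set R) < +oo)%E.
  by rewrite lebesgue_measure_itv /=; case: ifP => _; rewrite ?ltry// -EFinB ltry.
apply: measurable_bounded_integrable => //.
exists C; split; first exact: num_real.
by move=> M CM x abx; rewrite /= (le_trans (fC x abx))// ltW.
Qed.

Lemma bounded_convergence (a b C : R) (f_ : nat -> R -> R) (f : R -> R) :
  (forall n, measurable_fun `[a, b] (f_ n)) -> measurable_fun `[a, b] f ->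
  (forall n x, `[a, b]%classic x -> `|f_ n x| <= C) ->
  (forall x, `[a, b]%classic x -> f_ n x @[n --> \oo] --> f x) ->
  \int[mu]_(x in `[a, b]) f_ n x @[n --> \oo] --> \int[mu]_(x in `[a, b]) f x.
Proof.
move=> mf_ mf fC ff.
have me_ n : measurable_fun (`[a, b] : set R) (EFin \o f_ n).
  by apply/measurable_EFinP; exact: mf_.
have me : measurable_fun (`[a, b] : set R) (EFin \o f) by exact/measurable_EFinP.
have cvf x : `[a, b]%classic x -> (EFin \o f_ n) x @[n --> \oo] --> (EFin \o f) x.
  by move=> Dx; apply: cvg_EFin; [exact: nearW|exact: ff].
have ic : mu.-integrable `[a, b] (EFin \o cst C).
  by apply: (@integrable_bounded_segment _ _ _ `|C|); [exact: measurable_cst|].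
have [] := @dominated_convergence _ _ R mu `[a, b]%classic (measurable_itv _)
  (fun n => EFin \o f_ n) (EFin \o f) (EFin \o cst C) => //.
- by apply: aeW => x; exact: cvf.
- by apply: aeW => x n Dx; rewrite lee_fin; exact: fC.
move=> fi _ cv.
apply: fine_cvg; rewrite fineK//.
exact: integrable_fin_num.
Qed.

End bounded_convergence.

Section limit_moments.
Context (R : realType) (alpha beta : R).
Hypotheses (ha : 0 <= alpha <= 1) (hb : 0 <= beta <= 1).
Local Notation mu := (@lebesgue_measure R).
Local Notation a := (phi_minus alpha beta).
Local Notation b := (phi_plus alpha beta).
Local Notation r := (phi_rad alpha beta).
Local Notation dens := (limit_density alpha beta).
Local Notation supp := (limit_support alpha beta).

Let u := alpha + beta - 2 * alpha * beta.

Let a0 : 0 <= a. Proof. exact: phi_minus_ge0. Qed.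
Let b1 : b <= 1. Proof. exact: phi_plus_le1. Qed.
Let r0 : 0 <= r. Proof. exact: sqrtr_ge0. Qed.
Let aE : a = u - 2 * r. Proof. by []. Qed.
Let bE : b = u + 2 * r. Proof. by []. Qed.

Let pi_neq0 : pi != 0 :> R. Proof. by rewrite gt_eqF// pi_gt0. Qed.

Lemma phi_rad_sqr : r ^+ 2 = alpha * beta * (1 - alpha) * (1 - beta).
Proof.
case/andP: ha => ? ?; case/andP: hb => ? ?.
by rewrite sqr_sqrtr// !mulr_ge0// subr_ge0.
Qed.

Let sqrt01 (x : R) : 0 <= x <= 1 -> Num.sqrt x \in `[-1, 1].
Proof.
case/andP => x0 x1; rewrite in_itv /=; apply/andP; split.
  by rewrite (le_trans _ (sqrtr_ge0 x)).
by rewrite -sqrtr1 ler_wsqrtr.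
Qed.

Let cos_acos_sqr (x : R) : 0 <= x <= 1 -> cos (acos (Num.sqrt x)) ^+ 2 = x.
Proof. by move=> x01; rewrite acosK ?sqrt01// sqr_sqrtr//; case/andP: x01. Qed.

Let b01 : 0 <= b <= 1.
Proof. by rewrite b1 andbT bE; have := a0; have := r0; rewrite aE; lra. Qed.
Let a01 : 0 <= a <= 1.
Proof. by rewrite a0 /= aE; have := b1; have := r0; rewrite bE; lra. Qed.
Let ab : a <= b. Proof. by rewrite aE bE; have := r0; lra. Qed.

Let supp_pi x : supp x -> 0 <= x <= pi.
Proof.
rewrite /limit_support /= in_itv /= => /andP[h1 h2].
have /andP[b2 b3] : -1 <= Num.sqrt b <= 1 by have := sqrt01 b01; rewrite in_itv.
have /andP[a2 a3] : -1 <= Num.sqrt a <= 1 by have := sqrt01 a01; rewrite in_itv.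
apply/andP; split; first by apply: le_trans h1; rewrite acos_ge0 ?b2.
by apply: (le_trans h2); rewrite acos_lepi ?a2.
Qed.

Let cos_decr x y : supp x -> supp y -> x < y -> cos y ^+ 2 < cos x ^+ 2.
Proof.
move=> sx sy xy; have := sin_cos_ge0 ha hb sx; have := sin_cos_ge0 ha hb sy.
move=> [_ cy] [_ cx].
rewrite ltrXn2r// ?ltr_cos ?in_itv /=; [by []|exact: supp_pi|exact: supp_pi].
Qed.

Let supp_le : acos (Num.sqrt b) <= acos (Num.sqrt a).
Proof.
rewrite leNgt; apply/negP => lt.
have /andP[b2 b3] : -1 <= Num.sqrt b <= 1 by have := sqrt01 b01; rewrite in_itv.
have /andP[a2 a3] : -1 <= Num.sqrt a <= 1 by have := sqrt01 a01; rewrite in_itv.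
move: lt; rewrite -ltr_cos ?in_itv/= ?acos_ge0 ?acos_lepi ?a2 ?b2//.
rewrite !acosK ?sqrt01//; by apply/negP; rewrite -leNgt ler_wsqrtr.
Qed.

Let supp_l : supp (acos (Num.sqrt b)).
Proof. by rewrite /limit_support /= in_itv /= lexx supp_le. Qed.
Let supp_r : supp (acos (Num.sqrt a)).
Proof. by rewrite /limit_support /= in_itv /= lexx supp_le. Qed.

Let cos_range x : supp x -> a <= cos x ^+ 2 <= b.
Proof.
move=> sx; have := sx; rewrite /limit_support /= in_itv /= => /andP[h1 h2].
rewrite -[X in X <= _ <= _](cos_acos_sqr a01) -[X in _ <= _ <= X](cos_acos_sqr b01).
apply/andP; split.
  move: h2; rewrite le_eqVlt => /predU1P[->//|h2].
  by apply/ltW/cos_decr.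
move: h1; rewrite le_eqVlt => /predU1P[->//|h1].
by apply/ltW/cos_decr.
Qed.

(** On the support x = cos^2 satisfies phi_- <= x <= phi_+, and phi_+ <= 1 and
   0 <= phi_- give (phi_+ - x) (x - phi_-) <= (1 - x) x. *)
Lemma limit_density_le x : supp x -> dens x <= pi^-1.
Proof.
move=> sx; have [s0 c0] := sin_cos_ge0 ha hb sx.
have /andP[ca cb] := cos_range sx.
rewrite /limit_density; have [sc|sc] := eqVneq (sin x * cos x) 0.
  by rewrite -mulrA sc mulr0 invr0 mulr0 invr_ge0 pi_ge0.
rewrite -mulrA invfM mulrCA ler_piMr ?invr_ge0 ?pi_ge0//.
have sc0 : 0 < sin x * cos x by rewrite lt_neqAle eq_sym sc mulr_ge0.
rewrite ler_pdivrMr// mul1r.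
rewrite -[leRHS]ger0_norm ?mulr_ge0// -sqrtr_sqr ler_wsqrtr// exprMn.
have s2 := sin2cos2 x.
by rewrite s2 ler_pM ?subr_ge0//; [rewrite lerD2r|rewrite gerBl].
Qed.

(** The integral of g against the limit measure, written with Lebesgue measure:
   [integral_limit_measure]. *)
Definition density_integral (g : R -> R) : R := \int[mu]_(x in supp) (g x * dens x).

Let m_dens : measurable_fun supp dens.
Proof. exact: measurable_limit_density ha hb. Qed.

Let dens_norm x : supp x -> `|dens x| <= pi^-1.
Proof. by move=> sx; rewrite ger0_norm ?limit_density_le// limit_density_ge0. Qed.

Let m_gdens (g : R -> R) : measurable_fun setT g -> measurable_fun supp (fun x => g x * dens x).
Proof. by move=> mg; apply: measurable_funM => //; exact: measurable_funTS. Qed.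

Lemma integrable_gdens (g : R -> R) C : measurable_fun setT g -> (forall x, supp x -> `|g x| <= C) ->
  mu.-integrable supp (EFin \o (fun x => g x * dens x)).
Proof.
move=> mg gC; apply: (@integrable_bounded_segment _ _ _ _ (C * pi^-1)).
  exact: m_gdens.
by move=> x sx; rewrite normrM ler_pM ?gC ?dens_norm.
Qed.

(** The substitutions x = cos^2 theta and x = u + 2 r cos t turn the density into
   the semicircle density (2 / pi) sin^2 t. *)
Lemma density_integral_angle (q : R -> R) : continuous q ->
  density_integral (fun x => q (cos x ^+ 2) * (cos x ^+ 2 * sin x ^+ 2)) =
  r ^+ 2 * (2 / pi * \int[mu]_(t in `[0, pi]) (q (u + 2 * r * cos t) * sin t ^+ 2)).
Proof.
move=> cq.
pose G x := q x * Num.sqrt ((b - x) * (x - a)).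
have cG : continuous G.
  move=> x; apply: cvgM; first exact: cq.
  apply: (@continuous_comp _ _ _ (fun x => (b - x) * (x - a)) Num.sqrt).
    by apply: cvgM; apply: cvgB; try exact: cvg_id; exact: cvg_cst.
  exact: sqrt_continuous.
have dc (x : R) : is_derive x 1 (fun t => cos t ^+ 2) (- (2 * cos x * sin x)).
  by apply: is_derive_eq; rewrite /GRing.scale /=; ring.
have du (x : R) : is_derive x 1 (fun t => u + 2 * r * cos t) (- (2 * r * sin x)).
  by apply: is_derive_eq; rewrite /GRing.scale /=; ring.
have cM2 (f g : R -> R) : continuous f -> continuous g -> continuous (fun x => f x * g x).
  by move=> cf cg x; apply: cvgM; [exact: cf|exact: cg].
have cN (f : R -> R) : continuous f -> continuous (fun x => - f x).
  by move=> cf x; apply: cvgN; exact: cf.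
have cC (c : R) : continuous (fun _ : R => c) by exact: cst_continuous.
have ccos := @continuous_cos R; have csin := @continuous_sin R.
have e1 := @Rintegral_substitution_decreasing R (fun t => cos t ^+ 2)
   (fun x => - (2 * cos x * sin x)) G _ _ supp_le.
have e2 := @Rintegral_substitution_decreasing R (fun t => u + 2 * r * cos t)
   (fun x => - (2 * r * sin x)) G 0 pi (pi_ge0 R).
have [r00|rn0] := eqVneq r 0.
  rewrite r00 expr0n mul0r /density_integral /limit_support.
  have -> : Num.sqrt a = Num.sqrt b by rewrite aE bE r00 mulr0 subr0 addr0.
  by rewrite set_itv1 Rintegral_set1.
have rp : 0 < r by rewrite lt_neqAle eq_sym rn0.
rewrite !cos_acos_sqr// in e1.
rewrite cospi cos0 mulrN1 mulr1 -aE -bE in e2.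
have {}e1 : \int[mu]_(x in `[a, b]) G x =
    \int[mu]_(x in supp) (G (cos x ^+ 2) * (2 * cos x * sin x)).
  rewrite e1.
  - by apply: eq_Rintegral => x _; rewrite opprK.
  - by move=> x y sx sy /=; exact: cos_decr.
  - by apply: (cN); apply: (cM2) => //; exact: cM2.
  - exact: within_continuous.
have {}e2 : \int[mu]_(x in `[a, b]) G x =
    \int[mu]_(t in `[0, pi]) (G (u + 2 * r * cos t) * (2 * r * sin t)).
  rewrite e2.
  - by apply: eq_Rintegral => x _; rewrite opprK.
  - by move=> x y sx sy /= xy; rewrite ltrD2l ltr_pM2l ?mulr_gt0// ltr_cos.
  - by apply: (cN); apply: (cM2) => //; exact: cC.
  - exact: within_continuous.
have -> : density_integral (fun x => q (cos x ^+ 2) * (cos x ^+ 2 * sin x ^+ 2)) =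
    (2 * pi)^-1 * \int[mu]_(x in supp) (G (cos x ^+ 2) * (2 * cos x * sin x)).
  rewrite -RintegralZl//; last first.
    apply: integrable_segment; apply: within_continuous; apply: (cM2).
      move=> x; apply: (@continuous_comp _ _ _ (fun x => cos x ^+ 2) G); last exact: cG.
      exact: (is_derive_continuous dc).
    by apply: (cM2) => //; exact: cM2.
    exact: measurable_itv.
  rewrite /density_integral; apply: eq_Rintegral => x; rewrite inE => sx.
  rewrite /G /limit_density; set w := Num.sqrt _.
  have [sc|sc] := eqVneq (sin x * cos x) 0.
    rewrite (_ : cos x ^+ 2 * sin x ^+ 2 = (sin x * cos x) ^+ 2); last by ring.
    by rewrite sc expr0n mulr0 mul0r -(mulrA 2) (mulrC (cos x)) sc !mulr0.
  move: sc; rewrite mulf_eq0 negb_or => /andP[sn cn].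
  by move: pi_neq0; generalize (pi : R) => p pn; field; rewrite ?pn ?sn ?cn.
rewrite -e1 e2 mulrA.
rewrite -RintegralZl//; last first.
  apply: integrable_segment; apply: within_continuous; apply: (cM2); last by apply: (cM2) => //; exact: cC.
  move=> x; apply: (@continuous_comp _ _ _ (fun x => u + 2 * r * cos x) G); last exact: cG.
  exact: (is_derive_continuous du).
rewrite -RintegralZl//; last first.
  apply: integrable_segment; apply: within_continuous; apply: (cM2).
    move=> x; apply: (@continuous_comp _ _ _ (fun x => u + 2 * r * cos x) q); last exact: cq.
    exact: (is_derive_continuous du).
  have -> : (fun x => sin x ^+ 2) = (fun x : R => sin x * sin x) by apply/funext => x; rewrite expr2.
  exact: cM2.
apply: eq_Rintegral => t; rewrite inE /= in_itv /= => /andP[t0 tp].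
rewrite /G (_ : (b - _) * _ = (2 * r * sin t) ^+ 2); last first.
  by rewrite aE bE exprMn sin2cos2; ring.
rewrite sqrtr_sqr ger0_norm; last by rewrite mulr_ge0 ?mulr_ge0// sin_ge0_pi// t0.
by move: pi_neq0; generalize (pi : R) => p pn; field; rewrite ?pn.
Qed.

Definition limit_moment j := density_integral (fun x => cos x ^+ (2 * j)).

Let m_cosX j : measurable_fun setT (fun x : R => cos x ^+ j).
Proof. by apply: measurable_funX; exact: continuous_measurable_fun (@continuous_cos R). Qed.

Let m_sinX j : measurable_fun setT (fun x : R => sin x ^+ j).
Proof. by apply: measurable_funX; exact: continuous_measurable_fun (@continuous_sin R). Qed.

Let cosX_le j x : `|cos x ^+ j| <= 1 :> R.
Proof. by rewrite normrX exprn_ile1// ler_norml cos_geN1 cos_le1. Qed.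

(** The difference brings in the factor cos^2 sin^2 that cancels the denominator of the
   density. *)
Lemma limit_moment_diff j : limit_moment j.+1 - limit_moment j.+2 =
  r ^+ 2 * angular_moment u r j 0.
Proof.
rewrite /limit_moment /density_integral -RintegralB; last 3 first.
- exact: measurable_itv.
- exact: (@integrable_gdens _ 1).
- exact: (@integrable_gdens _ 1).
rewrite /angular_moment.
under [in RHS]eq_Rintegral do rewrite mul1r -expr2.
rewrite -(@density_integral_angle (fun x => x ^+ j)); last exact: exprn_continuous.
apply: eq_Rintegral => x _; rewrite -mulrBl; congr (_ * _).
by rewrite sin2cos2 !exprM; set c := cos x ^+ 2; rewrite !(exprS c); ring.
Qed.

(** The Stieltjes transform of the semicircle law at a point outside its support, with y
   the distance from that point to the centre and e = 1 or e = -1 the side on which it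
   lies. *)
Lemma density_integral_stieltjes (q : R -> R) (y e : R) : 2 * r < y -> e ^+ 2 = 1 ->
  continuous q -> (forall t, q (u + 2 * r * cos t) = (y + e * (2 * r) * cos t)^-1) ->
  density_integral (fun x => q (cos x ^+ 2) * (cos x ^+ 2 * sin x ^+ 2)) =
  (y - Num.sqrt (y ^+ 2 - 4 * r ^+ 2)) / 2.
Proof.
move=> ry e2 cq qE; rewrite density_integral_angle//.
have y0 : 0 < y by apply: le_lt_trans ry; rewrite mulr_ge0.
have [r00|rn0] := eqVneq r 0.
  by rewrite r00 expr0n mul0r mulr0 subr0 sqrtr_sqr gtr0_norm// subrr mul0r.
have rp : 0 < r by rewrite lt_neqAle eq_sym rn0.
have r2 : 2 * r != 0 by rewrite mulf_neq0.
pose A := y / (2 * r).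
have A1 : 1 < A by rewrite ltr_pdivlMr ?mulr_gt0// mul1r.
have -> : \int[mu]_(t in `[0, pi]) (q (u + 2 * r * cos t) * sin t ^+ 2) =
    (2 * r)^-1 * \int[mu]_(t in `[0, pi]) (sin t ^+ 2 / (A + e * cos t)).
  have d0 x : A + e * cos x != 0.
    have : `|e * cos x| <= 1.
      rewrite normrM (_ : `|e| = 1) ?mul1r ?ler_norml ?cos_geN1 ?cos_le1//.
      by apply/eqP; rewrite -sqrp_eq1// real_normK ?num_real// e2.
    by rewrite ler_norml => ?; rewrite gt_eqF//; lra.
  rewrite -Rintegral_segmentZ; last first.
    move=> x; apply: cvgM; first by apply: cvgM; exact: continuous_sin.
    apply: cvgV => //; apply: cvgD; first exact: cvg_cst.
    by apply: cvgM; [exact: cvg_cst|exact: continuous_cos].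
  apply: eq_Rintegral => t _; rewrite qE.
  have -> : y + e * (2 * r) * cos t = 2 * r * (A + e * cos t).
    by rewrite /A; field.
  by rewrite [in LHS]invfM -[LHS]mulrA [_ * sin t ^+ 2]mulrC.
rewrite integral_sin2_cos//.
have -> : Num.sqrt (A ^+ 2 - 1) = Num.sqrt (y ^+ 2 - 4 * r ^+ 2) / (2 * r).
  rewrite -[X in _ = _ / X]ger0_norm ?mulr_ge0// -sqrtr_sqr -sqrtrV ?sqr_ge0//.
  rewrite -sqrtrM; last first.
    rewrite subr_ge0 (_ : 4 * r ^+ 2 = (2 * r) ^+ 2); last by ring.
    by rewrite lerXn2r ?nnegrE ?mulr_ge0// ltW.
  by congr Num.sqrt; rewrite /A; field.
by rewrite /A; move: pi_neq0; generalize (pi : R) => p pn; field; rewrite rn0.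
Qed.

Let harm_cvg : (n.+1%:R^-1 : R) @[n --> \oo] --> (0 : R).
Proof. exact: cvg_harmonic. Qed.

Let stieltjes_cvg (y0 : R) : (((y0 + n.+1%:R^-1) -
    Num.sqrt ((y0 + n.+1%:R^-1) ^+ 2 - 4 * r ^+ 2)) / 2) @[n --> \oo] -->
  (y0 - Num.sqrt (y0 ^+ 2 - 4 * r ^+ 2)) / 2.
Proof.
have cy : (y0 + n.+1%:R^-1) @[n --> \oo] --> y0.
  by rewrite -[X in _ --> X]addr0; apply: cvgD; [exact: cvg_cst|exact: harm_cvg].
have cK : continuous (fun y : R => (y - Num.sqrt (y ^+ 2 - 4 * r ^+ 2)) / 2).
  move=> y; apply: cvgM; last exact: cvg_cst.
  apply: cvgB; first exact: cvg_id.
  apply: (@continuous_comp R R R (fun y : R => y ^+ 2 - 4 * r ^+ 2) (@Num.sqrt R)).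
    by apply: cvgB; [exact: exprn_continuous|exact: cvg_cst].
  exact: sqrt_continuous.
exact: (cvg_comp (fun n => y0 + n.+1%:R^-1) _ cy (cK y0)).
Qed.

(** Regularised quotients v / (e + v) tend to 1 where v does not vanish; where it
   does, the density vanishes because of the division by 0. *)
Let quot_cvg (v : R) : 0 <= v -> v / (n.+1%:R^-1 + v) @[n --> \oo] --> ((v != 0)%:R : R).
Proof.
move=> v0; have [->|vn] := eqVneq v 0.
  by under eq_fun do rewrite mul0r; exact: cvg_cst.
rewrite -[X in _ --> X](_ : v / (0 + v) = _); last by rewrite add0r divff.
apply: cvgM; first exact: cvg_cst.
apply: cvgV; first by rewrite add0r.
by apply: cvgD; [exact: harm_cvg|exact: cvg_cst].
Qed.

Let quot_le (e v : R) : 0 < e -> 0 <= v -> 0 <= v / (e + v) <= 1.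
Proof.
move=> e0 v0; have ev : 0 < e + v by lra.
by rewrite divr_ge0 ?(ltW ev)//= ler_pdivrMr// mul1r; lra.
Qed.

Let inv_abs_continuous (e c : R) : 0 < e -> continuous (fun x : R => (e + `|c - x|)^-1).
Proof.
move=> e0 x; apply: cvgV.
  by rewrite gt_eqF// ltr_wpDr.
apply: cvgD; first exact: cvg_cst.
apply: cvg_norm; apply: cvgB; [exact: cvg_cst|exact: cvg_id].
Qed.

Let density_integral_cvg (f_ : nat -> R -> R) (f : R -> R) :
  (forall n, measurable_fun setT (f_ n)) -> measurable_fun setT f ->
  (forall n x, supp x -> `|f_ n x| <= 1) ->
  (forall x, supp x -> f_ n x * dens x @[n --> \oo] --> f x * dens x) ->
  density_integral (f_ n) @[n --> \oo] --> density_integral f.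
Proof.
move=> mf_ mf f1 fc; apply: (@bounded_convergence _ _ _ pi^-1) => //.
- by move=> n; exact: m_gdens.
- exact: m_gdens.
- move=> n x sx; rewrite normrM -[leRHS]mul1r ler_pM ?f1 ?dens_norm//.
Qed.

(** On the support, cos^2 is the limit of cos^2 sin^2 / (e + sin^2) as e decreases to 0,
   where the denominator is the distance from x = cos^2 to the point 1 + e. The sine can
   vanish at an endpoint of the support only, and there the density is 0 by division
   by 0. *)
Lemma limit_moment1 : limit_moment 1 = (1 - u - `|1 - alpha - beta|) / 2.
Proof.
pose f_ n x : R := (n.+1%:R^-1 + `|1 - cos x ^+ 2|)^-1 * (cos x ^+ 2 * sin x ^+ 2).
have s2 x : `|1 - cos x ^+ 2| = sin x ^+ 2 :> R.
  by rewrite -sin2cos2 ger0_norm// sqr_ge0.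
have fE n x : f_ n x = cos x ^+ 2 * (sin x ^+ 2 / (n.+1%:R^-1 + sin x ^+ 2)).
  by rewrite /f_ s2; set v := _^-1; ring.
have lim1 : density_integral (f_ n) @[n --> \oo] --> limit_moment 1.
  apply: density_integral_cvg => [n||n x _|x sx].
  - apply: measurable_funM; last by apply: measurable_funM; [exact: m_cosX|exact: m_sinX].
    have mq : measurable_fun setT (fun x : R => (n.+1%:R^-1 + `|1 - x|)^-1).
      by apply: continuous_measurable_fun; exact: inv_abs_continuous.
    exact: (measurableT_comp mq (m_cosX 2)).
  - exact: m_cosX.
  - rewrite fE.
    have /andP[q0 q1] := quot_le (v := sin x ^+ 2) (e := n.+1%:R^-1) ltac:(by []) (sqr_ge0 _).
    by rewrite normrM -[leRHS]mul1r ler_pM// ?cosX_le// ger0_norm.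
  - under eq_fun do rewrite fE.
    have -> : cos x ^+ (2 * 1) * dens x = cos x ^+ 2 * (sin x ^+ 2 != 0)%:R * dens x.
      have [s0|_] := eqVneq (sin x ^+ 2) 0; last by rewrite mulr1.
      have {}s0 : sin x = 0 by apply/eqP; rewrite -sqrf_eq0 s0.
      by rewrite /limit_density s0 mulr0 mul0r invr0 !mulr0.
    apply: cvgM; last exact: cvg_cst.
    by apply: cvgM; [exact: cvg_cst|apply: quot_cvg; exact: sqr_ge0].
have val n : density_integral (f_ n) = ((1 - u + n.+1%:R^-1) -
    Num.sqrt ((1 - u + n.+1%:R^-1) ^+ 2 - 4 * r ^+ 2)) / 2.
  have n0 : 0 < n.+1%:R^-1 :> R by [].
  apply: (@density_integral_stieltjes (fun x => (n.+1%:R^-1 + `|1 - x|)^-1) _ (-1)).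
  - by have := b1; rewrite bE; move: n0; generalize (n.+1%:R^-1 : R) => z z0; lra.
  - by rewrite sqrrN expr1n.
  - exact: inv_abs_continuous.
  - move=> t; congr (_^-1).
    have : 2 * r * cos t <= 2 * r by rewrite ler_piMr ?mulr_ge0// cos_le1.
    by move=> h; rewrite ger0_norm; [ring|have := b1; rewrite bE; lra].
have lim2 := @stieltjes_cvg (1 - u).
have -> : `|1 - alpha - beta| = Num.sqrt ((1 - u) ^+ 2 - 4 * r ^+ 2).
  by rewrite -sqrtr_sqr phi_rad_sqr; congr Num.sqrt; rewrite /u; ring.
have /cvg_lim <- // := lim1.
under eq_fun do rewrite val.
exact/cvg_lim.
Qed.

(** As for the first moment, with cos^2 in the denominator and the point - e. *)
Lemma limit_moment01 : limit_moment 0 - limit_moment 1 = (u - `|alpha - beta|) / 2.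
Proof.
have -> : limit_moment 0 - limit_moment 1 = density_integral (fun x => sin x ^+ 2).
  rewrite /limit_moment /density_integral -RintegralB; last 3 first.
  - exact: measurable_itv.
  - exact: (@integrable_gdens _ 1).
  - exact: (@integrable_gdens _ 1).
  apply: eq_Rintegral => x _; rewrite -mulrBl; congr (_ * _).
  by rewrite sin2cos2 muln0 muln1 expr0.
pose f_ n x : R := (n.+1%:R^-1 + `|0 - cos x ^+ 2|)^-1 * (cos x ^+ 2 * sin x ^+ 2).
have c2 x : `|0 - cos x ^+ 2| = cos x ^+ 2 :> R.
  by rewrite sub0r normrN ger0_norm// sqr_ge0.
have fE n x : f_ n x = sin x ^+ 2 * (cos x ^+ 2 / (n.+1%:R^-1 + cos x ^+ 2)).
  by rewrite /f_ c2; set v := _^-1; ring.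
have s1 x : `|sin x ^+ 2| <= 1 :> R.
  by rewrite normrX exprn_ile1// ler_norml sin_geN1 sin_le1.
have lim1 : density_integral (f_ n) @[n --> \oo] --> density_integral (fun x => sin x ^+ 2).
  apply: density_integral_cvg => [n||n x _|x sx].
  - apply: measurable_funM; last by apply: measurable_funM; [exact: m_cosX|exact: m_sinX].
    have mq : measurable_fun setT (fun x : R => (n.+1%:R^-1 + `|0 - x|)^-1).
      by apply: continuous_measurable_fun; exact: inv_abs_continuous.
    exact: (measurableT_comp mq (m_cosX 2)).
  - exact: m_sinX.
  - rewrite fE.
    have /andP[q0 q1] := quot_le (v := cos x ^+ 2) (e := n.+1%:R^-1) ltac:(by []) (sqr_ge0 _).
    by rewrite normrM -[leRHS]mul1r ler_pM// ?s1// ger0_norm.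
  - under eq_fun do rewrite fE.
    have -> : sin x ^+ 2 * dens x = sin x ^+ 2 * (cos x ^+ 2 != 0)%:R * dens x.
      have [s0|_] := eqVneq (cos x ^+ 2) 0; last by rewrite mulr1.
      have {}s0 : cos x = 0 by apply/eqP; rewrite -sqrf_eq0 s0.
      by rewrite /limit_density s0 mulr0 invr0 !mulr0.
    apply: cvgM; last exact: cvg_cst.
    by apply: cvgM; [exact: cvg_cst|apply: quot_cvg; exact: sqr_ge0].
have val n : density_integral (f_ n) = ((u + n.+1%:R^-1) -
    Num.sqrt ((u + n.+1%:R^-1) ^+ 2 - 4 * r ^+ 2)) / 2.
  have n0 : 0 < n.+1%:R^-1 :> R by [].
  apply: (@density_integral_stieltjes (fun x => (n.+1%:R^-1 + `|0 - x|)^-1) _ 1).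
  - by have := a0; rewrite aE; move: n0; generalize (n.+1%:R^-1 : R) => z z0; lra.
  - by rewrite expr1n.
  - exact: inv_abs_continuous.
  - move=> t; congr (_^-1).
    have : - (2 * r) <= 2 * r * cos t by rewrite -mulrN1 ler_wpM2l ?mulr_ge0// cos_geN1.
    by move=> h; rewrite sub0r normrN ger0_norm; [ring|have := a0; rewrite aE; lra].
have lim2 := @stieltjes_cvg u.
have -> : `|alpha - beta| = Num.sqrt (u ^+ 2 - 4 * r ^+ 2).
  by rewrite -sqrtr_sqr phi_rad_sqr; congr Num.sqrt; rewrite /u; ring.
have /cvg_lim <- // := lim1.
under eq_fun do rewrite val.
exact/cvg_lim.
Qed.

(** The mass at 0 of the angles that vanish for dimension reasons. *)
Definition forced_zero_mass : R := Num.max (alpha + beta - 1) 0.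

Lemma limit_moment0 : limit_moment 0 =
  Num.min (Num.min alpha beta) (Num.min (1 - alpha) (1 - beta)).
Proof.
have -> : limit_moment 0 = limit_moment 1 + (limit_moment 0 - limit_moment 1) by ring.
rewrite limit_moment01 limit_moment1 /u.
case: (lerP alpha beta) => h1; case: (lerP (1 - alpha) (1 - beta)) => h2;
  case: (ler0P (1 - alpha - beta)) => h3; case: (ler0P (alpha - beta)) => h4;
  try (exfalso; lra); case: lerP => h5; lra.
Qed.

(** Restoring the forced atom at theta = 0 produces the solution of the limit
   loop equation. *)
Lemma limit_moment_loop m : loop_defect alpha beta
  (fun j => limit_moment j + forced_zero_mass) m.+1 = 0.
Proof.
apply: (@loop_defect_eq0 R alpha beta _ (fun j => r ^+ 2 * angular_moment u r j 0)).
- rewrite limit_moment1 /forced_zero_mass /u.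
  by case: (lerP (alpha + beta - 1) 0) => h; case: (ler0P (1 - alpha - beta)) => h'; try (exfalso; lra); lra.
- by move=> j; rewrite -limit_moment_diff; ring.
- by rewrite angular_moment0 eqxx mulr1 phi_rad_sqr.
move=> j; rewrite semicircle_recursion mulrDr !mulr_sumr; congr (_ + _).
  by rewrite mulrCA.
by apply: eq_bigr => i _; ring.
Qed.

End limit_moments.

(** * Integration against the limit measure *)

Section limit_integral.
Context (R : realType) (alpha beta : R).
Hypotheses (ha : 0 <= alpha <= 1) (hb : 0 <= beta <= 1).
Local Notation mu := (@lebesgue_measure R).
Local Notation nu := (limit_measure ha hb).
Local Notation dens := (limit_density alpha beta).
Local Notation supp := (limit_support alpha beta).

Let h := (fun x => (dens x)%:E) \_ supp.

Let msupp : measurable supp. Proof. exact: measurable_itv. Qed.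

Let integrable_dens : mu.-integrable supp (EFin \o dens).
Proof.
have := @integrable_gdens R alpha beta ha hb (cst 1) 1 (measurable_cst _)
  (fun=> fun=> ltac:(by rewrite normr1)).
by rewrite (_ : EFin \o (fun x => cst 1 x * dens x) = EFin \o dens)//;
  apply/funext => x /=; rewrite mul1r.
Qed.

Let measurable_h : measurable_fun setT h.
Proof.
apply/(measurable_restrictT _ msupp)/measurable_EFinP.
exact: measurable_limit_density ha hb.
Qed.

Let integrable_h : mu.-integrable setT h.
Proof. exact: (proj1 (integrable_mkcond (mu := mu) (EFin \o dens) msupp) integrable_dens). Qed.

Let nuE A : measurable A -> nu A = (\int[mu]_(x in A) h x)%E.
Proof. by move=> mA; rewrite /limit_measure integral_mkcondr. Qed.

Let nu_fin : fin_num_fun nu.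
Proof.
move=> A mA; rewrite nuE//; apply: integrable_fin_num => //.
exact: integrableS integrable_h.
Qed.

(** The limit measure on the measurable space that carries Lebesgue measure. *)
Definition limit_measure_lebesgue : set (measurableTypeR R) -> \bar R := nu.
Local Notation nuf := limit_measure_lebesgue.

HB.instance Definition _ := isMeasure.Build _ (measurableTypeR R) R nuf
  (measure0 nu) (measure_ge0 nu) (@measure_semi_sigma_additive _ _ _ nu).

HB.instance Definition _ := Measure_isFinite.Build _ (measurableTypeR R) R nuf nu_fin.

Let nuf_dom : nuf `<< mu.
Proof.
apply/null_content_dominatesP => A mA A0.
change (nu A = 0%E); rewrite nuE//.
by apply: null_set_integral => //; exact: measurable_funTS.
Qed.

(** The limit measure is absolutely continuous, and its Radon-Nikodym derivative is the
   density. *)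
Lemma integral_limit_measure (g : R -> R) C : measurable_fun setT g ->
  (forall x, `|g x| <= C) -> \int[nu]_x g x = density_integral alpha beta g.
Proof.
move=> mg gC.
have ig : nuf.-integrable setT (EFin \o g).
  apply: measurable_bounded_integrable => //.
    by rewrite -ge0_fin_numE//; exact: nu_fin.
  exists C; split; first exact: num_real.
  by move=> M CM x _; rewrite /= (le_trans (gC x))// ltW.
have e1 : (\int[nu]_x (g x)%:E = \int[mu]_x ((g x)%:E * h x))%E.
  (* The two measurable structures on the line differ by their display only. *)
  have mid : measurable_fun [set: measurableTypeR R] (idfun : measurableTypeR R -> R).
    by move=> _ A mA; rewrite setTI preimage_id.
  transitivity (\int[nuf]_x (g x)%:E)%E.
    transitivity (\int[pushforward nuf (idfun : measurableTypeR R -> R)]_x (g x)%:E)%E.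
      exact: eq_measure_integral.
    by rewrite (integral_pushforward mid) ?preimage_setT//; exact/measurable_EFinP.
  rewrite -(Radon_Nikodym_change_of_variables (@nuf_dom) measurableT ig)//.
  apply: ae_eq_integral => //.
  - apply: emeasurable_funM; first exact/measurable_EFinP.
    apply: (measurable_int mu).
    by apply: Radon_Nikodym_integrable; exact: (@nuf_dom).
  - by apply: emeasurable_funM => //; exact/measurable_EFinP.
  - apply: ae_eqe_mul2l => /=.
    rewrite Radon_NikodymE//=.
    case: cid => /= f [f1 f2 f3].
    apply: integral_ae_eq => //=.
    by move=> E _ mE; rewrite -f3//= -nuE.
rewrite /Rintegral e1 /density_integral /Rintegral; congr fine.
rewrite [RHS]integral_mkcond; apply: eq_integral => x _.
by rewrite /h !patchE; case: ifP => //= _; rewrite mule0.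
Qed.

Lemma limit_measure_setT : nu setT = (limit_moment alpha beta 0)%:E.
Proof.
rewrite /limit_moment /density_integral /Rintegral fineK; last first.
  apply: integrable_fin_num => //.
  apply: (@integrable_gdens R alpha beta ha hb (fun x => cos x ^+ (2 * 0)) 1).
    by under eq_fun do rewrite muln0 expr0; exact: measurable_cst.
  by move=> x _; rewrite muln0 expr0 normr1.
rewrite /limit_measure setTI; apply: eq_integral => x _.
by rewrite muln0 expr0 mul1r.
Qed.

End limit_integral.

(** * Polynomial approximation *)

Section bernstein.
Context (R : realFieldType).

(** The Bernstein polynomial sum_k 'C(n, k) g(k) X^k (1 - X)^(n - k), that is, the mean of
   g at a binomial variable, computed by conditioning on the first toss. *)
Fixpoint bernstein n (g : nat -> R) : {poly R} :=
  if n is n'.+1 then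
    'X * bernstein n' (fun k => g k.+1) + (1 - 'X) * bernstein n' g
  else (g 0%N)%:P.

Lemma bernstein_le n (g h : nat -> R) x : 0 <= x <= 1 ->
  (forall k, (k <= n)%N -> `|g k| <= h k) ->
  `|(bernstein n g).[x]| <= (bernstein n h).[x].
Proof.
move=> /andP[x0 x1]; elim: n g h => [|n IH] g h gh /=; first by rewrite !hornerC gh.
rewrite !hornerE (le_trans (ler_normD _ _))// !normrM (ger0_norm x0).
rewrite [`|1 - x|]ger0_norm ?subr_ge0//.
apply: lerD; apply: ler_wpM2l; rewrite ?subr_ge0//; apply: IH => k kn.
  exact: gh.
by apply: gh; exact: leqW.
Qed.

Lemma bernstein_sub n (g : nat -> R) c x :
  c - (bernstein n g).[x] = (bernstein n (fun k => c - g k)).[x].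
Proof.
elim: n g => [|n IH] g /=; first by rewrite !hornerC.
by rewrite !hornerE -!IH; ring.
Qed.

(** The mean of a quadratic function of a binomial variable. *)
Lemma bernstein_quadratic n a b c x :
  (bernstein n (fun k => a + b * (k%:R + c) ^+ 2)).[x] =
  a + b * (n%:R * x * (1 - x) + (n%:R * x + c) ^+ 2).
Proof.
elim: n c => [|n IH] c /=; first by rewrite hornerC; ring.
rewrite !hornerE.
rewrite (_ : (fun k : nat => a + b * (k.+1%:R + c) ^+ 2) =
  fun k : nat => a + b * (k%:R + (1 + c)) ^+ 2); last first.
  by apply/funext => k; rewrite -[k.+1]addn1 natrD addrA.
by rewrite !IH -[n.+1]addn1 natrD; ring.
Qed.

End bernstein.

Section approximation.
Context (R : realType).

Lemma cos2_inj (s t : R) : 0 <= s <= pi / 2 -> 0 <= t <= pi / 2 ->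
  cos s ^+ 2 = cos t ^+ 2 -> s = t.
Proof.
move=> /andP[s0 s1] /andP[t0 t1] e.
have pi2 : pi / 2 <= pi :> R by rewrite ler_pdivrMr// ler_pMr ?pi_gt0// ler1n.
have cs : 0 <= cos s.
  by apply: cos_ge0_pihalf; rewrite s1 andbT (le_trans _ s0)// oppr_le0 divr_ge0 ?pi_ge0.
have ct : 0 <= cos t.
  by apply: cos_ge0_pihalf; rewrite t1 andbT (le_trans _ t0)// oppr_le0 divr_ge0 ?pi_ge0.
apply: cos_inj; rewrite ?in_itv /= ?s0 ?t0 ?(le_trans s1) ?(le_trans t1)//.
by apply/eqP; rewrite -(eqrXn2 (n := 2))//; apply/eqP.
Qed.

Lemma acos_quarter (x : R) : 0 <= x <= 1 -> 0 <= acos x <= pi / 2.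
Proof.
move=> /andP[x0 x1]; have xm : -1 <= x by rewrite (le_trans _ x0)// lerN10.
rewrite acos_ge0 ?xm//= leNgt; apply/negP => xpi.
have pi2 : pi / 2 <= pi :> R by rewrite ler_pdivrMr// ler_pMr ?pi_gt0// ler1n.
have : cos (acos x) < cos (pi / 2).
  by rewrite ltr_cos// in_itv /= ?pi2 ?divr_ge0 ?pi_ge0 ?acos_ge0 ?acos_lepi ?xm ?x1.
by rewrite cos_pihalf acosK ?in_itv /= ?xm// ltNge x0.
Qed.

(** A modulus of continuity in the variable cos^2, which determines an angle of
   [0, pi / 2]; a compactness argument on pairs of angles. *)
Lemma cos2_modulus (f : R -> R) (e : R) : continuous f ->
  (exists M, forall x, `|f x| <= M) -> 0 < e ->
  exists2 C : R, 0 <= C & forall s t, 0 <= s <= pi / 2 -> 0 <= t <= pi / 2 ->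
    `|f s - f t| <= e + C * (cos s ^+ 2 - cos t ^+ 2) ^+ 2.
Proof.
move=> cf [M hM] e0.
pose K : set R := `[0, pi / 2]%classic.
have cK : compact (K `*` K) by apply: compact_setX; exact: segment_compact.
have [/(_ cK) cov _] := @compact_near_coveringP _ (K `*` K).
have c2 : continuous (fun x : R => cos x ^+ 2).
  move=> x; apply: (@continuous_comp _ _ _ (@cos R) (fun x => x ^+ 2)).
    exact: continuous_cos.
  exact: exprn_continuous.
have diff (g : R -> R) (x : R * R) : continuous g ->
    g y.1 - g y.2 @[y --> x] --> g x.1 - g x.2.
  move=> cg; apply: cvgB.
    by apply: (@continuous_comp _ _ _ (@fst R R) g); [exact: cvg_fst|exact: cg].
  by apply: (@continuous_comp _ _ _ (@snd R R) g); [exact: cvg_snd|exact: cg].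
have [n _ hn] : \forall n \near \oo, K `*` K `<=` (fun x : R * R =>
    `|f x.1 - f x.2| <= e + n%:R * (cos x.1 ^+ 2 - cos x.2 ^+ 2) ^+ 2).
  apply: (cov nat \oo (fun (n : nat) (x : R * R) =>
    `|f x.1 - f x.2| <= e + n%:R * (cos x.1 ^+ 2 - cos x.2 ^+ 2) ^+ 2)).
  move=> x [Ks Kt]; have [st|st] := eqVneq x.1 x.2.
    have : \forall y \near x, `|f y.1 - f y.2| < e.
      have := diff f x cf; rewrite st subrr => /cvgr0_norm_lt; exact.
    move=> h; near=> y n => /=.
    rewrite (@le_trans _ _ e)//; last by rewrite lerDl mulr_ge0 ?sqr_ge0.
    by apply/ltW; near: y.
  pose D (y : R * R) := (cos y.1 ^+ 2 - cos y.2 ^+ 2) ^+ 2.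
  have D0 : 0 < D x.
    rewrite exprn_even_gt0//= subr_eq0; apply: contra st => /eqP h; apply/eqP.
    by apply: cos2_inj h; [move: Ks|move: Kt]; rewrite /K /= in_itv.
  have Dx : D y @[y --> x] --> D x.
    apply: (@continuous_comp _ _ _ (fun y : R * R => cos y.1 ^+ 2 - cos y.2 ^+ 2)
      (fun u : R => u ^+ 2)); last exact: exprn_continuous.
    exact: (diff (fun u : R => cos u ^+ 2)).
  have h1 : \forall y \near x, D x / 2 < D y.
    by apply: (cvgr_gt _ Dx); rewrite ltr_pdivrMr// ltr_pMr// ltr1n.
  have h2 : \forall n \near \oo, 4 * M / D x <= n%:R :> R.
    exact: nbhs_infty_ger.
  near=> y n => /=.
  rewrite (@le_trans _ _ (2 * M))//.
    by rewrite (le_trans (ler_normB _ _))// mulr_natl mulr2n lerD.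
  rewrite (@le_trans _ _ (n%:R * D y))//; last by rewrite lerDr ltW.
  rewrite (_ : 2 * M = 4 * M / D x * (D x / 2)); last by field; rewrite gt_eqF.
  have M0 : 0 <= M by rewrite (le_trans _ (hM 0)).
  have D2 : 0 <= D x / 2 by rewrite divr_ge0 ?(ltW D0).
  have M2 : 0 <= 4 * M / D x by rewrite divr_ge0 ?(ltW D0)// mulr_ge0.
  apply: ler_pM => //.
    by near: n.
  by apply/ltW; near: y.
exists n%:R => // s t hs ht.
by apply: (hn n (leqnn _) (s, t)); split; rewrite /K /= in_itv.
Unshelve. all: by end_near. Qed.

(** Bernstein approximation of f o arccos o sqrt, in the variable cos^2. *)
Lemma cos2_polynomial_approximation (f : R -> R) (e : R) : continuous f ->
  (exists M, forall x, `|f x| <= M) -> 0 < e ->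
  exists p : {poly R}, forall t, 0 <= t <= pi / 2 -> `|f t - p.[cos t ^+ 2]| <= e.
Proof.
move=> cf bf e0; have e2 : 0 < e / 2 by rewrite divr_gt0.
have [C C0 hC] := cos2_modulus cf bf e2.
pose N := (Num.truncn (2 * C / e)).+1.
have N0 : 0 < N%:R :> R by rewrite ltr0n.
have CN : C / N%:R <= e / 2.
  rewrite ler_pdivrMr// mulrC -ler_pdivrMr// ltW//.
  rewrite (_ : C / (e / 2) = 2 * C / e); last by field; rewrite gt_eqF.
  by rewrite truncnS_gt.
pose node (j : nat) : R := acos (Num.sqrt (j%:R / N%:R)).
have node_le j : (j <= N)%N -> 0 <= (j%:R / N%:R : R) <= 1.
  by move=> jN; rewrite divr_ge0//= ler_pdivrMr// mul1r ler_nat.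
have node_itv j : (j <= N)%N -> 0 <= Num.sqrt (j%:R / N%:R : R) <= 1.
  by move=> /node_le/andP[j0 j1]; rewrite sqrtr_ge0 -[leRHS]sqrtr1 ler_wsqrtr.
have cos_node j : (j <= N)%N -> cos (node j) ^+ 2 = j%:R / N%:R.
  move=> jN; have /andP[j0 j1] := node_itv _ jN.
  rewrite acosK ?sqr_sqrtr//.
  by rewrite in_itv /= j1 andbT (le_trans _ j0)// lerN10.
have node_range j : (j <= N)%N -> 0 <= node j <= pi / 2.
  by move=> /node_itv; exact: acos_quarter.
exists (bernstein N (fun j => f (node j))) => t ht; set x := cos t ^+ 2.
have x01 : 0 <= x <= 1 by rewrite sqr_ge0 -(cos2Dsin2 t) lerDl sqr_ge0.
rewrite bernstein_sub.
pose h (j : nat) : R := e / 2 + C / N%:R ^+ 2 * (j%:R + - (N%:R * x)) ^+ 2.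
rewrite (le_trans (bernstein_le (h := h) x01 _))//.
  move=> j jN; rewrite (le_trans (hC _ _ ht (node_range _ jN)))// lerD2l.
  rewrite cos_node// -/x le_eqVlt; apply/orP; left; apply/eqP.
  by field; rewrite gt_eqF.
rewrite bernstein_quadratic subrr expr0n addr0.
have : C / N%:R ^+ 2 * (N%:R * x * (1 - x)) <= C / N%:R.
  rewrite (_ : _ * _ = C / N%:R * (x * (1 - x))); last by field; rewrite gt_eqF.
  rewrite ler_piMr ?divr_ge0 ?(ltW N0)//.
  have /andP[x0 x1] := x01.
  by rewrite mulr_ile1 ?subr_ge0// lerBlDr lerDl.
by lra.
Qed.

End approximation.

(** * Angular averages *)

Section angular_average.
Context (R : realType).

(** Each side is the sum of f over the nonzero entries plus (r - size of the filtered
   sequence) times f 0. *)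
Lemma sum_nonzero_padded (f : R -> R) (s : seq R) (r : nat) :
  (size [seq t <- s | (t != 0)%R] <= r)%N -> (r <= size s)%N ->
  \sum_(i < r) f ([seq t <- s | t != 0]`_i) =
  \sum_(i < size s) f s`_i - (size s - r)%:R * f 0.
Proof.
set s' := [seq t <- s | t != 0] => s'r rs.
have -> : \sum_(i < size s) f s`_i = \sum_(t <- s) f t by rewrite (big_nth 0) big_mkord.
rewrite [in RHS](bigID (fun t => t != 0)) /= -[X in _ = X + _ - _]big_filter -/s'.
have -> : \sum_(t <- s | ~~ (t != 0)) f t = (size s - size s')%:R * f 0.
  rewrite (eq_bigr (fun=> f 0)); last by move=> t; rewrite negbK => /eqP ->.
  rewrite big_const_seq iter_addr addr0 -[LHS]mulr_natl; congr (_%:R * _).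
  by rewrite size_filter -(count_predC (fun t => t != 0) s) addKn.
rewrite -(subnKC s'r) big_split_ord /= (big_nth 0) big_mkord -addrA; congr (_ + _).
rewrite (eq_bigr (fun=> f 0)); last by move=> i _; rewrite nth_default// leq_addr.
rewrite sumr_const card_ord -[X in X = _]mulr_natl -mulrBl -natrB; last by lia.
by congr (_%:R * _); lia.
Qed.

Definition angular_average (f : R -> R) n (k l : 'I_n.+1) (theta : (minn k l).-tuple R) : R :=
  (\sum_(i < minn k l) f theta`_i) / n%:R.

(** The missing angles read as 0 in the list of nonzero angles are among the zero angles
   of theta, so that the two sides differ by an atom at 0 whose mass is deterministic. *)
Lemma integral_angle_measure s n (k l : 'I_n.+1) (E : grassmannian R s k)
    (F : grassmannian R s l) (theta : (minn k l).-tuple R) (f : R -> R) :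
  principal_angles E F theta -> measurable_fun setT f ->
  \int[angle_measure theta]_x f x =
  angular_average f theta - (minn k l - num_angles k l)%:R / n%:R * f 0.
Proof.
move=> h mf; set z := fun i => [seq t <- theta | t != 0]`_i.
have ge0E (g : R -> R) : measurable_fun setT g -> (forall x, 0 <= g x) ->
    (\int[angle_measure theta]_x (g x)%:E =
      ((n%:R)^-1 * \sum_(i < num_angles k l) g (z i))%:E)%E.
  move=> mg g0; have mg' : measurable_fun setT (EFin \o g) by exact/measurable_EFinP.
  have g0' x : setT x -> (0 <= (EFin \o g) x)%E by rewrite lee_fin.
  rewrite /angle_measure (ge0_integral_mscale _ _ _ mg')//=.
  rewrite (ge0_integral_measure_sum _ measurableT g0' mg').
  rewrite EFinM -sumEFin; congr (_ * _)%E; apply: eq_bigr => i _.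
  by rewrite integral_dirac// diracT mul1e.
have -> : \int[angle_measure theta]_x f x = n%:R^-1 * \sum_(i < num_angles k l) f (z i).
  have posE x : (EFin \o f)^\+%E x = (Num.max (f x) 0)%:E.
    by rewrite funeposE EFin_max.
  have negE x : (EFin \o f)^\-%E x = (Num.max (- f x) 0)%:E.
    by rewrite funenegE EFin_max.
  rewrite /Rintegral integralE.
  under eq_integral do rewrite posE.
  under [X in (_ - X)%E]eq_integral do rewrite negE.
  have max0 x : 0 <= Num.max x 0 :> R by rewrite le_max lexx orbT.
  have mp := measurable_funrpos mf; have mn := measurable_funrneg mf.
  rewrite (ge0E _ mp)// (ge0E _ mn)//.
  rewrite /= -mulrBr -sumrB; congr (_ * _); apply: eq_bigr => i _.
  rewrite /funrpos /funrneg.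
  by case: (lerP (f (z i)) 0) => f0; case: (lerP (- f (z i)) 0) => f1; lra.
rewrite sum_nonzero_padded.
- by rewrite size_tuple /angular_average; ring.
- exact: count_nonzero_angles h.
- by rewrite size_tuple /num_angles geq_minl.
Qed.

Lemma angular_average_close s n (k l : 'I_n.+1) (E : grassmannian R s k)
    (F : grassmannian R s l) (theta : (minn k l).-tuple R) (f g : R -> R) e : 0 <= e ->
  principal_angles E F theta ->
  (forall t, 0 <= t <= pi / 2 -> `|f t - g t| <= e) ->
  `|angular_average f theta - angular_average g theta| <= e.
Proof.
move=> e0 h fg; rewrite -mulrBl -sumrB normrM normfV [`|n%:R|]ger0_norm//.
have [n0|n0] := posnP n.
  by rewrite (_ : n%:R = 0) ?invr0 ?mulr0// n0.
rewrite ler_pdivrMr ?ltr0n// (le_trans (ler_norm_sum _ _ _))//.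
apply: (@le_trans _ _ (\sum_(i < minn k l) e)).
  by apply: ler_sum => i _; apply: fg; exact: angles_bounds h _.
rewrite sumr_const card_ord -[leLHS]mulr_natr ler_wpM2l// ler_nat.
by have := ltn_ord k; lia.
Qed.

Lemma angular_average_horner n (k l : 'I_n.+1) (theta : (minn k l).-tuple R) (p : {poly R}) :
  angular_average (fun t => p.[cos t ^+ 2]) theta =
  \sum_(j < size p) p`_j * normalized_moment theta j.
Proof.
rewrite /angular_average mulr_suml /normalized_moment.
under [RHS]eq_bigr do rewrite mulrA mulr_sumr mulr_suml.
rewrite exchange_big /=; apply: eq_bigr => i _.
rewrite horner_coef mulr_suml; apply: eq_bigr => j _.
by rewrite exprM.
Qed.

End angular_average.

Section limit_integral_close.
Context (R : realType) (alpha beta : R).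
Hypotheses (ha : 0 <= alpha <= 1) (hb : 0 <= beta <= 1).
Local Notation mu := (@lebesgue_measure R).

Lemma limit_support_quarter x : limit_support alpha beta x -> 0 <= x <= pi / 2.
Proof.
have rad0 : 0 <= phi_rad alpha beta by exact: sqrtr_ge0.
have pm := phi_minus_ge0 ha hb; have p1 := phi_plus_le1 ha hb.
have range y : 0 <= y <= 1 -> 0 <= acos (Num.sqrt y) <= pi / 2.
  move=> /andP[y0 y1]; apply: acos_quarter.
  by rewrite sqrtr_ge0 -[leRHS]sqrtr1 ler_wsqrtr.
have mp : phi_minus alpha beta <= phi_plus alpha beta by rewrite /phi_minus /phi_plus; lra.
rewrite /limit_support /= in_itv /= => /andP[xl xr].
have /andP[_ h1] : 0 <= acos (Num.sqrt (phi_minus alpha beta)) <= pi / 2.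
  by apply: range; rewrite pm (le_trans mp).
have /andP[h2 _] : 0 <= acos (Num.sqrt (phi_plus alpha beta)) <= pi / 2.
  by apply: range; rewrite (le_trans pm).
by rewrite (le_trans h2)// (le_trans xr).
Qed.

Lemma density_integral_close (f g : R -> R) e C : measurable_fun setT f ->
  measurable_fun setT g -> (forall x, `|f x| <= C) -> (forall x, `|g x| <= C) ->
  (forall t, 0 <= t <= pi / 2 -> `|f t - g t| <= e) ->
  `|density_integral alpha beta f - density_integral alpha beta g| <=
    e * limit_moment alpha beta 0.
Proof.
move=> mf mg fC gC fg; have ms : measurable (limit_support alpha beta : set (measurableTypeR R)) by exact: measurable_itv.
have If := @integrable_gdens R alpha beta ha hb f C mf (fun x _ => fC x).
have Ig := @integrable_gdens R alpha beta ha hb g C mg (fun x _ => gC x).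
have I1 := @integrable_gdens R alpha beta ha hb (fun x => cos x ^+ (2 * 0)) 1.
have {}I1 : mu.-integrable (limit_support alpha beta)
    (EFin \o (fun x => cos x ^+ (2 * 0) * limit_density alpha beta x)).
  apply: I1 => [|x _]; last by rewrite muln0 expr0 normr1.
  by under eq_fun do rewrite muln0 expr0; exact: measurable_cst.
have ID : mu.-integrable (limit_support alpha beta)
    (EFin \o (fun x => f x * limit_density alpha beta x - g x * limit_density alpha beta x)).
  by have H := integrableB ms If Ig; exact H.
rewrite /limit_moment /density_integral -RintegralB// -RintegralZl//.
apply: le_trans (le_normr_Rintegral _ _) _ => //.
apply: le_Rintegral => //.
- exact: integrable_norm ID.
- by have H := integrableZl ms e I1; exact H.
- move=> x sx; rewrite -mulrBl normrM muln0 expr0 mul1r.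
  rewrite [`|limit_density _ _ _|]ger0_norm ?limit_density_ge0//.
  by apply: ler_wpM2r; [exact: limit_density_ge0|exact/fg/limit_support_quarter].
Qed.

Lemma density_integral_horner (p : {poly R}) :
  density_integral alpha beta (fun t => p.[cos t ^+ 2]) =
  \sum_(j < size p) p`_j * limit_moment alpha beta j.
Proof.
have ms : measurable (limit_support alpha beta : set (measurableTypeR R)) by exact: measurable_itv.
have Ij j : mu.-integrable (limit_support alpha beta)
    (EFin \o (fun x => cos x ^+ (2 * j) * limit_density alpha beta x)).
  apply: (@integrable_gdens R alpha beta ha hb (fun x => cos x ^+ (2 * j)) 1).
    by apply: measurable_funX; exact: continuous_measurable_fun (@continuous_cos R).
  by move=> x _; rewrite normrX exprn_ile1// ler_norml cos_geN1 cos_le1.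
transitivity (\int[mu]_(x in limit_support alpha beta)
    \sum_(j < size p) p`_j * (cos x ^+ (2 * j) * limit_density alpha beta x)).
  apply: eq_Rintegral => x _; rewrite horner_coef mulr_suml.
  by apply: eq_bigr => j _; rewrite -exprM -mulrA.
rewrite /limit_moment /density_integral /Rintegral.
under eq_integral do rewrite -sumEFin.
rewrite (integral_sum ms); last by move=> j; have H := integrableZl ms p`_j (Ij j); exact H.
have fE j : (\int[mu]_(x in limit_support alpha beta)
    (p`_j * (cos x ^+ (2 * j) * limit_density alpha beta x))%:E =
    (p`_j * fine (\int[mu]_(x in limit_support alpha beta)
      (cos x ^+ (2 * j) * limit_density alpha beta x)%:E))%:E)%E.
  rewrite EFinM fineK; last exact: integrable_fin_num (Ij j).
  under eq_integral do rewrite EFinM.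
  by rewrite (integralZl ms (Ij j)).
under eq_bigr do rewrite fE.
by rewrite sumEFin.
Qed.

End limit_integral_close.

Lemma cvg_minn_frac (R : realType) (u v : nat -> nat) (x y : R) :
  (u n)%:R / n%:R @[n --> \oo] --> x -> (v n)%:R / n%:R @[n --> \oo] --> y ->
  (minn (u n) (v n))%:R / n%:R @[n --> \oo] --> Num.min x y.
Proof.
move=> ux vy; rewrite minr_absE.
have -> : (fun n => (minn (u n) (v n))%:R / n%:R : R) = fun n =>
    ((u n)%:R / n%:R + (v n)%:R / n%:R - `|(u n)%:R / n%:R - (v n)%:R / n%:R|) / 2.
  apply/funext => n; rewrite -minr_absE -minr_pMl ?invr_ge0//; congr (_ / _).
  by rewrite -natr_min.
apply: cvgM; last exact: cvg_cst.
by apply: cvgB; [exact: cvgD|apply: cvg_norm; exact: cvgB].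
Qed.

Lemma cvg_codim_frac (R : realType) (k : forall n, 'I_n.+1) (x : R) :
  (k n : nat)%:R / n%:R @[n --> \oo] --> x ->
  (n - k n)%:R / n%:R @[n --> \oo] --> 1 - x.
Proof.
move=> kx; apply: (@cvg_trans _ ((1 - (k n : nat)%:R / n%:R : R) @[n --> \oo])); last first.
  by apply: cvgB => //; exact: cvg_cst.
apply: near_eq_cvg; near=> n.
have n0 : (0 < n)%N by near: n; exact: nbhs_infty_gt.
by rewrite natrB -1?ltnS// mulrBl divff// pnatr_eq0 -lt0n.
Unshelve. all: by end_near. Qed.

Section convergence_criteria.
Context (R : realType) (d : nat -> measure_display) (T : forall n, measurableType (d n))
  (P : forall n, probability (T n) R).

(** Approximation also provides the measurability of W, as a pointwise limit. *)
Lemma cvg_in_mean_approx (W : forall n, T n -> R) (c : R) :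
  (forall e, 0 < e -> exists Z z, [/\ cvg_in_mean P Z z,
     forall n w, `|W n w - Z n w| <= e & `|c - z| <= e]) -> cvg_in_mean P W c.
Proof.
move=> h.
have mW n : measurable_fun setT (W n).
  have hm m : exists Z : T n -> R, measurable_fun setT Z /\
      forall w, `|W n w - Z w| <= m.+1%:R^-1.
    have [|Z [z [[mZ _ _] WZ _]]] := h m.+1%:R^-1; first by rewrite invr_gt0.
    by exists (Z n).
  have [Z hZ] := choice hm.
  apply: (measurable_fun_cvg (h := Z)) => [m|w _]; first by case: (hZ m).
  apply/cvgrPdist_le => e e0; near=> m.
  have [_ /(_ w) hw] := hZ m; apply: (le_trans hw).
  by apply/ltW; near: m; exact: (near_infty_natSinv_lt (PosNum e0)).
have bW : exists B, forall n w, `|W n w| <= B.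
  have [//|Z [z [[_ [B hB] _] WZ _]]] := h 1.
  exists (1 + B) => n w; rewrite -(subrK (Z n w) (W n w)).
  by rewrite (le_trans (ler_normD _ _))// lerD.
split => //.
have bmW n : bounded_measurable (W n).
  by split => //; have [B hB] := bW; exists B => w; exact: hB.
apply/cvgrPdist_le => e e0.
have [|Z [z [hZ WZ cz]]] := h (e / 3); first by rewrite divr_gt0.
have [_ _ Z0] := hZ.
have e3 : 0 < e / 3 by rewrite divr_gt0.
move/cvgrPdist_le : Z0 => /(_ _ e3) Z0.
near=> n.
have hn : `|0 - \int[P n]_w `|Z n w - z| | <= e / 3 by near: n.
have bZ := bounded_measurable_dist n hZ.
have bc := bounded_measurable_cst (T n) (2 * (e / 3)).
rewrite sub0r normrN ger0_norm; last by apply: Rintegral_ge0 => w _.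
apply: (@le_trans _ _ (\int[P n]_w (2 * (e / 3) + `|Z n w - z|))).
  apply: le_mean.
  - apply: bounded_measurable_norm; apply: bounded_measurableB => //.
    exact: bounded_measurable_cst.
  - exact: bounded_measurableD.
  - move=> w.
    rewrite (_ : W n w - c = (W n w - Z n w) + (Z n w - z) - (c - z)); last by ring.
    rewrite (le_trans (ler_normB _ _))//.
    have h1 := ler_normD (W n w - Z n w) (Z n w - z).
    by have := WZ n w; lra.
rewrite meanD// mean_cst.
by move: hn; rewrite sub0r normrN => /(le_trans (ler_norm _)); lra.
Unshelve. all: by end_near. Qed.

(** By Markov's inequality. *)
Lemma cvg_in_mean_probability (W : forall n, T n -> R) (c e : R) : 0 < e ->
  cvg_in_mean P W c ->
  P n [set w | e <= `|W n w - c|] @[n --> \oo] --> 0%E.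
Proof.
move=> e0 hW; have [mW _ W0] := hW.
have bW n := bounded_measurable_dist n hW.
have mE n : measurable [set w | e <= `|W n w - c|].
  have [m _] := bW n; have := measurable_fun_ler (measurable_cst e) m.
  move=> /(_ measurableT [set true] I); rewrite setTI.
  by rewrite (_ : _ @^-1` _ = [set w | e <= `|W n w - c|]).
have le n : (P n [set w | (e <= `|W n w - c|)%R] <=
    (e^-1 * \int[P n]_w `|W n w - c|)%:E)%E.
  rewrite EFinM -lee_pdivrMl ?invr_gt0// invrK.
  have [mD _] := bW n; have iD := bounded_measurable_integrable (P n) (bW n).
  rewrite /Rintegral fineK; last exact: integrable_fin_num iD.
  have := @le_integral_comp_abse _ _ _ (P n) setT measurableT
    (fun w => `|W n w - c|%:E) e id (@measurable_id _ _ _) (fun _ => id) (fun _ _ _ _ => id)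
    (proj2 (measurable_EFinP _ _) mD) e0.
  rewrite setTI.
  under eq_set do rewrite /= normr_id lee_fin.
  by under eq_integral do rewrite /= normr_id.
apply: (squeeze_cvge (f := fun=> 0%E)
  (h := fun n => (e^-1 * \int[P n]_w `|W n w - c|)%:E)).
- by apply: nearW => n; rewrite measure_ge0 le.
- exact: cvg_cst.
- apply/cvg_EFin; first exact: nearW.
  rewrite -[X in _ --> X](mulr0 e^-1).
  by apply: cvgM => //; exact: cvg_cst.
Qed.

End convergence_criteria.

Section angle_measure_convergence.
Context (R : realType) (s : scalar_kind) (alpha beta : R)
    (ha : 0 <= alpha <= 1) (hb : 0 <= beta <= 1).
Context (k l : forall n : nat, 'I_n.+1)
    (hk : ((k n : nat)%:R / n%:R : R) @[n --> \oo] --> alpha)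
    (hl : ((l n : nat)%:R / n%:R : R) @[n --> \oo] --> beta)
    (d : nat -> measure_display) (T : forall n, measurableType (d n))
    (P : forall n, probability (T n) R)
    (E : forall n, {mfun T n >-> grassmannian R s (k n)})
    (F : forall n, {mfun T n >-> grassmannian R s (l n)})
    (hE : forall n, is_haar_measure (distribution (P n) (E n)))
    (hEF : forall n, independent_variables (P n) (E n) (F n))
    (theta : forall n, T n -> (minn (k n) (l n)).-tuple R)
    (htheta : forall n w, principal_angles (E n w) (F n w) (theta n w)).

Lemma limit_moment0_min :
  limit_moment alpha beta 0 + forced_zero_mass alpha beta = Num.min alpha beta.
Proof.
rewrite (limit_moment0 ha hb) /forced_zero_mass.
case: (lerP alpha beta) => h1; case: (lerP (1 - alpha) (1 - beta)) => h2;
  try (exfalso; lra); case: lerP => h3; case: lerP => h4; lra.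
Qed.

Lemma cvg_in_mean_horner (p : {poly R}) :
  cvg_in_mean P (fun n w => angular_average (fun t => p.[cos t ^+ 2]) (@theta n w))
    (density_integral alpha beta (fun t => p.[cos t ^+ 2]) +
     forced_zero_mass alpha beta * p.[1]).
Proof.
rewrite density_integral_horner// horner_coef mulr_sumr -big_split /=.
rewrite (_ : (fun n w => _) = fun n w =>
  \sum_(j < size p) p`_j * normalized_moment (@theta n w) j); last first.
  apply/functional_extensionality_dep => n; apply/funext => w.
  exact: angular_average_horner.
apply: cvg_in_mean_sum => j; rewrite expr1n mulr1 [_ * p`_j]mulrC -mulrDr.
apply: cvg_in_meanM; first exact: cvg_in_mean_cst.
case: (j : nat) => [|m].
  rewrite limit_moment0_min (_ : (fun n w => _) =
    fun n _ => (minn (k n) (l n))%:R / n%:R); last first.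
    apply/functional_extensionality_dep => n; apply/funext => w.
    rewrite /normalized_moment; congr (_ / _).
    by under eq_bigr do rewrite muln0 expr0; rewrite sumr_const card_ord.
  apply: cvg_in_mean_seq; last exact: cvg_minn_frac.
  exists 1 => n; rewrite ger0_norm ?divr_ge0//.
  have [->|n0] := posnP n; first by rewrite invr0 mulr0.
  by rewrite ler_pdivrMr ?ltr0n// mul1r ler_nat geq_min -ltnS ltn_ord.
apply: (cvg_in_mean_moment hk hl hE hEF htheta
  (c := fun j => limit_moment alpha beta j + forced_zero_mass alpha beta)) => i.
exact: limit_moment_loop.
Qed.

(** Uniform approximation by polynomials in cos^2, which the angular average and the
   integral against the limit both respect. *)
Lemma cvg_in_mean_average (f : R -> R) : continuous f -> (exists M, forall x, `|f x| <= M) ->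
  cvg_in_mean P (fun n w => angular_average f (@theta n w))
    (density_integral alpha beta f + forced_zero_mass alpha beta * f 0).
Proof.
move=> cf bf; apply: cvg_in_mean_approx => e e0.
have [p hp] := cos2_polynomial_approximation cf bf e0.
exists (fun n w => angular_average (fun t => p.[cos t ^+ 2]) (@theta n w)).
exists (density_integral alpha beta (fun t => p.[cos t ^+ 2]) +
     forced_zero_mass alpha beta * p.[1]).
split; first exact: cvg_in_mean_horner.
  by move=> n w; apply: angular_average_close (ltW e0) (@htheta n w) hp.
have [M hM] := bf.
set g := fun t : R => p.[cos t ^+ 2].
have cg : continuous g.
  move=> x; apply: (@continuous_comp _ _ _ (fun t : R => cos t ^+ 2) (horner p)).
    apply: (@continuous_comp _ _ _ (@cos R) (fun x => x ^+ 2)).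
      exact: continuous_cos.
    exact: exprn_continuous.
  exact: continuous_horner.
have mg : measurable_fun setT g := continuous_measurable_fun cg.
have bg : exists C, forall x, `|g x| <= C.
  exists (\sum_(j < size p) `|p`_j|) => x; rewrite /g horner_coef.
  rewrite (le_trans (ler_norm_sum _ _ _))// ler_sum// => j _.
  rewrite normrM -exprM ler_piMr// normrX exprn_ile1// ler_norml.
  by rewrite cos_geN1 cos_le1.
have [C hC] := bg.
have := @density_integral_close R alpha beta ha hb f g e (Num.max M C)
  (continuous_measurable_fun cf) mg.
have fM x : `|f x| <= Num.max M C by rewrite le_max hM.
have gM x : `|g x| <= Num.max M C by rewrite le_max hC orbT.
move=> /(_ fM gM hp) h1.
have z0 : 0 <= forced_zero_mass alpha beta by rewrite /forced_zero_mass le_max lexx orbT.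
have h2 : `|forced_zero_mass alpha beta * (f 0 - p.[1])| <= forced_zero_mass alpha beta * e.
  rewrite normrM ger0_norm// ler_wpM2l//.
  by have := hp 0; rewrite cos0 expr1n lexx divr_ge0 ?pi_ge0//; apply.
rewrite opprD addrACA -mulrBr (le_trans (ler_normD _ _))//.
rewrite (le_trans (lerD h1 h2))// [e * _]mulrC -mulrDl limit_moment0_min.
by rewrite ler_piMl ?(ltW e0)// ge_min; case/andP: ha => _ ->.
Qed.

Lemma angle_measure_cvg : cvg_weakly_in_probability P
  (fun n w => angle_measure (@theta n w)) (limit_measure ha hb).
Proof.
move=> f cf bf e e0; have mf := continuous_measurable_fun cf.
have [M hM] := bf; rewrite (integral_limit_measure ha hb mf hM).
apply: cvg_in_mean_probability e0 _.
rewrite (_ : (fun n w => _) = fun n w => angular_average f (@theta n w) -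
    (minn (k n) (l n) - num_angles (k n) (l n))%:R / n%:R * f 0); last first.
  apply/functional_extensionality_dep => n; apply/funext => w.
  exact: integral_angle_measure (@htheta n w) mf.
have -> : density_integral alpha beta f =
  (density_integral alpha beta f + forced_zero_mass alpha beta * f 0) -
    (Num.min alpha beta - limit_moment alpha beta 0) * f 0.
  by rewrite -limit_moment0_min; ring.
apply: cvg_in_meanB; first exact: cvg_in_mean_average.
have frac n : (minn (k n) (l n) - num_angles (k n) (l n))%:R / n%:R =
    (minn (k n) (l n))%:R / n%:R - (num_angles (k n) (l n))%:R / n%:R :> R.
  by rewrite natrB ?mulrBl// /num_angles geq_minl.
apply: cvg_in_meanM; last exact: cvg_in_mean_cst.
apply: cvg_in_mean_seq.
  exists 1 => n; rewrite ger0_norm ?divr_ge0//.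
  have [->|n0] := posnP n; first by rewrite invr0 mulr0.
  by rewrite ler_pdivrMr ?ltr0n// mul1r ler_nat; have := ltn_ord (k n); lia.
under eq_fun do rewrite frac.
apply: cvgB; first exact: cvg_minn_frac.
rewrite (limit_moment0 ha hb); apply: cvg_minn_frac; first exact: cvg_minn_frac.
by apply: cvg_minn_frac; exact: cvg_codim_frac.
Qed.

End angle_measure_convergence.

Theorem theorem2 (R : realType) (s : scalar_kind)
    (alpha beta : R) (ha : 0 <= alpha <= 1) (hb : 0 <= beta <= 1)
    (k l : forall n : nat, 'I_n.+1)
    (hk : ((k n : nat)%:R / n%:R : R) @[n --> \oo] --> alpha)
    (hl : ((l n : nat)%:R / n%:R : R) @[n --> \oo] --> beta)
    (d : nat -> measure_display) (T : forall n, measurableType (d n))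
    (P : forall n, probability (T n) R)
    (E : forall n, {mfun T n >-> grassmannian R s (k n)})
    (F : forall n, {mfun T n >-> grassmannian R s (l n)})
    (hE : forall n, is_haar_measure (distribution (P n) (E n)))
    (hF : forall n, is_haar_measure (distribution (P n) (F n)))
    (hEF : forall n, independent_variables (P n) (E n) (F n))
    (theta : forall n, T n -> (minn (k n) (l n)).-tuple R)
    (htheta : forall n w, principal_angles (E n w) (F n w) (theta n w)) :
  cvg_weakly_in_probability P (fun n w => angle_measure (theta n w))
    (limit_measure ha hb) /\
  limit_measure ha hb [set: R] =
    (Num.min (Num.min alpha beta) (Num.min (1 - alpha) (1 - beta)))%:E.
Proof.
split; first exact: angle_measure_cvg htheta.
by rewrite limit_measure_setT limit_moment0.
Qed.
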